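(* Let $d=O(1)$ and let $P\subset\mathbb{R}^d$ be a set of $n$ points with bounded ratio and bounded expansion constant $\gamma\ge 2$, in which every coordinate of every point is unique. Then the zd-tree of $P$ can be built using $O(n)$ work and $O(n^{\epsilon})$ span (for some constant $\epsilon<1$) in the binary fork-join model, and the resulting tree has height $O(\log n)$.
   Context: Bounded ratio: with $d_{\max}$ and $d_{\min}$ the maximum and minimum distances between two points of $P$, $d_{\max}/d_{\min}=\mathrm{poly}(n)$. Expansion constant: $P$ is contained in a bounded region $X$; for $x\in X$ and $r>0$ let $\mathrm{box}(x,r)$ be the axis-parallel box centered at $x$ with half side length $r$; $P$ has expansion constant $\gamma$ if for all $x\in X$ and all $r>0$, whenever $|\mathrm{box}(x,r)\cap P|=k>1$ then $|\mathrm{box}(x,2r)\cap P|\le\gamma k$; it is bounded if $\gamma=O(1)$. zd-tree: all points are first shifted by a random offset in each coordinate (the same offset for all points) and mapped to integer coordinates; the Morton code of a point interleaves the binary digits of its coordinates, and points are sorted by Morton code. The zd-tree is a binary tree whose root corresponds to the bounding box of the shifted points; a node at depth $i$ splits its box in half according to the $i$-th most significant bit of the Morton code (i.e. halving along the coordinates in cyclic order), the children receiving the points with that bit $0$ resp. $1$; recursion stops (creating a leaf, storing its points) when the bits are exhausted or the number of points is below a constant cutoff. Binary fork-join model: work is the total number of operations, span is the length of the longest chain of dependencies, where a process may fork two parallel child processes and wait for both. *)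

(* Defs.v *)
From mathcomp Require Import all_boot all_order all_algebra.
From mathcomp Require Import all_classical all_reals all_analysis.

Set Implicit Arguments.
Unset Strict Implicit.
Unset Printing Implicit Defensive.

Import Order.TTheory GRing.Theory Num.Theory.
Import numFieldNormedType.Exports.

(** * Point sets

    A set of n points of R^d is an injective family [P : 'I_n -> 'rV[R]_d]; the
    indexing is the (arbitrary) order in which the points are given. *)

Section PointSets.
Local Open Scope ring_scope.
Context {R : realType} {d n : nat}.
Implicit Types (x y : 'rV[R]_d) (P : 'I_n -> 'rV[R]_d).

Definition edist x y : R := Num.sqrt (\sum_(c < d) (x 0 c - y 0 c) ^+ 2).

Definition dmax P : R := \big[Num.max/0]_i \big[Num.max/0]_j edist (P i) (P j).

(* Starting the minimum from [dmax P] is harmless as soon as 1 < n. *)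
Definition dmin P : R :=
  \big[Num.min/dmax P]_(ij : 'I_n * 'I_n | ij.1 != ij.2)
    edist (P ij.1) (P ij.2).

Definition unique_coordinates P : Prop :=
  forall (i j : 'I_n) (c : 'I_d), P i 0 c = P j 0 c -> i = j.

Definition in_box x (r : R) y : bool := [forall c, `|y 0 c - x 0 c| <= r].

Definition box_count P x (r : R) : nat := #|[pred i | in_box x r (P i)]|.

Definition has_expansion P (X : set 'rV[R]_d) (gamma : R) : Prop :=
  forall x r, X x -> 0 < r -> (1 < box_count P x r)%N ->
    (box_count P x (2 * r))%:R <= gamma * (box_count P x r)%:R.

(* The offset is given by the point [o] that becomes the origin, i.e. p is
   shifted to p - o.  The shift brings P into the positive orthant, in a cube
   of twice the diameter, so that [o] has a range of order [dmax P] in each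
   coordinate. *)
Definition valid_offset P (o : 'rV[R]_d) : Prop :=
  forall i c, 0 <= P i 0 c - o 0 c <= 2 * dmax P.

Definition grid P (o : 'rV[R]_d) (g : R) (i : 'I_n) : 'rV[nat]_d :=
  \row_c Num.truncn ((P i 0 c - o 0 c) / g).

End PointSets.

(** * zd-trees *)

Definition bit (k x : nat) : bool := odd (x %/ 2 ^ k).

(* Number of binary digits of the largest coordinate: [0, 2 ^ nbits z)^d is the
   smallest dyadic cube at the origin that contains all the points, and is the
   box of the root. *)
Definition nbits (n d : nat) (z : 'I_n -> 'rV[nat]_d) : nat :=
  up_log 2 (\max_(i < n) \max_(c < d) z i ord0 c).+1.

(* Digit j of coordinate c has weight 2 ^ (j * d + (d - 1 - c)), so that from
   the most significant bit on the coordinates occur in the order 0, ..., d-1,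
   0, ..., d-1, ... *)
Definition morton (b d : nat) (v : 'rV[nat]_d) : nat :=
  \sum_(j < b) \sum_(c < d) bit j (v ord0 c) * 2 ^ (j * d + (d.-1 - c)).

Inductive zdtree (T : Type) : Type :=
| Leaf of seq T
| Node of zdtree T & zdtree T.

Fixpoint height T (t : zdtree T) : nat :=
  match t with
  | Leaf _ => 0
  | Node l r => (maxn (height l) (height r)).+1
  end.

(* [m] is the number of bits of the Morton codes not consumed yet. *)
Fixpoint zd_build T (code : T -> nat) (cutoff m : nat) (s : seq T) : zdtree T :=
  match m with
  | 0 => Leaf s
  | m'.+1 =>
      if size s < cutoff then Leaf s
      else Node (zd_build code cutoff m' [seq x <- s | ~~ bit m' (code x)])
                (zd_build code cutoff m' [seq x <- s | bit m' (code x)])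
  end.

Definition zdtree_of (n d : nat) (cutoff : nat) (z : 'I_n -> 'rV[nat]_d) :
    zdtree 'I_n :=
  let b := nbits z in
  let code i := morton b (z i) in
  zd_build code cutoff (b * d) (sort (relpre code leq) (enum 'I_n)).

(* The resolution of the grid is free, but distinct points must be mapped to
   distinct integer points. *)
Definition is_zdtree (R : realType) (d n : nat) (P : 'I_n -> 'rV[R]_d)
    (o : 'rV[R]_d) (cutoff : nat) (t : zdtree 'I_n) : Prop :=
  exists g : R, [/\ (0 < g)%R, injective (grid P o g)
                  & t = zdtree_of cutoff (grid P o g)].

(** * Binary fork-join machine

    A word RAM with words < M and shared memory, in which a process may fork two
    children and wait for both.  A process has its own registers.  The real
    input is a read-only memory whose cells can only be compared or rounded to
    words: unit-cost arithmetic on stored reals would allow packing many words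
    into one real. *)

Inductive wop := Add | Sub | Mul | Div | Mod | And | Or | Xor | Shl | Shr
               | Eq | Le.

Definition weval (f : wop) (x y : nat) : nat :=
  match f with
  | Add => x + y | Sub => x - y | Mul => x * y | Div => x %/ y | Mod => x %% y
  | And => Nat.land x y | Or => Nat.lor x y | Xor => Nat.lxor x y
  | Shl => x * 2 ^ y | Shr => x %/ 2 ^ y
  | Eq => x == y | Le => x <= y
  end.

(* All arguments are register numbers, except the word [k] of [Const] and the
   procedure index of [Call].  [Call] runs in the registers of the caller; a
   child of [Fork] runs in a copy of those of its parent. *)
Inductive cmd :=
| Skip
| Const (x k : nat)
| Op (f : wop) (x y z : nat)
| Read (x a : nat)
| Write (a y : nat)
| RealLe (x a1 a2 a3 a4 : nat)
| RealRound (x k a1 a2 a3 a4 : nat)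
| Seq (c1 c2 : cmd)
| If (x : nat) (c1 c2 : cmd)
| While (x : nat) (c : cmd)
| Call (p : nat)
| Fork (c1 c2 : cmd).

Definition program := seq cmd.

Definition upd (f : nat -> nat) (a v : nat) : nat -> nat :=
  fun b => if b == a then v else f b.

Section Semantics.
Local Open Scope classical_set_scope.

(* [exec M inp pr c rho h rho' h' W S A U]: from registers [rho] and memory [h],
   [c] ends in [rho'] and [h'], with work W and span S, having accessed the
   memory cells in A and written those in U.  Results that do not fit in a word
   have no execution.  The children of a fork may not race: neither accesses a
   cell written by the other, so that all their interleavings agree with the
   sequential execution used in [ExecFork]. *)
Inductive exec (R : realType) (M : nat) (inp : nat -> R) (pr : program) :
    cmd -> (nat -> nat) -> (nat -> nat) -> (nat -> nat) -> (nat -> nat) ->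
    nat -> nat -> set nat -> set nat -> Prop :=
| ExecSkip rho h :
    exec M inp pr Skip rho h rho h 1 1 set0 set0
| ExecConst x k rho h : (k < M)%N ->
    exec M inp pr (Const x k) rho h (upd rho x k) h 1 1 set0 set0
| ExecOp f x y z rho h : (weval f (rho y) (rho z) < M)%N ->
    exec M inp pr (Op f x y z) rho h
      (upd rho x (weval f (rho y) (rho z))) h 1 1 set0 set0
| ExecRead x a rho h :
    exec M inp pr (Read x a) rho h
      (upd rho x (h (rho a))) h 1 1 [set rho a] set0
| ExecWrite a y rho h :
    exec M inp pr (Write a y) rho h
      rho (upd h (rho a) (rho y)) 1 1 [set rho a] [set rho a]
| ExecRealLe x a1 a2 a3 a4 rho h :
    let b := (inp (rho a1) - inp (rho a2) <= inp (rho a3) - inp (rho a4))%R in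
    exec M inp pr (RealLe x a1 a2 a3 a4) rho h
      (upd rho x (nat_of_bool b)) h 1 1 set0 set0
| ExecRealRound x k a1 a2 a3 a4 rho h :
    let q := Num.truncn ((rho k)%:R * (inp (rho a1) - inp (rho a2))
                         / (inp (rho a3) - inp (rho a4)))%R in
    (q < M)%N ->
    exec M inp pr (RealRound x k a1 a2 a3 a4) rho h
      (upd rho x q) h 1 1 set0 set0
| ExecSeq c1 c2 rho h rho1 h1 rho2 h2 W1 W2 S1 S2 A1 A2 U1 U2 :
    exec M inp pr c1 rho h rho1 h1 W1 S1 A1 U1 ->
    exec M inp pr c2 rho1 h1 rho2 h2 W2 S2 A2 U2 ->
    exec M inp pr (Seq c1 c2) rho h rho2 h2
      (W1 + W2) (S1 + S2) (A1 `|` A2) (U1 `|` U2)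
| ExecIf x c1 c2 rho h rho' h' W S A U :
    exec M inp pr (if rho x != 0 then c1 else c2) rho h rho' h' W S A U ->
    exec M inp pr (If x c1 c2) rho h rho' h' W.+1 S.+1 A U
| ExecWhileEnd x c rho h : rho x = 0 ->
    exec M inp pr (While x c) rho h rho h 1 1 set0 set0
| ExecWhile x c rho h rho' h' W S A U : rho x <> 0 ->
    exec M inp pr (Seq c (While x c)) rho h rho' h' W S A U ->
    exec M inp pr (While x c) rho h rho' h' W.+1 S.+1 A U
| ExecCall p rho h rho' h' W S A U :
    exec M inp pr (nth Skip pr p) rho h rho' h' W S A U ->
    exec M inp pr (Call p) rho h rho' h' W.+1 S.+1 A U
| ExecFork c1 c2 rho h rho1 h1 rho2 h2 W1 W2 S1 S2 A1 A2 U1 U2 :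
    exec M inp pr c1 rho h rho1 h1 W1 S1 A1 U1 ->
    exec M inp pr c2 rho h1 rho2 h2 W2 S2 A2 U2 ->
    U1 `&` A2 = set0 -> A1 `&` U2 = set0 ->
    exec M inp pr (Fork c1 c2) rho h rho h2
      (W1 + W2).+1 (maxn S1 S2).+1 (A1 `|` A2) (U1 `|` U2).

End Semantics.

Definition input_layout (R : realType) (d n : nat) (P : 'I_n -> 'rV[R]_d)
    (o : 'rV[R]_d) (inp : nat -> R) : Prop :=
  (forall (i : 'I_n) (c : 'I_d), inp (i * d + c) = P i ord0 c) /\
  (forall c : 'I_d, inp (n * d + c) = o ord0 c).

(* A leaf is a cell 0 followed by the number of its points and the address of an
   array of their indices; an internal node is a cell 1 followed by the
   addresses of its children. *)
Fixpoint represents (n : nat) (h : nat -> nat) (p : nat) (t : zdtree 'I_n) :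
    Prop :=
  match t with
  | Leaf s =>
      [/\ h p = 0, h p.+1 = size s
        & [seq h (h p.+2 + j) | j <- iota 0 (size s)] = [seq val i | i <- s]]
  | Node l r =>
      [/\ h p = 1, represents h (h p.+1) l & represents h (h p.+2) r]
  end.

(* Words have [kappa * up_log 2 n] bits.  The machine starts with procedure 0,
   the value n in register 0 and zeros elsewhere, and ends with the address of
   the root in register 0. *)
Definition builds (R : realType) (d n : nat) (kappa : nat) (pr : program)
    (P : 'I_n -> 'rV[R]_d) (o : 'rV[R]_d) (t : zdtree 'I_n) (W S : nat) : Prop :=
  forall inp : nat -> R, input_layout P o inp ->
  exists (rho h : nat -> nat) (A U : set nat),
    exec (2 ^ (kappa * up_log 2 n)) inp pr (Call 0)
      (upd (fun=> 0) 0 n) (fun=> 0) rho h W S A U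
    /\ represents h (rho 0) t.

(* Main.v *)
(* The points are rounded to a grid whose mesh is the largest coordinate
   difference between the first two points divided by a power of n; by the bounded
   ratio, this separates the points and leaves O(log n) bits per coordinate.  The
   Morton codes are computed from a table of spread digits of (log n)/2 bits and
   sorted by a constant number of passes of a stable parallel counting sort with
   such digits, in O(n) work and O(sqrt n) span.  A node of the tree is a segment
   of the sorted array and a binary search splits it, so k points at a node cost
   O(log k), in parallel for all the nodes of a level.

   The sum of log k over the nodes is linear by the expansion.  Since coordinates
   are unique, the first box around a point of X that contains two points has at
   most 2 d + 1 of them.  Hence at the scales where the box around a point p of P
   has more than gamma ^ 2 (2 d + 1) points, the disjoint box around another point
   of X, which exists because X is connected, has a constant fraction of that
   number, and the number of points around p grows by a constant factor every
   second scale.  The contributions 1 / sqrt k of p to the nodes of k >= cutoff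
   points around it thus form a geometric series, and summing them over p bounds
   the sum of sqrt k over the nodes, which dominates that of log k. *)
Require Import Defs.
From mathcomp Require Import all_boot all_order all_algebra.
From mathcomp Require Import all_classical all_reals all_analysis.
From mathcomp Require Import zify ring lra.
From Stdlib Require PeanoNat.
Import Order.TTheory GRing.Theory Num.Theory.
Import numFieldNormedType.Exports.

Set Implicit Arguments.
Unset Strict Implicit.
Unset Printing Implicit Defensive.


(** * Hoare logic with work and span *)

Arguments upd f a v b /.

(** The overview speaks of the nodes around a point as if their boxes were centered at it. The two
    can differ badly: a point near the boundary of its node may have few companions inside and many
    across the boundary. As the bound is proved for every valid offset, no randomness excludes this,
    and the comparison is made on average. Each of the k points of a node spreads its share over the
    points of the surrounding centered box, divided by k; since boundedly many dyadic cubes of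
    comparable size lie near a given point, every point receives a bounded multiple of the weight of
    its own centered box. The square root dominates the logarithm, while a share of 1 / sqrt k per
    point still decays geometrically when the counts grow.

    For the machine, [builds] fixes work and span before the real input is given, and only the cells
    of the points and the offset are determined by [input_layout]. Hence executions are shown to
    keep their cost under all changes of the other cells. Since children of a fork may not race,
    every judgment also carries the sets of cells accessed and written. *)

Inductive expr :=
| Reg (x : nat)
| Cst (k : nat)
| Bin (f : wop) (e1 e2 : expr)
| Fetch (e : expr)
| DistLe (a1 a2 a3 a4 : expr)
| Round (k a1 a2 a3 a4 : expr).

(* Registers from this one on hold intermediate values of expressions. *)
Definition nregs := 32.

(** The registers from [t] on serve as an evaluation stack. There is no move instruction; [And] of a
    register with itself copies it. *)
Fixpoint comp (t : nat) (e : expr) : cmd :=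
  match e with
  | Reg x => Op And t x x
  | Cst k => Const t k
  | Bin f e1 e2 => Seq (comp t e1) (Seq (comp t.+1 e2) (Op f t t t.+1))
  | Fetch e => Seq (comp t e) (Read t t)
  | DistLe a1 a2 a3 a4 =>
      Seq (comp t a1) (Seq (comp t.+1 a2) (Seq (comp t.+2 a3)
        (Seq (comp t.+3 a4) (RealLe t t t.+1 t.+2 t.+3))))
  | Round k a1 a2 a3 a4 =>
      Seq (comp t k) (Seq (comp t.+1 a1) (Seq (comp t.+2 a2) (Seq (comp t.+3 a3)
        (Seq (comp t.+4 a4) (RealRound t t t.+1 t.+2 t.+3 t.+4)))))
  end.

Fixpoint cost (e : expr) : nat :=
  match e with
  | Reg _ | Cst _ => 1
  | Bin _ e1 e2 => (cost e1 + cost e2).+1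
  | Fetch e => (cost e).+1
  | DistLe a1 a2 a3 a4 => (cost a1 + cost a2 + cost a3 + cost a4).+1
  | Round k a1 a2 a3 a4 =>
      (cost k + cost a1 + cost a2 + cost a3 + cost a4).+1
  end.

Definition Asg x e := Seq (comp nregs e) (Op And x nregs nregs).
Definition Sto ea e :=
  Seq (comp nregs ea) (Seq (comp nregs.+1 e) (Write nregs nregs.+1)).
Definition IfE e c1 c2 := Seq (comp nregs e) (If nregs c1 c2).
Definition WhE e c :=
  Seq (comp nregs e) (While nregs (Seq c (comp nregs e))).

Section Hoare.
Local Open Scope classical_set_scope.
Context {R : realType} {M : nat} {inp : nat -> R} {D : set nat} {pr : program}.
Implicit Types (r rho h : nat -> nat) (A U : set nat).
Implicit Types (Q : (nat -> nat) -> (nat -> nat) -> Prop).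

Fixpoint eval r h (e : expr) : nat :=
  match e with
  | Reg x => r x
  | Cst k => k
  | Bin f e1 e2 => weval f (eval r h e1) (eval r h e2)
  | Fetch e => h (eval r h e)
  | DistLe a1 a2 a3 a4 =>
      (inp (eval r h a1) - inp (eval r h a2)
         <= inp (eval r h a3) - inp (eval r h a4))%R
  | Round k a1 a2 a3 a4 =>
      Num.truncn ((eval r h k)%:R * (inp (eval r h a1) - inp (eval r h a2))
                  / (inp (eval r h a3) - inp (eval r h a4)))%R
  end.

(** Copying a register is an [Op], whose result must be a word; hence a bound even for [Reg]. The
    sets [A] and [D] confine the memory cells and the reals that are read. *)
Fixpoint ok r h A (e : expr) : Prop :=
  match e with
  | Reg x => (x < nregs)%N /\ (r x < M)%N
  | Cst k => (k < M)%N
  | Bin f e1 e2 =>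
      [/\ ok r h A e1, ok r h A e2
        & (weval f (eval r h e1) (eval r h e2) < M)%N]
  | Fetch e => ok r h A e /\ A (eval r h e)
  | DistLe a1 a2 a3 a4 =>
      [/\ ok r h A a1, ok r h A a2, ok r h A a3 & ok r h A a4] /\
      [/\ D (eval r h a1), D (eval r h a2), D (eval r h a3) & D (eval r h a4)]
  | Round k a1 a2 a3 a4 =>
      [/\ ok r h A k, ok r h A a1, ok r h A a2, ok r h A a3 & ok r h A a4] /\
      [/\ D (eval r h a1), D (eval r h a2), D (eval r h a3), D (eval r h a4)
        & (eval r h (Round k a1 a2 a3 a4) < M)%N]
  end.

Definition agree r r' := forall x, (x < nregs)%N -> r x = r' x.

(* The cost of an execution may depend on the real inputs in [D] only. *)
Definition uexec c rho h rho' h' W S A U := forall inp' : nat -> R,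
  (forall x, D x -> inp' x = inp x) ->
  exec M inp' pr c rho h rho' h' W S A U.

Definition computes c rho h rho' h' w s A U :=
  exists W S A' U', uexec c rho h rho' h' W S A' U' /\
    [/\ (W <= w)%N, (S <= s)%N, A' `<=` A & U' `<=` U].

(** Total correctness with resource bounds. Assertions see a register file [r] that agrees with the
    actual one below [nregs] only, so the evaluation stack never occurs in them. *)
Definition hoare c r h w s A U Q := forall rho, agree rho r ->
  exists rho' r' h', [/\ computes c rho h rho' h' w s A U, agree rho' r'
    & Q r' h'].

Lemma computes_seq c1 c2 rho h rho1 h1 rho2 h2 w1 s1 w2 s2 A U :
  computes c1 rho h rho1 h1 w1 s1 A U ->
  computes c2 rho1 h1 rho2 h2 w2 s2 A U ->
  computes (Seq c1 c2) rho h rho2 h2 (w1 + w2) (s1 + s2) A U.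
Proof.
move=> [W1 [S1 [A1 [U1 [E1 [HW1 HS1 HA1 HU1]]]]]].
move=> [W2 [S2 [A2 [U2 [E2 [HW2 HS2 HA2 HU2]]]]]].
exists (W1 + W2), (S1 + S2), (A1 `|` A2), (U1 `|` U2); split.
  by move=> inp' ag; exact: ExecSeq (E1 _ ag) (E2 _ ag).
split; try lia.
- by move=> x [/HA1|/HA2].
- by move=> x [/HU1|/HU2].
Qed.

Lemma computes_le c rho h rho' h' w s w' s' A U A' U' :
  computes c rho h rho' h' w s A U ->
  (w <= w')%N -> (s <= s')%N -> A `<=` A' -> U `<=` U' ->
  computes c rho h rho' h' w' s' A' U'.
Proof.
move=> [W [S [A1 [U1 [E [HW HS HA HU]]]]]] lw ls lA lU.
exists W, S, A1, U1; split=> //; split; try lia.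
- by move=> x /HA /lA.
- by move=> x /HU /lU.
Qed.

Lemma computes_comp e t rho r h A : (nregs <= t)%N -> agree rho r ->
  ok r h A e ->
  exists rho', [/\ computes (comp t e) rho h rho' h (cost e) (cost e) A set0,
    rho' t = eval r h e & forall x, (x < t)%N -> rho' x = rho x].
Proof.
have step f t' v (c : cmd) rho1 A1 : uexec c rho1 h (upd rho1 t' v) h 1 1 A1 set0
    -> A1 `<=` A -> f = rho1 -> 
  exists rho', [/\ computes c f h rho' h 1 1 A set0, rho' t' = v
     & forall x, (x < t')%N -> rho' x = f x].
  move=> E sA ->; exists (upd rho1 t' v); split.
  - by exists 1, 1, A1, set0; split=> //; split.
  - by rewrite /upd eqxx.
  - by move=> x lx; rewrite /upd ltn_eqF.
have agr t1 rho1 rho2 : (nregs <= t1)%N -> agree rho1 r ->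
    (forall x, (x < t1)%N -> rho2 x = rho1 x) -> agree rho2 r.
  by move=> lt ag E x lx; rewrite E ?ag//; apply: leq_trans lx lt.
elim: e t rho => [x|k|f e1 IH1 e2 IH2|e IH|a1 IH1 a2 IH2 a3 IH3 a4 IH4
  |k IHk a1 IH1 a2 IH2 a3 IH3 a4 IH4] t rho lt ag /=.
- move=> [xT xM].
  have -> : r x = Nat.land (rho x) (rho x) by rewrite PeanoNat.Nat.land_diag ag.
  apply: (step _ _ _ _ _ set0) => //.
  move=> inp' _; apply: (@ExecOp R M inp' pr And t x x rho h).
  by rewrite /= PeanoNat.Nat.land_diag ag.
- move=> kM; apply: (step _ _ _ _ _ set0) => //.
  by move=> inp' _; exact: ExecConst.
- move=> [ o1 o2 oM].
  have [rho1 [C1 v1 E1]] := IH1 t rho lt ag o1.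
  have ag1 := agr _ _ _ lt ag E1.
  have [rho2 [C2 v2 E2]] := IH2 t.+1 rho1 (leqW lt) ag1 o2.
  have v21 : rho2 t = eval r h e1 by rewrite E2.
  have [rho3 [C3 v3 E3]] := step rho2 t _ (Op f t t t.+1) rho2 set0
    (fun inp' _ => @ExecOp R M inp' pr f t t t.+1 rho2 h ltac:(by rewrite v21 v2)) ltac:(by move=> ?) erefl.
  exists rho3; split.
  + have -> : (cost e1 + cost e2).+1 = cost e1 + (cost e2 + 1) by lia.
    exact: computes_seq C1 (computes_seq C2 C3).
  + by rewrite v3 v21 v2.
  + by move=> x lx; rewrite E3// E2 ?E1//; lia.
- move=> [ o oA].
  have [rho1 [C1 v1 E1]] := IH t rho lt ag o.
  have [rho3 [C3 v3 E3]] := step rho1 t _ (Read t t) rho1 _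
    (fun inp' _ => @ExecRead R M inp' pr t t rho1 h) ltac:(by rewrite v1 => ? ->) erefl.
  exists rho3; split.
  + by rewrite -addn1; exact: computes_seq C1 C3.
  + by rewrite v3 v1.
  + by move=> x lx; rewrite E3// E1.
- move=> [[ o1 o2 o3 o4] [i1 i2 i3 i4]].
  have [rho1 [C1 v1 E1]] := IH1 t rho lt ag o1.
  have ag1 := agr _ _ _ lt ag E1.
  have [rho2 [C2 v2 E2]] := IH2 t.+1 rho1 ltac:(lia) ag1 o2.
  have ag2 := agr t.+1 _ _ ltac:(lia) ag1 E2.
  have [rho3 [C3 v3 E3]] := IH3 t.+2 rho2 ltac:(lia) ag2 o3.
  have ag3 := agr t.+2 _ _ ltac:(lia) ag2 E3.
  have [rho4 [C4 v4 E4]] := IH4 t.+3 rho3 ltac:(lia) ag3 o4.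
  have w3 : rho4 t.+2 = eval r h a3 by rewrite E4.
  have w2 : rho4 t.+1 = eval r h a2 by rewrite E4 ?E3//; lia.
  have w1 : rho4 t = eval r h a1 by rewrite E4 ?E3 ?E2//; lia.
  have ex : uexec (RealLe t t t.+1 t.+2 t.+3) rho4 h
      (upd rho4 t (eval r h (DistLe a1 a2 a3 a4))) h 1 1 set0 set0.
    move=> inp' ag'; have := @ExecRealLe R M inp' pr t t t.+1 t.+2 t.+3 rho4 h.
    by rewrite /= w1 w2 w3 v4 !ag'.
  have [rho5 [C5 v5 E5]] := step rho4 t _ _ rho4 set0 ex ltac:(by move=> ?) erefl.
  exists rho5; split.
  + have -> : (cost a1 + cost a2 + cost a3 + cost a4).+1 =
      cost a1 + (cost a2 + (cost a3 + (cost a4 + 1))) by lia.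
    exact: computes_seq C1 (computes_seq C2 (computes_seq C3 (computes_seq C4 C5))).
  + by rewrite v5.
  + by move=> x lx; rewrite E5// E4 ?E3 ?E2 ?E1//; lia.
- move=> [[ o0 o1 o2 o3 o4] [i1 i2 i3 i4 oM]].
  have [rho0 [C0 v0 E0]] := IHk t rho lt ag o0.
  have ag0 := agr _ _ _ lt ag E0.
  have [rho1 [C1 v1 E1]] := IH1 t.+1 rho0 ltac:(lia) ag0 o1.
  have ag1 := agr t.+1 _ _ ltac:(lia) ag0 E1.
  have [rho2 [C2 v2 E2]] := IH2 t.+2 rho1 ltac:(lia) ag1 o2.
  have ag2 := agr t.+2 _ _ ltac:(lia) ag1 E2.
  have [rho3 [C3 v3 E3]] := IH3 t.+3 rho2 ltac:(lia) ag2 o3.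
  have ag3 := agr t.+3 _ _ ltac:(lia) ag2 E3.
  have [rho4 [C4 v4 E4]] := IH4 t.+4 rho3 ltac:(lia) ag3 o4.
  have w3 : rho4 t.+3 = eval r h a3 by rewrite E4.
  have w2 : rho4 t.+2 = eval r h a2 by rewrite E4 ?E3//; lia.
  have w1 : rho4 t.+1 = eval r h a1 by rewrite E4 ?E3 ?E2//; lia.
  have w0 : rho4 t = eval r h k by rewrite E4 ?E3 ?E2 ?E1//; lia.
  have ex : uexec (RealRound t t t.+1 t.+2 t.+3 t.+4) rho4 h
      (upd rho4 t (eval r h (Round k a1 a2 a3 a4))) h 1 1 set0 set0.
    move=> inp' ag'; have := @ExecRealRound R M inp' pr t t t.+1 t.+2 t.+3 t.+4 rho4 h.
    by rewrite /= w0 w1 w2 w3 v4 !ag'//; apply.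
  have [rho5 [C5 v5 E5]] := step rho4 t _ _ rho4 set0 ex ltac:(by move=> ?) erefl.
  exists rho5; split.
  + have -> : (cost k + cost a1 + cost a2 + cost a3 + cost a4).+1 =
      cost k + (cost a1 + (cost a2 + (cost a3 + (cost a4 + 1)))) by lia.
    exact: computes_seq C0 (computes_seq C1 (computes_seq C2
      (computes_seq C3 (computes_seq C4 C5)))).
  + by rewrite v5.
  + by move=> x lx; rewrite E5// E4 ?E3 ?E2 ?E1 ?E0//; lia.
Qed.

Lemma hoare_le c r h w s w' s' A U A' U' Q Q' :
  hoare c r h w s A U Q -> (w <= w')%N -> (s <= s')%N ->
  A `<=` A' -> U `<=` U' -> (forall r1 h1, Q r1 h1 -> Q' r1 h1) ->
  hoare c r h w' s' A' U' Q'.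
Proof.
move=> H lw ls lA lU lQ rho /H [rho' [r' [h' [C ag q]]]].
exists rho', r', h'; split; [exact: computes_le C _ _ _ _ | by [] | exact: lQ].
Qed.

Lemma hoare_cost c r h w s w' s' A U Q : hoare c r h w s A U Q ->
  (w <= w')%N -> (s <= s')%N -> hoare c r h w' s' A U Q.
Proof. by move=> H lw ls; apply: hoare_le H lw ls _ _ _. Qed.

Lemma hoare_weak c r h w s A U Q Q' : hoare c r h w s A U Q ->
  (forall r1 h1, Q r1 h1 -> Q' r1 h1) -> hoare c r h w s A U Q'.
Proof. by move=> H lQ; apply: hoare_le H _ _ _ _ lQ. Qed.

Lemma hoare_seq c1 c2 r h w1 s1 w2 s2 A U Q :
  hoare c1 r h w1 s1 A U (fun r1 h1 => hoare c2 r1 h1 w2 s2 A U Q) ->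
  hoare (Seq c1 c2) r h (w1 + w2) (s1 + s2) A U Q.
Proof.
move=> H rho /H [rho1 [r1 [h1 [C1 ag1 H2]]]].
have [rho2 [r2 [h2 [C2 ag2 q]]]] := H2 _ ag1.
by exists rho2, r2, h2; split=> //; exact: computes_seq C1 C2.
Qed.

Lemma hoare_asg x e r h A U Q : (x < nregs)%N -> ok r h A e ->
  (eval r h e < M)%N -> Q (upd r x (eval r h e)) h ->
  hoare (Asg x e) r h (cost e + 1) (cost e + 1) A U Q.
Proof.
move=> xT o vM q rho ag.
have [rho1 [C1 v1 E1]] := computes_comp (leqnn _) ag o.
exists (upd rho1 x (eval r h e)), (upd r x (eval r h e)), h; split=> //.
  apply: (computes_seq (computes_le C1 _ _ _ _)) => //.
  exists 1, 1, set0, set0; split; last by split=> // ?.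
  move=> inp' _; have := @ExecOp R M inp' pr And x nregs nregs rho1 h.
  by rewrite /= PeanoNat.Nat.land_diag v1; apply.
by move=> y yT; rewrite /upd; case: eqP => // _; rewrite E1// ag.
Qed.

Lemma hoare_sto ea e r h A U Q : ok r h A ea -> ok r h A e ->
  A (eval r h ea) -> U (eval r h ea) ->
  Q r (upd h (eval r h ea) (eval r h e)) ->
  hoare (Sto ea e) r h (cost ea + (cost e + 1)) (cost ea + (cost e + 1)) A U Q.
Proof.
move=> oa o Aa Ua q rho ag.
have [rho1 [C1 v1 E1]] := computes_comp (leqnn _) ag oa.
have ag1 : agree rho1 r by move=> x xT; rewrite E1// ag.
have [rho2 [C2 v2 E2]] := computes_comp (leqnSn _) ag1 o.
have v21 : rho2 nregs = eval r h ea by rewrite E2.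
exists rho2, r, (upd h (eval r h ea) (eval r h e)); split=> //.
  apply: (computes_seq (computes_le C1 _ _ _ _)) => //.
  apply: (computes_seq (computes_le C2 _ _ _ _)) => //.
  exists 1, 1, [set rho2 nregs], [set rho2 nregs]; split.
    by move=> inp' _; rewrite -v2 -v21; exact: ExecWrite.
  by rewrite v21; split=> // x ->.
by move=> x xT; rewrite E2 ?ag1//; lia.
Qed.

Lemma computes_if x c1 c2 rho h rho' h' w s A U :
  computes (if rho x != 0 then c1 else c2) rho h rho' h' w s A U ->
  computes (If x c1 c2) rho h rho' h' w.+1 s.+1 A U.
Proof.
move=> [W [S [A1 [U1 [E [HW HS HA HU]]]]]].
by exists W.+1, S.+1, A1, U1; split; [move=> ? /E; exact: ExecIf|split].
Qed.

Lemma hoare_if e c1 c2 r h w1 s1 w2 s2 A U Q : ok r h A e ->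
  (eval r h e <> 0 -> hoare c1 r h w1 s1 A U Q) ->
  (eval r h e = 0 -> hoare c2 r h w2 s2 A U Q) ->
  hoare (IfE e c1 c2) r h (cost e + (maxn w1 w2).+1)
    (cost e + (maxn s1 s2).+1) A U Q.
Proof.
move=> o H1 H2 rho ag.
have [rho1 [C1 v1 E1]] := computes_comp (leqnn _) ag o.
have ag1 : agree rho1 r by move=> x xT; rewrite E1// ag.
have [rho2 [r2 [h2 [C2 ag2 q]]]] : exists rho' r' h',
    [/\ computes (if rho1 nregs != 0 then c1 else c2) rho1 h rho' h'
          (maxn w1 w2) (maxn s1 s2) A U, agree rho' r' & Q r' h'].
  rewrite v1; case: eqP => [/H2|/H1] /(_ _ ag1) [rho2 [r2 [h2 [C2 ag2 q]]]];
  by exists rho2, r2, h2; split=> //; apply: computes_le C2 _ _ _ _ => //;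
    rewrite ?leq_maxl ?leq_maxr.
exists rho2, r2, h2; split=> //.
apply: (computes_seq (computes_le C1 _ _ _ _)) => //.
exact: computes_if.
Qed.

(** The index [k] is only an upper bound on the iterations left, so that a loop such as a binary
    search may stop early. *)
Lemma hoare_while e c Inv w s A U Q k r h :
  (forall k r h, Inv k r h -> [/\ ok r h A e, eval r h e = 0 -> Q r h
     & eval r h e <> 0 -> exists2 k', k = k'.+1 &
         hoare c r h w s A U (Inv k')]) ->
  Inv k r h ->
  hoare (WhE e c) r h (k * (w + cost e + 1) + (cost e + 1))
    (k * (s + cost e + 1) + (cost e + 1)) A U Q.
Proof.
move=> H; move: k r h.
suff main k r h rho : agree rho r -> rho nregs = eval r h e -> Inv k r h ->
    exists rho' r' h', [/\ computes (While nregs (Seq c (comp nregs e)))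
      rho h rho' h' (k * (w + cost e + 1) + 1) (k * (s + cost e + 1) + 1) A U,
      agree rho' r' & Q r' h'].
  move=> k r h I rho ag; have [ o _ _] := H _ _ _ I.
  have [rho1 [C1 v1 E1]] := computes_comp (leqnn _) ag o.
  have ag1 : agree rho1 r by move=> x xT; rewrite E1// ag.
  have [rho2 [r2 [h2 [C2 ag2 q]]]] := main _ _ _ _ ag1 v1 I.
  exists rho2, r2, h2; split=> //.
  rewrite -!(addnCA (cost e)).
  by apply: (computes_seq (computes_le C1 _ _ _ _) C2).
elim: k r h rho => [|k IH] r h rho ag v I; have [ o H0 H1] := H _ _ _ I.
  have E0 : eval r h e = 0 by apply: contrapT => /H1 [].
  exists rho, r, h; split=> //; last exact: H0.
  exists 1, 1, set0, set0; split; last by split=> // ?.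
  by move=> ? _; apply: ExecWhileEnd; rewrite v.
have [E0|N0] := pselect (eval r h e = 0).
  exists rho, r, h; split=> //; last exact: H0.
  exists 1, 1, set0, set0; split; last by split=> //; try lia; move=> ?.
  by move=> ? _; apply: ExecWhileEnd; rewrite v.
have [_ [<-] Hc] := H1 N0.
have [rho1 [r1 [h1 [C1 ag1 I1]]]] := Hc _ ag.
have [ o1 _ _] := H _ _ _ I1.
have [rho2 [C2 v2 E2]] := computes_comp (leqnn _) ag1 o1.
have ag2 : agree rho2 r1 by move=> x xT; rewrite E2// ag1.
have [rho3 [r3 [h3 [C3 ag3 q]]]] := IH _ _ _ ag2 v2 I1.
exists rho3, r3, h3; split=> //.
have sU : set0 `<=` U by move=> ?.
have [W [S [A1 [U1 [E [HW HS HA HU]]]]]] := computes_seq (computes_seq C1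
   (computes_le C2 (leqnn _) (leqnn _) (@subset_refl _ A) sU)) C3.
exists W.+1, S.+1, A1, U1; split; last by split=> //; lia.
by move=> ? ag'; apply: ExecWhile; [rewrite v|exact: E].
Qed.

Lemma hoare_call p r h w s A U Q :
  hoare (nth Skip pr p) r h w s A U Q ->
  hoare (Call p) r h w.+1 s.+1 A U Q.
Proof.
move=> H rho /H [rho' [r' [h' [[W [S [A1 [U1 [E [HW HS HA HU]]]]]] ag q]]]].
exists rho', r', h'; split=> //.
by exists W.+1, S.+1, A1, U1; split; [move=> ? /E; exact: ExecCall|split].
Qed.

Lemma exec_frame c rho h rho' h' W S A U :
  exec M inp pr c rho h rho' h' W S A U ->
  forall a, ~ U a -> h' a = h a.
Proof.
elim=> //.
- move=> a y rho0 h0 b /= Nb; rewrite /upd ifN//.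
  by apply/eqP => E; exact: Nb.
- move=> c1 c2 rho0 h0 rho1 h1 rho2 h2 W1 W2 S1 S2 A1 A2 U1 U2 _ IH1 _ IH2 a Na.
  by rewrite IH2 ?IH1// => ?; apply: Na; [left|right].
- move=> c1 c2 rho0 h0 rho1 h1 rho2 h2 W1 W2 S1 S2 A1 A2 U1 U2 _ IH1 _ IH2 _ _ a Na.
  by rewrite IH2 ?IH1// => ?; apply: Na; [left|right].
Qed.

Lemma hoare_frame c r h w s A U Q :
  hoare c r h w s A U Q ->
  hoare c r h w s A U (fun r' h' => Q r' h' /\ forall a, ~ U a -> h' a = h a).
Proof.
move=> H rho /H [rho' [r' [h' [C ag q]]]].
exists rho', r', h'; split=> //; split=> // a Na.
have [W [S [A1 [U1 [E [HW HS HA HU]]]]]] := C.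
by apply: (exec_frame (E inp (fun=> fun=> erefl))) => /HU.
Qed.

Lemma hoare_skip r h A U Q : Q r h -> hoare Skip r h 1 1 A U Q.
Proof.
move=> q rho ag; exists rho, r, h; split=> //.
by exists 1, 1, set0, set0; split; [move=> ? _; exact: ExecSkip|split=> // ?].
Qed.

(** As in [ExecFork], the second child is specified in the memory left by the first. The two frame
    facts let it recover the initial contents of its own cells and let the result of the first child
    survive. *)
Lemma hoare_fork c1 c2 r h w1 s1 w2 s2 A1 U1 A2 U2 A U Q :
  hoare c1 r h w1 s1 A1 U1 (fun _ h1 => (forall a, ~ U1 a -> h1 a = h a) ->
    hoare c2 r h1 w2 s2 A2 U2 (fun _ h2 =>
      (forall a, ~ U2 a -> h2 a = h1 a) -> Q r h2)) ->
  A1 `<=` A -> A2 `<=` A -> U1 `<=` U -> U2 `<=` U ->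
  (forall a, U1 a -> ~ A2 a) -> (forall a, U2 a -> ~ A1 a) ->
  hoare (Fork c1 c2) r h (w1 + w2).+1 (maxn s1 s2).+1 A U Q.
Proof.
move=> H sA1 sA2 sU1 sU2 d1 d2 rho ag.
have [rho1 [r1 [h1 [C1 ag1 [H2 F1]]]]] := hoare_frame H ag.
have [rho2 [r2 [h2 [C2 ag2 [q F2]]]]] := hoare_frame (H2 F1) ag.
exists rho, r, h2; split=> //; last exact: q.
have [W [S [A1' [U1' [E [HW HS HA HU]]]]]] := C1.
have [W' [S' [A2' [U2' [E' [HW' HS' HA' HU']]]]]] := C2.
exists (W + W').+1, (maxn S S').+1, (A1' `|` A2'), (U1' `|` U2'); split.
  move=> inp' ag'; apply: ExecFork (E _ ag') (E' _ ag') _ _; rewrite -subset0 => x [].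
    by move=> /HU x1 /HA' x2; exact: (d1 x).
  by move=> /HA x2 /HU' x1; exact: (d2 x).
split; try lia.
- by move=> x [/HA /sA1|/HA' /sA2].
- by move=> x [/HU /sU1|/HU' /sU2].
Qed.

(** A fork leaves the registers of the parent unchanged; forking against [Skip] thus makes all
    registers of [c] local, for two extra units. *)
Definition Scoped c := Fork Skip c.

Lemma hoare_scoped c r h w s A U Q :
  hoare c r h w s A U (fun _ h' => Q r h') ->
  hoare (Scoped c) r h w.+2 s.+2 A U Q.
Proof.
move=> H; have H' : hoare (Scoped c) r h (1 + w).+1 (maxn 1 s).+1 A U Q.
  apply: (@hoare_fork Skip c r h 1 1 w s set0 set0 A U) => //.
  - apply: hoare_skip => _.
    by apply: hoare_le H _ _ _ _ _.
  - by move=> a _ [].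
apply: hoare_le H' _ _ _ _ _ => //; lia.
Qed.

End Hoare.

Ltac splits := repeat match goal with
  | |- _ /\ _ => split
  | |- and3 _ _ _ => split
  | |- and4 _ _ _ _ => split
  | |- and5 _ _ _ _ _ => split
  end.
Ltac bounds := splits; first [done | lia].

(** * Parallel loops by recursive halving of an interval *)

Definition ltE e1 e2 := Bin Le (Bin Add e1 (Cst 1)) e2.

(* Procedure [pr_p] runs [body] with register 1 ranging over the interval of
   length [r 2] that starts at [r 1]. *)
Definition pfor_proc p body :=
  IfE (Bin Le (Reg 2) (Cst 1)) body
    (Fork (Seq (Asg 2 (Bin Div (Reg 2) (Cst 2))) (Call p))
          (Seq (Asg 1 (Bin Add (Reg 1) (Bin Div (Reg 2) (Cst 2))))
               (Seq (Asg 2 (Bin Defs.Sub (Reg 2) (Bin Div (Reg 2) (Cst 2))))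
                    (Call p)))).

Definition PFor p y :=
  Scoped (Seq (Asg 1 (Cst 0)) (Seq (Asg 2 (Reg y)) (Call p))).

(* Registers below 10 are local to the bodies of loops. *)
Definition same_glob (r r0 : nat -> nat) := forall x, 10 <= x -> r x = r0 x.

Lemma same_globU r r0 x v : x < 10 -> same_glob r r0 -> same_glob (upd r x v) r0.
Proof. by move=> lx H y ly; rewrite /upd gtn_eqF ?H//; lia. Qed.

Section ParallelFor.
Local Open Scope classical_set_scope.
Context {R : realType} {M : nat} {inp : nat -> R} {D : set nat} {pr : program}.
Variables (p : nat) (body : cmd) (N : nat) (r0 h0 : nat -> nat) (wb sb : nat).
Variables (Acc Upd : nat -> set nat) (Post : nat -> (nat -> nat) -> Prop).
Hypothesis prp : nth Skip pr p = pfor_proc p body.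
Hypothesis NM : (N + 2 < M)%N.
Hypothesis Post_ext : forall i h1 h2,
  (forall a, Upd i a -> h1 a = h2 a) -> Post i h1 -> Post i h2.
Hypothesis UpdAcc : forall i, Upd i `<=` Acc i.
Hypothesis UpdAccN : forall i j a, (i < N)%N -> (j < N)%N -> i <> j ->
  Upd i a -> ~ Acc j a.
Hypothesis bodyP : forall i r h, (i < N)%N -> same_glob r r0 -> r 1 = i ->
  (forall a, Acc i a -> h a = h0 a) ->
  @hoare R M inp D pr body r h wb sb (Acc i) (Upd i) (fun _ h' => Post i h').

Let over (B : nat -> set nat) lo len : set nat :=
  [set a | exists2 i, (lo <= i < lo + len)%N & B i a].

(** [Post i] depends on the cells of [Upd i] alone, which no other iteration touches, so the results
    of the left half survive the right half. The two halves subtract 30 each and the whole subtracts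
    it once, which leaves 30 units to pay for the fork. *)
Lemma hoare_pfor_call k lo len r h : (0 < len <= 2 ^ k)%N ->
  (lo + len <= N)%N -> same_glob r r0 -> r 1 = lo -> r 2 = len ->
  (forall i a, (lo <= i < lo + len)%N -> Acc i a -> h a = h0 a) ->
  @hoare R M inp D pr (Call p) r h (len * (wb + 60) - 30) (sb + 30 * k.+1)
    (over Acc lo len) (over Upd lo len)
    (fun _ h' => forall i, (lo <= i < lo + len)%N -> Post i h').
Proof.
elim: k lo len r h => [|k IH] lo len r h lk lN rr0 r1 r2 hh.
  have len1 : len = 1 by move: lk; rewrite expn0; lia.
  apply: hoare_cost.
  - apply: hoare_call; rewrite prp; apply: (@hoare_if _ _ _ _ _ _ _ _ _ _ wb sb 0 0).
    + by rewrite /= r2; bounds.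
    + move=> _; have lN' : (lo < N)%N by lia.
      have hlo a : Acc lo a -> h a = h0 a by apply: hh; lia.
      apply: (hoare_le (bodyP lN' rr0 r1 hlo)) => //.
      * by move=> a ?; exists lo => //; lia.
      * by move=> a ?; exists lo => //; lia.
      * by move=> ? h' P1 i il; have -> : i = lo by lia.
    + by rewrite /= r2 len1.
  - rewrite /= len1; lia.
  - rewrite /=; lia.
have [len1|len2] := leqP len 1.
  have len1' : len = 1 by lia.
  have Nk : (0 < len <= 2 ^ k)%N by have := expn_gt0 2 k; lia.
  by apply: hoare_cost (IH lo len r h Nk lN rr0 r1 r2 hh) _ _; lia.
have half_gt0 : (0 < len %/ 2)%N by lia.
have half_lt : (len %/ 2 < len)%N by lia.
have lh : (len %/ 2 <= 2 ^ k)%N by move: lk; rewrite expnS; lia.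
have lh' : (len - len %/ 2 <= 2 ^ k)%N by move: lk; rewrite expnS; lia.
have lmul : (len * (wb + 60) = len %/ 2 * (wb + 60) + (len - len %/ 2) * (wb + 60))%N.
  by rewrite -mulnDl; congr muln; lia.
(* Subtraction on [nat] is truncated; these bounds make the subtractions of 30 exact. *)
have lmul1 : (60 <= len %/ 2 * (wb + 60))%N by nia.
have lmul2 : (60 <= (len - len %/ 2) * (wb + 60))%N by nia.
have okr2 r' h' A : r' 2 = len -> @ok R M inp D r' h' A (Reg 2).
  by move=> E; split=> //; rewrite E; lia.
have okd r' h' A : r' 2 = len -> @ok R M inp D r' h' A (Bin Div (Reg 2) (Cst 2)).
  move=> E; split; [exact: okr2 | by rewrite /=; lia|].
  by rewrite /= E; lia.
apply: hoare_cost.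
- apply: hoare_call; rewrite prp; apply: (@hoare_if _ _ _ _ _ _ _ _ _ _ 0 0).
  + by rewrite /= r2; bounds.
  + by rewrite /= r2; move: len2; rewrite ltnNge; case: leq.
  + move=> _; apply: (@hoare_fork _ _ _ _ _ _ _ _ _ _ _ _ _
       (over Acc lo (len %/ 2)) (over Upd lo (len %/ 2))
       (over Acc (lo + len %/ 2) (len - len %/ 2))
       (over Upd (lo + len %/ 2) (len - len %/ 2)) (over Acc lo len) (over Upd lo len)).
    * apply: hoare_seq; apply: hoare_asg => //; first exact: okd.
        by rewrite /= r2; lia.
      apply: hoare_weak; first apply: (IH lo (len %/ 2)) => //.
      - lia.
      - lia.
      - exact: same_globU.
      - by rewrite /= /upd /= r2.
      - by move=> i a il; apply: hh; lia.
      move=> ? h1 /= P1 fr1.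
      have r2' : r 2 = len by [].
      apply: hoare_seq; apply: hoare_asg => //.
        by split; [by rewrite /= r1; split=> //; lia| exact: okd | rewrite /= r1 r2; lia].
        by rewrite /= r1 r2; lia.
      set r' := upd r 1 _.
      have r'2 : r' 2 = len by [].
      apply: hoare_seq; apply: hoare_asg => //.
        by split; [exact: okr2| exact: okd | rewrite /= r'2; lia].
        by rewrite /= r'2; lia.
      have F1 j a : (lo + len %/ 2 <= j < lo + len)%N -> Acc j a -> h1 a = h a.
        move=> jl Aj; apply: fr1 => -[i il Ui]; apply: (UpdAccN _ _ _ Ui Aj); lia.
      apply: hoare_weak; first apply: (IH (lo + len %/ 2) (len - len %/ 2)) => //.
      - lia.
      - lia.
      - by do 2 apply: same_globU => //.
      - by rewrite /= /r' /upd /= r1 r2.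
      - by rewrite /= /upd /= -/(r' 2) r'2.
      - move=> i a il Ai; rewrite (F1 i) ?(hh i) //; lia.
      move=> ? h2 /= P2 fr2 i il.
      have [ilt|ige] := ltnP i (lo + len %/ 2); last by apply: P2; lia.
      apply: (@Post_ext i h1); last by apply: P1; lia.
      move=> a Ui; rewrite fr2// => -[j jl Uj].
      by apply: (UpdAccN _ _ _ Ui (UpdAcc Uj)); lia.
    * by move=> a [i il ?]; exists i => //; lia.
    * by move=> a [i il ?]; exists i => //; lia.
    * by move=> a [i il ?]; exists i => //; lia.
    * by move=> a [i il ?]; exists i => //; lia.
    * by move=> a [i il Ui] [j jl Aj]; apply: (UpdAccN _ _ _ Ui Aj); lia.
    * by move=> a [i il Ui] [j jl Aj]; apply: (UpdAccN _ _ _ Ui Aj); lia.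
- rewrite /=; lia.
- rewrite /=; lia.
Qed.

Lemma hoare_pfor y k r h Q : (10 <= y < nregs)%N -> r y = N ->
  (0 < N <= 2 ^ k)%N -> same_glob r r0 ->
  (forall i a, (i < N)%N -> Acc i a -> h a = h0 a) ->
  (forall h', (forall i, (i < N)%N -> Post i h') ->
    (forall a, ~ over Upd 0 N a -> h' a = h a) -> Q r h') ->
  @hoare R M inp D pr (PFor p y) r h (N * (wb + 60)) (sb + 30 * k.+2)
    (over Acc 0 N) (over Upd 0 N) Q.
Proof.
move=> yT ry Nk rr0 hh HQ.
have lN : (wb + 60 <= N * (wb + 60))%N by nia.
apply: hoare_cost.
- apply: hoare_scoped; apply: hoare_weak.
    apply: hoare_frame; apply: (hoare_seq (Q := fun _ h' =>
      forall i, (i < N)%N -> Post i h')); apply: hoare_asg => //.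
      by rewrite /=; lia.
      by rewrite /=; lia.
    have r'y : (if y == 1 then 0 else r y) = N by case: eqP => // E; lia.
    apply: hoare_seq; apply: hoare_asg => //.
      by rewrite /= r'y; bounds.
      by rewrite /= r'y; lia.
    apply: (@hoare_pfor_call k 0 N).
    + by [].
    + by [].
    + by do 2 apply: same_globU => //.
    + by [].
    + by rewrite /= r'y.
    + by move=> i a il; apply: hh.
  by move=> ? h1 /= [P1 fr]; apply: HQ.
- rewrite /=; lia.
- rewrite /=; lia.
Qed.

End ParallelFor.

(** * Parallel radix sort *)

Lemma count0 (T : eqType) (p : pred T) (s : seq T) :
  {in s, forall x, ~~ p x} -> count p s = 0.
Proof. by move=> H; apply/eqP; rewrite -leqn0 leqNgt -has_count; apply/hasPn. Qed.

Section RadixCount.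
Variables (n : nat) (g : nat -> nat).

(** The guard [i < n] is there because the last block of the array may extend beyond [n]. *)
Definition ndig v m := count (fun i => (i < n) && (g i == v)) (iota 0 m).
Definition ndiglt v := count (fun i => g i < v) (iota 0 n).
(** The target of element [i] in a stable counting sort. *)
Definition dest i := ndiglt (g i) + ndig (g i) i.

Lemma ndigS v m : ndig v m.+1 = ndig v m + ((m < n) && (g m == v)).
Proof. by rewrite /ndig -[in LHS]addn1 iotaD count_cat /= add0n !addn0. Qed.

Lemma ndigD v m k : ndig v m <= ndig v (m + k).
Proof. by rewrite /ndig iotaD count_cat leq_addr. Qed.

Lemma ndig_le v m : ndig v m <= m.
Proof. by apply: leq_trans (count_size _ _) _; rewrite size_iota. Qed.

Lemma ndiglt_le v : ndiglt v <= n.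
Proof. by apply: leq_trans (count_size _ _) _; rewrite size_iota. Qed.

Lemma ndig_ge v m : n <= m -> ndig v m = count (fun i => g i == v) (iota 0 n).
Proof.
move=> nm; rewrite /ndig -(subnKC nm) iotaD count_cat -[RHS]addn0; congr addn.
  by apply: eq_in_count => i; rewrite mem_iota /= => ->.
by apply: count0 => i; rewrite mem_iota add0n => /andP[ni _]; rewrite ltnNge ni.
Qed.

Lemma ndig_n v m : ndig v m <= n.
Proof.
apply: (@leq_trans (ndig v n)); last exact: ndig_le.
have [mn|nm] := leqP m n; first by rewrite -(subnKC mn) ndigD.
by rewrite ndig_ge ?ndig_ge// ltnW.
Qed.

Lemma ndiglt0 : ndiglt 0 = 0.
Proof. by apply: count0. Qed.

Lemma ndigltS v m : n <= m -> ndiglt v.+1 = ndiglt v + ndig v m.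
Proof.
move=> nm; rewrite ndig_ge// /ndiglt -count_predUI.
rewrite [X in _ + X](_ : _ = 0) ?addn0; last first.
  by apply: count0 => i _ /=; lia.
by apply: eq_count => i /=; lia.
Qed.

(** [dest] is the rank in the lexicographic order of the pairs (digit, index); monotonicity,
    injectivity and surjectivity all come from this form. *)
Lemma destE i : i < n ->
  dest i = count (fun j => (g j < g i) || ((g j == g i) && (j < i))) (iota 0 n).
Proof.
move=> lin; pose p j := (g j == g i) && (j < i).
have -> : dest i = count (fun j => g j < g i) (iota 0 n) + count p (iota 0 n).
  congr addn; rewrite /ndig -[in RHS](subnKC (ltnW lin)) iotaD count_cat.
  rewrite [X in _ = _ + X](_ : _ = 0) ?addn0.
    by apply: eq_in_count => j; rewrite mem_iota /p; lia.
  by apply: count0 => j; rewrite mem_iota /p; lia.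
rewrite -count_predUI [X in _ + X](_ : _ = 0) ?addn0//.
by apply: count0 => j _; rewrite /= /p; lia.
Qed.

Lemma dest_mono i j : i < n -> j < n ->
  (g i < g j) || ((g i == g j) && (i < j)) -> dest i < dest j.
Proof.
move=> lin ljn lij; rewrite !destE// -addn1.
pose p k := (g k < g i) || ((g k == g i) && (k < i)).
have <- : count (pred1 i) (iota 0 n) = 1.
  by rewrite count_uniq_mem ?iota_uniq// mem_iota lin.
rewrite -(count_predUI p) [X in _ + X](_ : _ = 0) ?addn0; last first.
  by apply: count0 => k _; apply/negP => /andP[H /eqP E]; move: H; rewrite E /p; lia.
by apply: sub_count => k /orP[|/eqP ->]; rewrite /= /p; lia.
Qed.

Lemma dest_lt i : i < n -> dest i < n.
Proof.
move=> lin; pose p k := (g k < g i) || ((g k == g i) && (k < i)).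
rewrite destE// -/p -addn1.
have <- : count (pred1 i) (iota 0 n) = 1.
  by rewrite count_uniq_mem ?iota_uniq// mem_iota lin.
rewrite -(count_predUI p) [X in _ + X](_ : _ = 0) ?addn0; last first.
  by apply: count0 => k _; apply/negP => /andP[H /eqP E]; move: H; rewrite E /p; lia.
by apply: leq_trans (count_size _ _) _; rewrite size_iota.
Qed.

Lemma dest_inj i j : i < n -> j < n -> dest i = dest j -> i = j.
Proof.
move=> lin ljn E; apply/eqP; apply: contraT => ij.
case: (boolP ((g i < g j) || ((g i == g j) && (i < j)))) => [/(dest_mono lin ljn)|H].
  by rewrite E ltnn.
have : dest j < dest i by apply: dest_mono => //; lia.
by rewrite E ltnn.
Qed.

Lemma dest_perm : perm_eq (map dest (iota 0 n)) (iota 0 n).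
Proof.
have U : uniq (map dest (iota 0 n)).
  rewrite map_inj_in_uniq ?iota_uniq// => i j; rewrite !mem_iota.
  by move=> /andP[_ ?] /andP[_ ?]; apply: dest_inj.
apply: uniq_perm => //; first exact: iota_uniq.
have S : {subset map dest (iota 0 n) <= iota 0 n}.
  move=> _ /mapP[i +] ->; rewrite !mem_iota; move=> /andP[_ ?]; exact: dest_lt.
by have [] := uniq_min_size U S _; rewrite ?size_map ?size_iota.
Qed.

Lemma dest_surj m : m < n -> exists2 i, i < n & m = dest i.
Proof.
move=> lm; have : m \in map dest (iota 0 n).
  by rewrite (perm_mem dest_perm) mem_iota.
by move=> /mapP[i]; rewrite mem_iota => /andP[_ lin] ->; exists i.
Qed.

Lemma dest_le i j : i < n -> j < n -> dest i < dest j ->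
  (g i < g j) || ((g i == g j) && (i < j)).
Proof.
move=> lin ljn lij; apply: contraT => H.
have [ij|ij] := eqVneq i j; first by move: lij; rewrite ij ltnn.
have : dest j < dest i by apply: dest_mono => //; lia.
by rewrite ltnNge (ltnW lij).
Qed.

End RadixCount.

(** Memory layout: the cells below [n] are kept for the arrays of the leaves; above them [K] arrays
    are interleaved, the tag [t] naming the array. No array needs a length in advance, and the
    entries of index [i] with tags 0, 1, 2 are adjacent, as the fields of a tree node have to be. *)
Definition ad (n K t i : nat) := n + (K * i + t).

Lemma ad_inj n K t i t' i' : t < K -> t' < K -> ad n K t i = ad n K t' i' ->
  t = t' /\ i = i'.
Proof.
move=> tK t'K /addnI E; have K0 : 0 < K by lia.
have tt : t = t'.
  have := congr1 (modn^~ K) E.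
  by rewrite ![K * _]mulnC !modnMDl !modn_small.
split=> //; move: E; rewrite tt => /addIn /eqP.
by rewrite eqn_pmul2l// => /eqP.
Qed.

Lemma ad_lt n K t i m : t < K -> i < m -> ad n K t i < n + K * m.
Proof.
move=> tK im; rewrite /ad ltn_add2l.
have : K * i.+1 <= K * m by rewrite leq_mul2l im orbT.
rewrite mulnS; lia.
Qed.

Lemma row_inj N i j i' j' : j < N -> j' < N -> i * N + j = i' * N + j' ->
  i = i' /\ j = j'.
Proof.
move=> jN j'N E; have N0 : 0 < N by lia.
have jj : j = j' by have := congr1 (modn^~ N) E; rewrite !modnMDl !modn_small.
split=> //; move: E; rewrite jj => /addIn /eqP.
by rewrite eqn_pmul2r// => /eqP.
Qed.

Lemma row_lt N N' i j : i < N' -> j < N -> i * N + j < N' * N.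
Proof.
move=> iN jN; have : i.+1 * N <= N' * N by rewrite leq_mul2r iN orbT.
rewrite mulSn; lia.
Qed.

Lemma block_bounds V i : 0 < V -> i %/ V * V <= i < i %/ V * V + V.
Proof.
move=> V0; move: (divn_eq i V) (ltn_pmod i V0).
by move: (i %/ V * V) (i %% V) => x y; lia.
Qed.

Lemma block_uniq V b i : b * V <= i < b * V + V -> b = i %/ V.
Proof.
move=> /andP[H1 H2]; have V0 : 0 < V by lia.
by rewrite -(subnKC H1) divnMDl// divn_small ?addn0//; lia.
Qed.

Definition adE K t e := Bin Add (Reg 10) (Bin Add (Bin Mul (Cst K) e) (Cst t)).

(* In global registers: 10 = the number of points n, 11 = L, 12 = w,
   13 = 2 ^ w, 14 = 2 ^ (L - w), 15 = 2 ^ L. *)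
Definition globals (n L w : nat) (r : nat -> nat) :=
  [/\ r 10 = n, r 11 = L, r 12 = w & [/\ r 13 = 2 ^ w, r 14 = 2 ^ (L - w)
    & r 15 = 2 ^ L]].

Lemma globals_same n L w r r0 : same_glob r r0 -> globals n L w r0 ->
  globals n L w r.
Proof. by move=> G [E0 E1 E2 [E3 E4 E5]]; split; [..|split]; rewrite G. Qed.

Lemma globalsU n L w r x v : x < 10 -> globals n L w r ->
  globals n L w (upd r x v).
Proof. by move=> lx; apply: globals_same; apply: same_globU. Qed.

Definition digE q e :=
  Bin Mod (Bin Shr e (Bin Add (Reg 11) (Bin Mul (Cst q) (Reg 12)))) (Reg 13).

(** The low [L] bits of an entry hold the index of its point, so the digits of the code start at bit
    [L]. *)
Definition dig (L w q x : nat) := (x %/ 2 ^ (L + q * w)) %% 2 ^ w.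

(** * One pass of the parallel counting sort *)

Section Pass.
Variables (K q tA tC tD tT tS tB : nat).

(** The input [tA] is cut into 2 ^ (L - w) blocks of 2 ^ w entries, each processed sequentially. At
    index v * 2 ^ (L - w) + b, [tC] holds the number of digits v in block b and [tD] the number of
    those in earlier blocks; [tT] holds the total of each digit, [tS] the start of its range in the
    output [tB]. Blocks run in parallel with each other when counting and scattering, digits when
    summing over the blocks. *)
Definition count_body :=
  Seq (Asg 2 (Cst 0)) (WhE (ltE (Reg 2) (Reg 13))
    (Seq (Asg 3 (Bin Add (Bin Mul (Reg 1) (Reg 13)) (Reg 2)))
    (Seq (IfE (ltE (Reg 3) (Reg 10))
            (Seq (Asg 4 (digE q (Fetch (adE K tA (Reg 3)))))
            (Seq (Asg 5 (adE K tC (Bin Add (Bin Mul (Reg 4) (Reg 14)) (Reg 1))))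
                 (Sto (Reg 5) (Bin Add (Fetch (Reg 5)) (Cst 1)))))
            Skip)
         (Asg 2 (Bin Add (Reg 2) (Cst 1)))))).

Definition column_body :=
  Seq (Asg 2 (Cst 0)) (Seq (Asg 3 (Cst 0))
  (Seq (WhE (ltE (Reg 2) (Reg 14))
    (Seq (Asg 4 (Bin Add (Bin Mul (Reg 1) (Reg 14)) (Reg 2)))
    (Seq (Sto (adE K tD (Reg 4)) (Reg 3))
    (Seq (Asg 5 (Fetch (adE K tC (Reg 4))))
    (Seq (Asg 3 (Bin Add (Reg 3) (Reg 5)))
         (Asg 2 (Bin Add (Reg 2) (Cst 1))))))))
    (Sto (adE K tT (Reg 1)) (Reg 3)))).

Definition starts :=
  Scoped (Seq (Asg 2 (Cst 0)) (Seq (Asg 3 (Cst 0))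
  (WhE (ltE (Reg 2) (Reg 13))
    (Seq (Sto (adE K tS (Reg 2)) (Reg 3))
    (Seq (Asg 5 (Fetch (adE K tT (Reg 2))))
    (Seq (Asg 3 (Bin Add (Reg 3) (Reg 5)))
         (Asg 2 (Bin Add (Reg 2) (Cst 1))))))))).

Definition scatter_body :=
  Seq (Asg 2 (Cst 0)) (WhE (ltE (Reg 2) (Reg 13))
    (Seq (Asg 3 (Bin Add (Bin Mul (Reg 1) (Reg 13)) (Reg 2)))
    (Seq (IfE (ltE (Reg 3) (Reg 10))
            (Seq (Asg 5 (Fetch (adE K tA (Reg 3))))
            (Seq (Asg 4 (digE q (Reg 5)))
            (Seq (Asg 6 (adE K tD (Bin Add (Bin Mul (Reg 4) (Reg 14)) (Reg 1))))
            (Seq (Asg 7 (Fetch (Reg 6)))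
            (Seq (Sto (adE K tB (Bin Add (Fetch (adE K tS (Reg 4))) (Reg 7))) (Reg 5))
                 (Sto (Reg 6) (Bin Add (Reg 7) (Cst 1))))))))
            Skip)
         (Asg 2 (Bin Add (Reg 2) (Cst 1)))))).

Local Open Scope classical_set_scope.
Context {R : realType} {M : nat} {inp : nat -> R} {D : set nat} {pr : program}.
Variables (n L w : nat) (r0 h0 a : nat -> nat).
Hypothesis tags : [/\ tA < K, tC < K, tD < K & [/\ tT < K, tS < K & tB < K]]%N.
Hypothesis tagsN : uniq [:: tA; tC; tD; tT; tS; tB].
Hypothesis nL : (0 < n <= 2 ^ L)%N.
Hypothesis wL : (w <= L)%N.
Hypothesis qK : (q < K)%N.
Hypothesis K3 : (3 <= K)%N.
Hypothesis HM : (n + K * (2 ^ L).+1 < M)%N.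
Hypothesis G0 : globals n L w r0.
Hypothesis aM : forall i, (i < n)%N -> (a i < M)%N.

Let V := 2 ^ w.
Let NB := 2 ^ (L - w).
Let g i := dig L w q (a i).
Notation cell t i := (ad n K t i).
Notation hoare := (@hoare R M inp D pr).

Let VN : (NB * V = 2 ^ L)%N.
Proof. by rewrite -expnD subnK. Qed.
Let VN' : (V * NB = 2 ^ L)%N. Proof. by rewrite mulnC. Qed.
Let V0 : (0 < V)%N. Proof. by rewrite expn_gt0. Qed.
Let N0 : (0 < NB)%N. Proof. by rewrite expn_gt0. Qed.
Let VL : (V <= 2 ^ L)%N. Proof. by rewrite leq_exp2l. Qed.
Let NL : (NB <= 2 ^ L)%N. Proof. by rewrite leq_exp2l// leq_subr. Qed.
Let LM : (3 * (2 ^ L).+1 + n < M)%N.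
Proof. by apply: leq_ltn_trans HM; rewrite addnC leq_add2l leq_mul2r K3 orbT. Qed.
Let g_lt i : (g i < V)%N. Proof. by rewrite ltn_mod. Qed.

Lemma ok_cell t e r h A x : globals n L w r -> (t < K)%N -> @ok R M inp D r h A e ->
  @eval R inp r h e = x -> (x < 2 ^ L)%N -> @ok R M inp D r h A (adE K t e).
Proof.
move=> [E0 _ _ _] tK oe ex xL /=; rewrite E0 ex.
have := ad_lt n tK xL; rewrite /ad => H.
have H2 : (K <= K * (2 ^ L).+1)%N by rewrite leq_pmulr.
have H3 : (K * (2 ^ L).+1 = K + K * 2 ^ L)%N by rewrite mulnS.
by splits => //; lia.
Qed.

Lemma eval_cell t e r h : globals n L w r ->
  @eval R inp r h (adE K t e) = cell t (@eval R inp r h e).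
Proof. by move=> [E0 _ _ _]; rewrite /= E0. Qed.

Lemma ok_dig e r h A x : globals n L w r -> @ok R M inp D r h A e ->
  @eval R inp r h e = x -> (x < M)%N ->
  @ok R M inp D r h A (digE q e) /\ @eval R inp r h (digE q e) = dig L w q x.
Proof.
move=> [E0 E1 E2 [E3 _ _]] oe ex xM; rewrite /= E1 E2 E3 ex.
have HL : (L < 2 ^ L)%N by apply: ltn_expl.
have H1 : (q * w <= K * 2 ^ L)%N by apply: leq_mul; lia.
have H2 : (q <= K * (2 ^ L).+1)%N.
  by apply: (@leq_trans K); [lia|rewrite leq_pmulr].
have H3 : (L + q * w <= K * (2 ^ L).+1)%N.
  have : (q.+1 * 2 ^ L <= K * 2 ^ L)%N by rewrite leq_mul2r qK orbT.
  have : (q * w <= q * 2 ^ L)%N by rewrite leq_mul2l; lia.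
  rewrite mulSn mulnS; lia.
have H4 : (x %/ 2 ^ (L + q * w) <= x)%N by apply: leq_div.
have H5 := leq_mod (x %/ 2 ^ (L + q * w)) (2 ^ w).
by split=> //; splits => //; rewrite -?/V; lia.
Qed.

Let AccC b : set nat := [set x | (exists2 i, (i < n)%N & x = cell tA i) \/
  exists2 v, (v < V)%N & x = cell tC (v * NB + b)].
Let UpdC b : set nat := [set x | exists2 v, (v < V)%N & x = cell tC (v * NB + b)].

(** The count of a block is a difference of two prefix counts, stated additively to avoid truncated
    subtraction. The counters are incremented from zero, which is why every pass has tables of its
    own in the initially zero memory. *)
Lemma count_bodyP b r h : (b < NB)%N -> same_glob r r0 -> r 1 = b ->
  (forall i, (i < n)%N -> h (cell tA i) = a i) ->
  (forall v, (v < V)%N -> h (cell tC (v * NB + b)) = 0) ->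
  hoare count_body r h (V * 100 + 20) (V * 100 + 20) (AccC b) (UpdC b)
   (fun _ h' => forall v, (v < V)%N ->
      h' (cell tC (v * NB + b)) + ndig n g v (b * V) = ndig n g v (b * V + V))%N.
Proof.
move: tags tagsN => [KA KC KD [KT KS KB]] tN bN rr0 r1 hA hC.
have dAC : tA <> tC by move=> E; move: tN; rewrite E /= !inE eqxx ?orbT /= ?andbF.
have bV t : (t < V)%N -> (b * V + t < 2 ^ L)%N by rewrite -VN; apply: row_lt.
apply: hoare_cost.
- apply: hoare_seq; apply: hoare_asg => //=; try lia.
  apply: (hoare_while (w := 80) (s := 80) (k := V) (Inv := fun k r h =>
    exists t, [/\ k + t = V, r 2 = t, r 1 = b, same_glob r r0 &
     (forall i, (i < n)%N -> h (cell tA i) = a i) /\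
     forall v, (v < V)%N -> h (cell tC (v * NB + b)) + ndig n g v (b * V) =
        ndig n g v (b * V + t)]%N)); last first.
    exists 0; rewrite addn0; split=> //; first exact: same_globU.
    by split=> // v vV; rewrite hC// addn0.
  move=> k {}r {}h [t [kt r2 {}r1 {}rr0 [{}hA {}hC]]].
  have G := globals_same rr0 G0; have [E0 E1 E2 [E3 E4 E5]] := G.
  split.
  + by rewrite /= r2 E3 -/V; bounds.
  + rewrite /= r2 E3 -/V => H v vV; rewrite hC//.
    by have -> : t = V by lia.
  rewrite /= r2 E3 -/V => H; have tV : (t < V)%N by lia.
  have tL := bV t tV.
  case: k kt => [|k] kt; first lia.
  exists k => //; apply: hoare_cost.
  + apply: hoare_seq; apply: hoare_asg => //=; rewrite ?r1 ?r2 ?E3 -/V.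
    * by bounds.
    * lia.
    set i := (b * V + t)%N.
    apply: hoare_seq; apply: (hoare_weak (Q := fun r h => [/\ r 2 = t, r 1 = b, same_glob r r0 &
     (forall i, (i < n)%N -> h (cell tA i) = a i) /\
     forall v, (v < V)%N -> h (cell tC (v * NB + b)) + ndig n g v (b * V) =
        ndig n g v (b * V + t).+1]%N)); last first.
      move=> r3 h3 [s2 s1 sr0 [sA sC]].
      apply: hoare_asg => //=; rewrite ?s2.
      - by bounds.
      - lia.
      exists t.+1; split => //; first lia.
      - by rewrite /upd /= addn1.
      - exact: same_globU.
      - by split=> // v vV; rewrite sC// addnS.
    have rr' : same_glob (upd r 3 i) r0 by apply: same_globU.
    have G' : globals n L w (upd r 3 i) by apply: globalsU.
    apply: (hoare_if (w1 := 60) (s1 := 60)).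
    * by rewrite /= E0; bounds.
    * rewrite /= E0 => lin; have {}lin : (i < n)%N by lia.
      have okA : @ok R M inp D (upd r 3 i) h (AccC b) (Fetch (adE K tA (Reg 3))).
        split.
          by apply: (ok_cell (x := i)) => //; split=> //=; lia.
        by rewrite eval_cell//=; left; exists i.
      have evA : @eval R inp (upd r 3 i) h (Fetch (adE K tA (Reg 3))) = a i.
        by rewrite -hA// /eval -/eval eval_cell.
      have [okd evd] := ok_dig G' okA evA (aM lin).
      apply: hoare_cost.
      - apply: hoare_seq; apply: hoare_asg => //; first by rewrite evd; have := g_lt i; rewrite /g; lia.
        rewrite evd -/(g i).
        have G4 : globals n L w (upd (upd r 3 i) 4 (g i)) by apply: globalsU.
        have gL : (g i * NB + b < 2 ^ L)%N by rewrite -VN'; apply: row_lt.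
        have gLE : @eval R inp (upd (upd r 3 i) 4 (g i)) h
            (Bin Add (Bin Mul (Reg 4) (Reg 14)) (Reg 1)) = (g i * NB + b)%N.
          by rewrite /= r1 E4 -/NB.
        have ok5 : @ok R M inp D (upd (upd r 3 i) 4 (g i)) h (AccC b)
            (Bin Add (Bin Mul (Reg 4) (Reg 14)) (Reg 1)).
          by rewrite /= r1 E4 -/NB; have gV := g_lt i; bounds.
        have cM : (cell tC (g i * NB + b) < M)%N.
          apply: leq_trans (ad_lt n KC gL) _; have := HM; rewrite mulnS; lia.
        apply: hoare_seq; apply: hoare_asg => //.
        + exact: (ok_cell (x := (g i * NB + b)%N)).
        + by rewrite eval_cell// gLE.
        rewrite eval_cell// gLE.
        have Acell : AccC b (cell tC (g i * NB + b)) by right; exists (g i).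
        have hcM : (h (cell tC (g i * NB + b)) <= n)%N.
          have := ndig_n n g (g i) (b * V + t); rewrite -hC//; lia.
        apply: hoare_sto => //=.
        + by bounds.
        + by exists (g i).
        split=> //; first by do 3 apply: same_globU => //.
        split=> [j jn|v vV].
          by rewrite /upd; case: eqP => [/(ad_inj KA KC)[]|]//; rewrite hA.
        rewrite ndigS -/i lin /= -hC//.
        rewrite /upd; case: eqP => [/(ad_inj KC KC)[_]|NE].
          move/(row_inj bN bN) => [-> _]; rewrite eqxx; lia.
        have -> : (g i == v) = false by apply/eqP => E; apply: NE; rewrite E.
        by rewrite addn0.
      - by rewrite /=; lia.
      - by rewrite /=; lia.
    * rewrite /= E0 => lin; apply: hoare_skip; split=> //.
      split=> // v vV; rewrite ndigS hC// -/i.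
      have -> : (i < n)%N = false by lia.
      by rewrite addn0.
  + by rewrite /=; lia.
  + by rewrite /=; lia.
- by rewrite /=; lia.
- by rewrite /=; lia.
Qed.

Let AccD v : set nat := [set x | (exists2 b, (b < NB)%N & x = cell tC (v * NB + b)) \/
  (exists2 b, (b < NB)%N & x = cell tD (v * NB + b)) \/ x = cell tT v].
Let UpdD v : set nat := [set x |
  (exists2 b, (b < NB)%N & x = cell tD (v * NB + b)) \/ x = cell tT v].

(** The counts of one digit, being differences of prefix counts, telescope when summed over the
    blocks. *)
Lemma column_bodyP v r h : (v < V)%N -> same_glob r r0 -> r 1 = v ->
  (forall b, (b < NB)%N ->
     h (cell tC (v * NB + b)) + ndig n g v (b * V) = ndig n g v (b * V + V))%N ->
  hoare column_body r h (NB * 100 + 60) (NB * 100 + 60) (AccD v) (UpdD v)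
   (fun _ h' => (forall b, (b < NB)%N -> h' (cell tD (v * NB + b)) = ndig n g v (b * V))
      /\ h' (cell tT v) = ndig n g v (2 ^ L)).
Proof.
move: tags tagsN => [KA KC KD [KT KS KB]] tN vV rr0 r1 hC.
have dCD : tC <> tD by move=> E; move: tN; rewrite E /= !inE eqxx ?orbT /= ?andbF.
have dDT : tD <> tT by move=> E; move: tN; rewrite E /= !inE eqxx ?orbT /= ?andbF.
have vb b : (b < NB)%N -> (v * NB + b < 2 ^ L)%N by rewrite -VN'; apply: row_lt.
have cM t i : (t < K)%N -> (i < 2 ^ L)%N -> (cell t i < M)%N.
  by move=> tK iL; apply: leq_trans (ad_lt n tK iL) _; have := HM; rewrite mulnS; lia.
apply: hoare_cost.
- apply: hoare_seq; apply: hoare_asg => //=; try lia.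
  apply: hoare_seq; apply: hoare_asg => //=; try lia.
  apply: hoare_seq.
  apply: (hoare_while (w := 80) (s := 80) (k := NB) (Inv := fun k r h =>
    exists t, [/\ k + t = NB, r 2 = t, r 1 = v, same_glob r r0 &
     [/\ r 3 = ndig n g v (t * V),
     (forall b, (b < NB)%N ->
     h (cell tC (v * NB + b)) + ndig n g v (b * V) = ndig n g v (b * V + V)) &
     forall b, (b < t)%N -> h (cell tD (v * NB + b)) = ndig n g v (b * V)]]%N)); last first.
    by exists 0; rewrite addn0; split=> //; do 2 apply: same_globU => //.
  move=> k {}r {}h [t [kt r2 {}r1 {}rr0 [r3 {}hC hD]]].
  have G := globals_same rr0 G0; have [E0 E1 E2 [E3 E4 E5]] := G.
  have tn := ndig_n n g v (t * V).
  split.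
  + by rewrite /= r2 E4 -/NB; bounds.
  + rewrite /= r2 E4 -/NB => H; have tE : t = NB by lia.
    apply: hoare_sto.
    * by apply: (ok_cell (x := v)) => //=; [rewrite r1; bounds|lia].
    * by rewrite /= r3; bounds.
    * by rewrite eval_cell//= r1; right; right.
    * by rewrite eval_cell//= r1; right.
    rewrite eval_cell//= r1; split=> [b bN|].
      by case: eqP => [/(ad_inj KD KT)[]|_]//; rewrite hD// tE.
    by rewrite eqxx r3 tE VN.
  rewrite /= r2 E4 -/NB => H; have tV : (t < NB)%N by lia.
  have tL := vb t tV.
  case: k kt => [|k] kt; first lia.
  exists k => //; apply: hoare_cost.
  + apply: hoare_seq; apply: hoare_asg => //=; rewrite ?r1 ?r2 ?E4 -/NB.
    * by bounds.
    * lia.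
    have G4 : globals n L w (upd r 4 (v * NB + t)) by apply: globalsU.
    apply: hoare_seq; apply: hoare_sto.
    * by apply: (ok_cell (x := (v * NB + t)%N)) => //=; bounds.
    * by rewrite /= r3; bounds.
    * by rewrite eval_cell//=; right; left; exists t.
    * by rewrite eval_cell//=; left; exists t.
    rewrite eval_cell//= r3.
    have sumE := hC t tV.
    have tn' := ndig_n n g v (t * V + V).
    have evE : @eval R inp (upd r 4 (v * NB + t)) (upd h (cell tD (v * NB + t)) (ndig n g v (t * V)))
        (Fetch (adE K tC (Reg 4))) = h (cell tC (v * NB + t)).
      rewrite [LHS]/eval -/eval eval_cell//=.
      by case: eqP => [/(ad_inj KC KD)[]|].
    apply: hoare_seq; apply: hoare_asg => //.
    * split; first by apply: (ok_cell (x := (v * NB + t)%N)) => //=; bounds.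
      by rewrite eval_cell//=; left; exists t.
    * by rewrite evE; lia.
    rewrite evE; apply: hoare_seq; apply: hoare_asg => //=.
    * by rewrite r3; bounds.
    * by rewrite r3; lia.
    rewrite r3 [(ndig _ _ _ _ + h _)%N]addnC sumE.
    apply: hoare_asg => //=.
    * by rewrite r2; bounds.
    * by rewrite r2; lia.
    exists t.+1; rewrite r2; split=> //; first by lia.
    * by rewrite /= addn1.
    * by do 4 apply: same_globU => //.
    split=> //.
    * by rewrite /= mulSn addnC.
    * by move=> b bN; case: eqP => [/(ad_inj KC KD)[]|_]//; apply: hC.
    * move=> b bt; case: eqP => [/(ad_inj KD KD)[_]|NE].
        have bN : (b < NB)%N by lia.
        by move/(row_inj bN tV) => [_ ->].
      apply: hD; have : b <> t by move=> E; apply: NE; rewrite E.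
      by lia.
  + by rewrite /=; lia.
  + by rewrite /=; lia.
- by rewrite /=; lia.
- by rewrite /=; lia.
Qed.

Lemma startsP r h Q : globals n L w r ->
  (forall v, (v < V)%N -> h (cell tT v) = ndig n g v (2 ^ L)) ->
  (forall h', (forall v, (v < V)%N -> h' (cell tS v) = ndiglt n g v) ->
    (forall x, (forall i, x <> cell tS i) -> h' x = h x) -> Q r h') ->
  hoare starts r h (V * 100 + 60) (V * 100 + 60) setT setT Q.
Proof.
move: tags tagsN => [KA KC KD [KT KS KB]] tN G hT HQ.
have dTS : tT <> tS by move=> E; move: tN; rewrite E /= !inE eqxx ?orbT /= ?andbF.
have cM t i : (t < K)%N -> (i < 2 ^ L)%N -> (cell t i < M)%N.
  by move=> tK iL; apply: leq_trans (ad_lt n tK iL) _; have := HM; rewrite mulnS; lia.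
apply: hoare_cost.
- apply: hoare_scoped; apply: hoare_seq; apply: hoare_asg => //=; try lia.
  apply: hoare_seq; apply: hoare_asg => //=; try lia.
  apply: (hoare_while (w := 80) (s := 80) (k := V) (Inv := fun k r h' =>
    exists t, [/\ k + t = V, r 2 = t, globals n L w r &
     [/\ r 3 = ndiglt n g t,
     (forall v, (v < V)%N -> h' (cell tT v) = ndig n g v (2 ^ L)),
     (forall v, (v < t)%N -> h' (cell tS v) = ndiglt n g v) &
     forall x, (forall i, x <> cell tS i) -> h' x = h x]]%N)); last first.
    exists 0; rewrite addn0; split=> //.
    by rewrite ndiglt0.
  move=> k r1 h1 [t [kt r2 {}G [r3 hT1 hS fr]]].
  have [E0 E1 E2 [E3 E4 E5]] := G.
  have tn := ndiglt_le n g t.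
  split.
  + by rewrite /= r2 E3 -/V; bounds.
  + rewrite /= r2 E3 -/V => H; have tE : t = V by lia.
    by apply: HQ => // v vV; apply: hS; rewrite tE.
  rewrite /= r2 E3 -/V => H; have tV : (t < V)%N by lia.
  have tL : (t < 2 ^ L)%N by lia.
  case: k kt => [|k] kt; first lia.
  exists k => //; apply: hoare_cost.
  + apply: hoare_seq; apply: hoare_sto => //.
    * by apply: (ok_cell (x := t)) => //=; bounds.
    * by rewrite /= r3; bounds.
    rewrite eval_cell//= r2 r3.
    have evE : @eval R inp r1 (upd h1 (cell tS t) (ndiglt n g t))
        (Fetch (adE K tT (Reg 2))) = ndig n g t (2 ^ L).
      rewrite [LHS]/eval -/eval eval_cell//= r2.
      by case: eqP => [/(ad_inj KT KS)[]//|_]; apply: hT1.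
    have tn' := ndig_n n g t (2 ^ L).
    apply: hoare_seq; apply: hoare_asg => //.
    * split=> //; first by apply: (ok_cell (x := t)) => //=; bounds.
    * by rewrite evE; lia.
    have nL' : (n <= 2 ^ L)%N by lia.
    have St := ndigltS g t nL'; have := ndiglt_le n g t.+1; rewrite St => tn3.
    rewrite evE; apply: hoare_seq; apply: hoare_asg => //=.
    * by rewrite r3; bounds.
    * by rewrite r3; lia.
    rewrite r3 -St.
    apply: hoare_asg => //=.
    * by rewrite r2; bounds.
    * by rewrite r2; lia.
    exists t.+1; rewrite r2; split=> //; first by lia.
    * by rewrite addn1.
    split=> //.
    * by move=> v vV; case: eqP => [/(ad_inj KT KS)[]//|_]; apply: hT1.
    * move=> v vt; case: eqP => [/(ad_inj KS KS)[_ ->]//|NE].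
      apply: hS; have : v <> t by move=> E; apply: NE; rewrite E.
      by lia.
    * by move=> x Hx /=; rewrite ifN ?fr//; apply/eqP.
  + by rewrite /=; lia.
  + by rewrite /=; lia.
- by rewrite /=; lia.
- by rewrite /=; lia.
Qed.

Let AccS b : set nat := [set x | [\/ exists2 i, (i < n)%N & x = cell tA i,
  exists v, x = cell tS v, exists2 v, (v < V)%N & x = cell tD (v * NB + b) |
  exists2 i, (i < n)%N && (b * V <= i < b * V + V)%N & x = cell tB (dest n g i)]].
Let UpdS b : set nat := [set x | (exists2 v, (v < V)%N & x = cell tD (v * NB + b)) \/
  exists2 i, (i < n)%N && (b * V <= i < b * V + V)%N & x = cell tB (dest n g i)].

(** The entry of [tD] is used as a cursor. When position [i] of the block is reached, it holds the
    number of earlier entries with the same digit, so that adding the start of the digit gives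
    [dest]. *)
Lemma scatter_bodyP b r h : (b < NB)%N -> same_glob r r0 -> r 1 = b ->
  (forall i, (i < n)%N -> h (cell tA i) = a i) ->
  (forall v, (v < V)%N -> h (cell tS v) = ndiglt n g v) ->
  (forall v, (v < V)%N -> h (cell tD (v * NB + b)) = ndig n g v (b * V)) ->
  hoare scatter_body r h (V * 150 + 20) (V * 150 + 20) (AccS b) (UpdS b)
   (fun _ h' => forall i, (i < n)%N -> (b * V <= i < b * V + V)%N ->
      h' (cell tB (dest n g i)) = a i).
Proof.
move: tags tagsN => [KA KC KD [KT KS KB]] tN bN rr0 r1 hA hS hD.
have [dAD dAB dSD dSB dDB] : [/\ tA <> tD, tA <> tB, tS <> tD, tS <> tB & tD <> tB].
  by split=> E; move: tN; rewrite E /= !inE eqxx ?orbT /= ?andbF.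
have bV t : (t < V)%N -> (b * V + t < 2 ^ L)%N by rewrite -VN; apply: row_lt.
have cM t i : (t < K)%N -> (i < 2 ^ L)%N -> (cell t i < M)%N.
  by move=> tK iL; apply: leq_trans (ad_lt n tK iL) _; have := HM; rewrite mulnS; lia.
apply: hoare_cost.
- apply: hoare_seq; apply: hoare_asg => //=; try lia.
  apply: (hoare_while (w := 120) (s := 120) (k := V) (Inv := fun k r h =>
    exists t, [/\ k + t = V, r 2 = t, r 1 = b, same_glob r r0 &
     [/\ (forall i, (i < n)%N -> h (cell tA i) = a i),
      (forall v, (v < V)%N -> h (cell tS v) = ndiglt n g v),
      (forall v, (v < V)%N -> h (cell tD (v * NB + b)) = ndig n g v (b * V + t)) &
      forall i, (i < n)%N -> (b * V <= i < b * V + t)%N ->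
        h (cell tB (dest n g i)) = a i]]%N)); last first.
    exists 0; rewrite addn0; split=> //; first exact: same_globU.
    by split=> // [v vV|i _]; [rewrite addn0 hD|lia].
  move=> k {}r {}h [t [kt r2 {}r1 {}rr0 [{}hA {}hS {}hD hB]]].
  have G := globals_same rr0 G0; have [E0 E1 E2 [E3 E4 E5]] := G.
  split.
  + by rewrite /= r2 E3 -/V; bounds.
  + rewrite /= r2 E3 -/V => H i lin il; apply: hB => //; lia.
  rewrite /= r2 E3 -/V => H; have tV : (t < V)%N by lia.
  have tL := bV t tV.
  case: k kt => [|k] kt; first lia.
  exists k => //; apply: hoare_cost.
  + apply: hoare_seq; apply: hoare_asg => //=; rewrite ?r1 ?r2 ?E3 -/V.
    * by bounds.
    * lia.
    set i := (b * V + t)%N.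
    apply: hoare_seq; apply: (hoare_weak (Q := fun r h => [/\ r 2 = t, r 1 = b, same_glob r r0 &
     [/\ (forall i, (i < n)%N -> h (cell tA i) = a i),
      (forall v, (v < V)%N -> h (cell tS v) = ndiglt n g v),
      (forall v, (v < V)%N -> h (cell tD (v * NB + b)) = ndig n g v (b * V + t).+1) &
      forall i, (i < n)%N -> (b * V <= i < (b * V + t).+1)%N ->
        h (cell tB (dest n g i)) = a i]]%N)); last first.
      move=> r3 h3 [s2 s1 sr0 [sA sS sD sB]].
      apply: hoare_asg => //=; rewrite ?s2.
      - by bounds.
      - lia.
      exists t.+1; split => //; first lia.
      - by rewrite /= addn1.
      - exact: same_globU.
      - by split=> //; rewrite addnS.
    have rr' : same_glob (upd r 3 i) r0 by apply: same_globU.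
    have G' : globals n L w (upd r 3 i) by apply: globalsU.
    apply: (hoare_if (w1 := 100) (s1 := 100)).
    * by rewrite /= E0; bounds.
    * rewrite /= E0 => lin; have {}lin : (i < n)%N by lia.
      have evA : @eval R inp (upd r 3 i) h (Fetch (adE K tA (Reg 3))) = a i.
        by rewrite -hA// /eval -/eval eval_cell.
      have gV := g_lt i.
      have gL : (g i * NB + b < 2 ^ L)%N by rewrite -VN'; apply: row_lt.
      have dl := dest_lt g lin.
      have hDM := ndig_n n g (g i) i.
      apply: hoare_cost.
      - apply: hoare_seq; apply: hoare_asg => //.
        + split; first by apply: (ok_cell (x := i)) => //=; bounds.
          by rewrite eval_cell//=; apply: Or41; exists i.
        + by rewrite evA; apply: aM.
        rewrite evA.
        have G5 : globals n L w (upd (upd r 3 i) 5 (a i)) by apply: globalsU.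
        have [okd evd] : @ok R M inp D (upd (upd r 3 i) 5 (a i)) h (AccS b) (digE q (Reg 5)) /\
           @eval R inp (upd (upd r 3 i) 5 (a i)) h (digE q (Reg 5)) = g i.
          by apply: ok_dig => //=; [split=> //; exact: aM|exact: aM].
        apply: hoare_seq; apply: hoare_asg => //; first by rewrite evd; lia.
        rewrite evd.
        have G4 : globals n L w (upd (upd (upd r 3 i) 5 (a i)) 4 (g i)) by apply: globalsU.
        have gLE : @eval R inp (upd (upd (upd r 3 i) 5 (a i)) 4 (g i)) h
            (Bin Add (Bin Mul (Reg 4) (Reg 14)) (Reg 1)) = (g i * NB + b)%N.
          by rewrite /= r1 E4 -/NB.
        have ok5 : @ok R M inp D (upd (upd (upd r 3 i) 5 (a i)) 4 (g i)) h (AccS b)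
            (Bin Add (Bin Mul (Reg 4) (Reg 14)) (Reg 1)).
          by rewrite /= r1 E4 -/NB; bounds.
        have DM := cM tD _ KD gL.
        apply: hoare_seq; apply: hoare_asg => //.
        + exact: (ok_cell (x := (g i * NB + b)%N)).
        + by rewrite eval_cell// gLE.
        rewrite eval_cell// gLE.
        apply: hoare_seq; apply: hoare_asg => //=.
        + by split; [bounds|apply: Or43; exists (g i)].
        + by rewrite hD// -/i; lia.
        rewrite hD// -/i.
        set r' := upd _ 7 _.
        have r'4 : r' 4 = g i by [].
        have r'7 : r' 7 = ndig n g (g i) i by [].
        have G7 : globals n L w r' by do 2 apply: globalsU => //.
        have dE : @eval R inp r' h (Bin Add (Fetch (adE K tS (Reg 4))) (Reg 7)) = dest n g i.
          by rewrite [LHS]/eval -/eval eval_cell//= hS.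
        have BM := cM tB _ KB (leq_trans dl (proj2 (andP nL))).
        have dn : (ndiglt n g (g i) <= n)%N by apply: ndiglt_le.
        have dM : (dest n g i < M)%N by lia.
        apply: hoare_seq; apply: hoare_sto.
        + apply: (ok_cell (x := dest n g i)) => //; last by lia.
          split.
          * split; first by apply: (ok_cell (x := g i)); rewrite /= ?r'4 //; first [bounds | lia].
            by rewrite eval_cell//=; apply: Or42; exists (g i).
          * by rewrite /= r'7; bounds.
          * by rewrite -/(eval _ _ _) -[X in (X < M)%N]/(@eval R inp r' h (Bin Add (Fetch (adE K tS (Reg 4))) (Reg 7))) dE.
        + by split=> //=; apply: aM.
        + by rewrite eval_cell// dE; apply: Or44; exists i => //; lia.
        + by rewrite eval_cell// dE; right; exists i => //; lia.
        rewrite eval_cell// dE [@eval R inp r' h (Reg 5)]/=.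
        apply: hoare_sto => //=.
        + by bounds.
        + by apply: Or43; exists (g i).
        + by left; exists (g i).
        split=> //; first by do 5 apply: same_globU => //.
        split.
        + move=> j jn; case: eqP => [/(ad_inj KA KD)[]//|_].
          by case: eqP => [/(ad_inj KA KB)[]//|_]; apply: hA.
        + move=> j jn; case: eqP => [/(ad_inj KS KD)[]//|_].
          by case: eqP => [/(ad_inj KS KB)[]//|_]; apply: hS.
        + move=> v vV; rewrite ndigS -/i lin /=.
          case: eqP => [/(ad_inj KD KD)[_]|NE].
            by move/(row_inj bN bN) => [-> _]; rewrite eqxx.
          have -> : (g i == v) = false by apply/eqP => E; apply: NE; rewrite -E.
          by case: eqP => [/(ad_inj KD KB)[]//|_]; rewrite hD// addn0.
        + move=> j jn jl; case: eqP => [/(ad_inj KB KD)[]/esym//|_].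
          case: eqP => [/(ad_inj KB KB)[_] /(dest_inj jn lin) ->//|NE].
          apply: hB => //; have : j <> i by move=> E; apply: NE; rewrite E.
          by rewrite /i; lia.
      - by rewrite /=; lia.
      - by rewrite /=; lia.
    * rewrite /= E0 => lin; apply: hoare_skip; split=> //.
      split=> // [v vV|j jn jl]; last by apply: hB => //; lia.
      rewrite ndigS hD// -/i.
      have -> : (i < n)%N = false by lia.
      by rewrite addn0.
  + by rewrite /=; lia.
  + by rewrite /=; lia.
- by rewrite /=; lia.
- by rewrite /=; lia.
Qed.

Variables (p1 p2 p3 : nat).

Definition radix_pass :=
  Seq (PFor p1 14) (Seq (PFor p2 13) (Seq starts (PFor p3 14))).

Hypothesis prp1 : nth Skip pr p1 = pfor_proc p1 count_body.
Hypothesis prp2 : nth Skip pr p2 = pfor_proc p2 column_body.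
Hypothesis prp3 : nth Skip pr p3 = pfor_proc p3 scatter_body.
Hypothesis Lw : (L - w <= w)%N.

Let radix_cost_work :
  (NB * (V * 100 + 20 + 60) + (V * (NB * 100 + 60 + 60) + (V * 100 + 60 +
     NB * (V * 150 + 20 + 60))) <= 1000 * 2 ^ L)%N.
Proof.
rewrite -VN; have := leq_pmulr NB V0; have := leq_pmull V N0.
by have : (0 < NB * V)%N by [rewrite muln_gt0 N0 V0]; clear; move: V NB => V' NB'; nia.
Qed.

Let radix_cost_span :
  (V * 100 + 20 + 30 * (L - w).+2 + (NB * 100 + 60 + 30 * w.+2 + (V * 100 + 60 +
     (V * 150 + 20 + 30 * (L - w).+2))) <= 2000 * V)%N.
Proof.
have NV : (NB <= V)%N by rewrite leq_exp2l.
have : (w < V)%N by apply: ltn_expl.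
by move: Lw V0 NV; clear; move: V NB (L - w)%N => V' NB' x; lia.
Qed.

Lemma radix_passP h Q :
  (forall i, (i < n)%N -> h (cell tA i) = a i) ->
  (forall i, h (cell tC i) = 0) ->
  (forall h', (forall i, (i < n)%N -> h' (cell tB (dest n g i)) = a i) ->
    (forall x, (forall t i, t \in [:: tC; tD; tT; tS; tB] -> x <> cell t i) ->
       h' x = h x) -> Q r0 h') ->
  hoare radix_pass r0 h (1000 * 2 ^ L) (2000 * V) setT setT Q.
Proof.
move: (tags) (tagsN) => [KA KC KD [KT KS KB]] tN hA hC HQ.
have NBM : (NB + 2 < M)%N by lia.
have VM : (V + 2 < M)%N by lia.
have [E0 E1 E2 [E3 E4 E5]] := G0.
have [dAC dAD dAT] : [/\ tA <> tC, tA <> tD & tA <> tT].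
  by split=> E; move: tN; rewrite E /= !inE eqxx ?orbT /= ?andbF.
have [dAS dAB dCD dCT] : [/\ tA <> tS, tA <> tB, tC <> tD & tC <> tT].
  by split=> E; move: tN; rewrite E /= !inE eqxx ?orbT /= ?andbF.
have [dDT dDS dDB dTS] : [/\ tD <> tT, tD <> tS, tD <> tB & tT <> tS].
  by split=> E; move: tN; rewrite E /= !inE eqxx ?orbT /= ?andbF.
have dSB : tS <> tB.
  by move=> E; move: tN; rewrite E /= !inE eqxx ?orbT /= ?andbF.
have NV : (NB <= V)%N by rewrite leq_exp2l.
have wV : (w < V)%N by apply: ltn_expl.
have memC (x : nat) t i : x = cell t i -> t \in [:: tC; tD; tT; tS; tB] ->
    (forall t i, t \in [:: tC; tD; tT; tS; tB] -> x <> cell t i) -> False.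
  by move=> -> tm /(_ t i tm); apply.
have i0 : tC \in [:: tC; tD; tT; tS; tB] by rewrite !inE eqxx.
have i1 : tD \in [:: tC; tD; tT; tS; tB] by rewrite !inE eqxx ?orbT.
have i2 : tT \in [:: tC; tD; tT; tS; tB] by rewrite !inE eqxx ?orbT.
have i3 : tS \in [:: tC; tD; tT; tS; tB] by rewrite !inE eqxx ?orbT.
have i4 : tB \in [:: tC; tD; tT; tS; tB] by rewrite !inE eqxx ?orbT.
apply: hoare_cost.
- apply: hoare_seq.
  apply: hoare_le; first apply: (@hoare_pfor R M inp D pr p1 count_body NB r0 h _ _
    AccC UpdC (fun b h' => forall v, (v < V)%N ->
      h' (cell tC (v * NB + b)) + ndig n g v (b * V) = ndig n g v (b * V + V))%N
    prp1 NBM _ _ _ _ 14 (L - w) r0 h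
    (fun r h1 => r = r0 /\ (forall v b, (v < V)%N -> (b < NB)%N ->
      h1 (cell tC (v * NB + b)) + ndig n g v (b * V) = ndig n g v (b * V + V))%N /\
      forall x, (forall i, x <> cell tC i) -> h1 x = h x)) => //.
  + move=> b h1 h2 E H v vV; rewrite -E; [exact: H|by exists v].
  + by move=> b x [v vV ->]; right; exists v.
  + move=> b b' x bN b'N bb [v vV ->] [[i _ /(ad_inj KC KA)[/esym]]//|].
    by move=> [v' v'V /(ad_inj KC KC)[_ /(row_inj bN b'N)[]]].
  + move=> b r h1 bN rr r1 HA; apply: count_bodyP => //.
    * by move=> i lin; rewrite HA ?hA//; left; exists i.
    * by move=> v vV; rewrite HA ?hC//; right; exists v.
  + by rewrite N0 leqnn.
  + move=> h1 P1 fr; split=> //; split=> [v b vV bN|x Hx]; first exact: P1.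
    by apply: fr => -[b _ [v _ E]]; apply: (Hx _ E).
  + exact: leqnn.
  + exact: leqnn.
  + by move=> ? _.
  + by move=> ? _.
  move=> _ h1 [-> [P1 fr1]]; apply: hoare_seq.
  have NVk : (0 < V <= 2 ^ w)%N by rewrite V0 leqnn.
  apply: hoare_le; first apply: (@hoare_pfor R M inp D pr p2 column_body V r0 h1 _ _
    AccD UpdD (fun v h' => (forall b, (b < NB)%N -> h' (cell tD (v * NB + b)) = ndig n g v (b * V))
      /\ h' (cell tT v) = ndig n g v (2 ^ L))%N
    prp2 VM _ _ _ _ 13 w r0 h1
    (fun r h2 => r = r0 /\ (forall v b, (v < V)%N -> (b < NB)%N ->
      h2 (cell tD (v * NB + b)) = ndig n g v (b * V))%N /\
      (forall v, (v < V)%N -> h2 (cell tT v) = ndig n g v (2 ^ L))%N /\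
      forall x, (forall i, x <> cell tD i /\ x <> cell tT i) -> h2 x = h1 x)) => //.
  + move=> v h2 h3 E [H H']; split=> [b bN|]; rewrite -E ?H//; [left; by exists b|by right].
  + by move=> v x [[b bN ->]|->]; right; [left; exists b|right].
  + move=> v v' x vV v'V vv [[b bN ->]|->] [[b' b'N]|[[b' b'N]|]].
    * by move/(ad_inj KD KC) => [/esym].
    * by move/(ad_inj KD KD) => [_ /(row_inj bN b'N)[]].
    * by move/(ad_inj KD KT) => [].
    * by move/(ad_inj KT KC) => [/esym].
    * by move/(ad_inj KT KD) => [/esym].
    * by move/(ad_inj KT KT) => [].
  + move=> v r h2 vV rr r1 HA; apply: column_bodyP => // b bN.
    by rewrite HA ?P1//; left; exists b.
  + move=> h2 P2 fr; split=> //; split=> [v b vV bN|]; first by case: (P2 v vV) => ->.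
    split=> [v vV|x Hx]; first by case: (P2 v vV).
    by apply: fr => -[v _ [[b _ E]|E]]; [case: (Hx (v * NB + b)%N)|case: (Hx v)].
  + exact: leqnn.
  + exact: leqnn.
  + by move=> ? _.
  + by move=> ? _.
  move=> _ h2 [-> [D2 [T2 fr2]]]; apply: hoare_seq.
  apply: startsP => // h3 S3 fr3.
  apply: hoare_le; first apply: (@hoare_pfor R M inp D pr p3 scatter_body NB r0 h3 _ _
    AccS UpdS (fun b h' => forall i, (i < n)%N -> (b * V <= i < b * V + V)%N ->
      h' (cell tB (dest n g i)) = a i)
    prp3 NBM _ _ _ _ 14 (L - w) r0 h3 Q) => //.
  + move=> b h4 h5 E H i lin il; rewrite -E; first exact: H.
    by right; exists i => //; rewrite lin.
  + by move=> b x [[v vV ->]|[i il ->]]; [apply: Or43; exists v|apply: Or44; exists i].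
  + move=> b b' x bN b'N bb [[v vV ->]|[i /andP[lin il] ->]] [].
    * by move=> [i _ /(ad_inj KD KA)[/esym]].
    * by move=> [i /(ad_inj KD KS)[]].
    * by move=> [v' _ /(ad_inj KD KD)[_ /(row_inj bN b'N)[]]].
    * by move=> [i _ /(ad_inj KD KB)[]].
    * by move=> [i' _ /(ad_inj KB KA)[/esym]].
    * by move=> [i' /(ad_inj KB KS)[/esym]].
    * by move=> [v' _ /(ad_inj KB KD)[/esym]].
    (* Distinct blocks write distinct output cells: [dest] is injective and an index determines its
       block. *)
    * move=> [i' /andP[li'n il'] /(ad_inj KB KB)[_ /(dest_inj lin li'n) ii]].
      by apply: bb; rewrite (block_uniq il) ii -(block_uniq il').
  + move=> b r h4 bN rr r1 HA; apply: scatter_bodyP => //.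
    * move=> i lin; rewrite HA; last by apply: Or41; exists i.
      rewrite fr3 ?fr2 ?fr1 ?hA//.
      - by move=> j /(ad_inj KA KC)[].
      - by move=> j; split=> /ad_inj[]//.
      - by move=> j /(ad_inj KA KS)[].
    * by move=> v vV; rewrite HA ?S3//; apply: Or42; exists v.
    * move=> v vV; rewrite HA; last by apply: Or43; exists v.
      by rewrite fr3 ?D2// => j /(ad_inj KD KS)[].
  + by rewrite N0 leqnn.
  + move=> h4 P4 fr; apply: HQ => [i lin|x Hx].
      apply: (P4 (i %/ V)) => //.
        by rewrite ltn_divLR// VN (leq_trans lin)//; case/andP: nL.
      exact: block_bounds.
    rewrite fr ?fr3 ?fr2 ?fr1//.
    * by move=> i /memC; apply.
    * by move=> i; split=> /memC; apply.
    * by move=> i /memC; apply.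
    * by move=> [b _ [[v _ /memC]|[i _ /memC]]]; apply.
  + exact: leqnn.
  + exact: leqnn.
  + by move=> ? _.
  + by move=> ? _.
  + by [].
- exact: radix_cost_work.
- exact: radix_cost_span.
Qed.

End Pass.

Section SortKeys.
Variables (L w : nat).

Definition key q x := (x %/ 2 ^ L) %% 2 ^ (q * w).

Lemma key0 x : key 0 x = 0. Proof. by rewrite /key mul0n expn0 modn1. Qed.

Lemma keyS q x : key q.+1 x = dig L w q x * 2 ^ (q * w) + key q x.
Proof.
rewrite /key /dig mulSn expnD (expnD 2 L) divnMA; set y := x %/ 2 ^ L.
set B := 2 ^ w; set A := 2 ^ (q * w).
have A0 : 0 < A by rewrite expn_gt0.
have B0 : 0 < B by rewrite expn_gt0.
have lt : y %/ A %% B * A + y %% A < B * A.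
  apply: (@leq_trans ((y %/ A %% B).+1 * A)).
    by rewrite mulSn addnC ltn_add2r ltn_mod.
  by rewrite leq_mul2r ltn_mod B0 orbT.
have E : y = y %/ A %/ B * (B * A) + (y %/ A %% B * A + y %% A).
  by rewrite mulnA addnA -mulnDl -!divn_eq.
by rewrite {1}E modnMDl modn_small.
Qed.

Lemma key_full q x : x %/ 2 ^ L < 2 ^ (q * w) -> key q x = x %/ 2 ^ L.
Proof. by move=> lx; rewrite /key modn_small. Qed.

(** The invariant of radix sort from the least significant digit: a larger new digit decides, and
    among equal digits stability keeps the order that the previous passes have established. *)
Lemma radix_step n q (a b : nat -> nat) :
  (forall i, i < n -> b (dest n (fun i => dig L w q (a i)) i) = a i) ->
  (forall i j, i < j -> j < n -> key q (a i) <= key q (a j)) ->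
  perm_eq (mkseq b n) (mkseq a n) /\
  (forall i j, i < j -> j < n -> key q.+1 (b i) <= key q.+1 (b j)).
Proof.
set g := fun i => _; move=> ba srt; split.
  have -> : mkseq a n = map b (map (dest n g) (iota 0 n)).
    rewrite /mkseq -map_comp; apply/eq_in_map => i; rewrite mem_iota /= => lin.
    by rewrite ba.
  by apply: perm_map; rewrite perm_sym; apply: dest_perm.
move=> i j ij jn; have lin := ltn_trans ij jn.
have [i' i'n Ei] := dest_surj g lin; have [j' j'n Ej] := dest_surj g jn.
rewrite Ei Ej !ba// !keyS.
move: ij; rewrite Ei Ej => /(dest_le i'n j'n) /orP[lg|/andP[/eqP Eg lij]].
  apply: (@leq_trans ((g i').+1 * 2 ^ (q * w))).
    by rewrite mulSn addnC leq_add2r ltnW// ltn_mod expn_gt0.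
  by apply: leq_trans (leq_addr _ _); rewrite leq_mul2r lg orbT.
by rewrite -/(g i') -/(g j') Eg leq_add2l srt.
Qed.

End SortKeys.

Section Sort.
Local Open Scope classical_set_scope.
Context {R : realType} {M : nat} {inp : nat -> R} {D : set nat} {pr : program}.
Variables (Q p0 : nat).

Definition stride := 5 * Q + 10.

(* Tags: 0, 1, 2 for the nodes of the tree, 3 for the table of spread digits,
   [5 * q + 4] for the array before pass [q]. *)
Definition tag_arr q := 5 * q + 4.

Definition pass q :=
  radix_pass stride (5 * q + 7) (5 * q + 8) (p0 + 3 * q) (p0 + 3 * q + 1)
    (p0 + 3 * q + 2).

Fixpoint passes q k :=
  if k is k'.+1 then Seq (pass q) (passes q.+1 k') else Skip.

Definition pass_procs q :=
  [:: pfor_proc (p0 + 3 * q) (count_body stride q (tag_arr q) (5 * q + 5));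
      pfor_proc (p0 + 3 * q + 1)
        (column_body stride (5 * q + 5) (5 * q + 6) (5 * q + 7));
      pfor_proc (p0 + 3 * q + 2)
        (scatter_body stride q (tag_arr q) (5 * q + 6) (5 * q + 8)
           (tag_arr q.+1))].

Hypothesis prp : forall q i, (q < Q)%N -> (i < 3)%N ->
  nth Skip pr (p0 + 3 * q + i) = nth Skip (pass_procs q) i.

Variables (n L w : nat) (r0 : nat -> nat).
Hypothesis nL : (0 < n <= 2 ^ L)%N.
Hypothesis wL : (w <= L)%N.
Hypothesis Lw : (L - w <= w)%N.
Hypothesis HM : (n + stride * (2 ^ L).+1 < M)%N.
Hypothesis G0 : globals n L w r0.

Lemma passesP k q (a h : nat -> nat) P : (q + k <= Q)%N ->
  (forall i, (i < n)%N -> (a i < M)%N) ->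
  (forall i j, (i < j)%N -> (j < n)%N -> key L w q (a i) <= key L w q (a j))%N ->
  (forall i, (i < n)%N -> h (ad n stride (tag_arr q) i) = a i) ->
  (forall q' i, (q <= q' < Q)%N -> h (ad n stride (5 * q' + 5) i) = 0) ->
  (forall h' b : nat -> nat,
    perm_eq (mkseq b n) (mkseq a n) ->
    (forall i j, (i < j)%N -> (j < n)%N ->
       key L w (q + k) (b i) <= key L w (q + k) (b j))%N ->
    (forall i, (i < n)%N -> h' (ad n stride (tag_arr (q + k)) i) = b i) ->
    P r0 h') ->
  @hoare R M inp D pr (passes q k) r0 h (k * (1000 * 2 ^ L) + 1)
    (k * (2000 * 2 ^ w) + 1) setT setT P.
Proof.
elim: k q a h => [|k IH] q a h qk aM srt ha hC HP.
  by apply: hoare_skip; apply: (HP h a) => //; rewrite addn0.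
have qQ : (q < Q)%N by lia.
apply: (@hoare_cost _ _ _ _ _ _ _ _ (1000 * 2 ^ L + (k * (1000 * 2 ^ L) + 1))
  (2000 * 2 ^ w + (k * (2000 * 2 ^ w) + 1))); last 2 first.
- by rewrite mulSn addnA.
- by rewrite mulSn addnA.
apply: hoare_seq; apply: (@radix_passP stride q (tag_arr q) (5 * q + 5) (5 * q + 6)
  (5 * q + 7) (5 * q + 8) (tag_arr q.+1) R M inp D pr n L w r0 a) => //.
- by rewrite /tag_arr /stride; split; [lia..|split; lia].
- by rewrite /tag_arr /= !inE; lia.
- by rewrite /stride; lia.
- by rewrite /stride; lia.
- by have := prp qQ (erefl (0 < 3)%N); rewrite addn0.
- exact: prp.
- exact: prp.
- by move=> i; apply: hC; rewrite leqnn.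
move=> h' hb fr.
pose b i := h' (ad n stride (tag_arr q.+1) i).
have [pb sb] := radix_step (b := b) hb srt.
have bM i : (i < n)%N -> (b i < M)%N.
  move=> lin; have : b i \in mkseq a n.
    by rewrite -(perm_mem pb); apply/mapP; exists i => //; rewrite mem_iota.
  by move=> /mapP[j]; rewrite mem_iota => /andP[_ jn] ->; apply: aM.
apply: (IH q.+1 b) => //.
- by rewrite addSnnS.
- move=> q' i qq'; rewrite fr ?hC//; first by lia.
  move=> t j tm /ad_inj H; move: (tm); rewrite !inE /tag_arr => tm'.
  by have [] := H _ _; rewrite /stride; lia.
- move=> h2 c pc sc hc; apply: (HP h2 c) => //.
  + exact: perm_trans pc pb.
  + by rewrite -addSnnS.
  + by rewrite -addSnnS.
Qed.

End Sort.

Section Sorted.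
Variables (T : eqType) (code enc : T -> nat) (L : nat) (s : seq T).
Hypothesis code_inj : {in s &, injective code}.
Hypothesis encE : forall x, enc x %/ 2 ^ L = code x.

(** Codes are distinct on [s], so only one arrangement is sorted; the result of the machine is
    therefore that of [sort], although the algorithms differ. *)
Lemma sorted_by_key (l : seq nat) :
  perm_eq l (map enc s) -> sorted (relpre (divn^~ (2 ^ L)) leq) l ->
  l = map enc (sort (relpre code leq) s).
Proof.
move=> pl sl; apply: (@sorted_eq_in _ (relpre (divn^~ (2 ^ L)) leq)) => //.
- by move=> x y z _ _ _ /=; apply: leq_trans.
- move=> x y; rewrite !(perm_mem pl) => /mapP[i ins ->] /mapP[j jns ->] /=.
  by rewrite !encE => /anti_leq /code_inj ->.
- rewrite sorted_map; apply: sub_sorted (sort_sorted _ _) => [i j /=|i j /=].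
    by rewrite !encE.
  exact: leq_total.
- apply: perm_trans pl _; apply: perm_map; by rewrite perm_sym perm_sort.
Qed.

End Sorted.

(** * Morton codes *)

Section Spread.
Variable d : nat.

Definition spread b x := \sum_(j < b) bit j x * 2 ^ (j * d).

Lemma bit0 x : bit 0 x = odd x.
Proof. by rewrite /bit expn0 divn1. Qed.

Lemma bitS j x : bit j.+1 x = bit j (x %/ 2).
Proof. by rewrite /bit expnS divnMA. Qed.

Lemma bit_div j k x : bit j (x %/ 2 ^ k) = bit (k + j) x.
Proof. by rewrite /bit expnD divnMA. Qed.

Lemma bit_mod j k x : j < k -> bit j (x %% 2 ^ k) = bit j x.
Proof.
elim: j k x => [|j IH] [|k] x //= jk.
  by rewrite !bit0 expnS odd_mod// oddM.
by rewrite !bitS expnS mulnC -modn_divl IH.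
Qed.

Lemma bit_small j x : x < 2 ^ j -> bit j x = false.
Proof. by move=> lx; rewrite /bit divn_small. Qed.

Lemma spreadS b x : spread b.+1 x = odd x + spread b (x %/ 2) * 2 ^ d.
Proof.
rewrite /spread big_ord_recl /= mul0n expn0 muln1 bit0; congr addn.
rewrite big_distrl /=; apply: eq_bigr => j _.
by rewrite /bump /= bitS mulSn expnD mulnA mulnAC.
Qed.

Lemma spreadD b b' x :
  spread (b + b') x = spread b (x %% 2 ^ b) + spread b' (x %/ 2 ^ b) * 2 ^ (b * d).
Proof.
rewrite /spread big_split_ord /= big_distrl /=; congr addn; apply: eq_bigr => j _.
  by rewrite bit_mod.
by rewrite bit_div -mulnA -expnD; congr (_ * 2 ^ _); rewrite mulnDl addnC.
Qed.

Lemma spread_widen b b' x : x < 2 ^ b -> b <= b' -> spread b' x = spread b x.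
Proof.
move=> lx bb; rewrite -(subnKC bb) spreadD modn_small// divn_small//.
rewrite [spread _ 0]big1 ?addn0// => j _.
by rewrite bit_small ?expn_gt0.
Qed.

Lemma spread0 b : spread b 0 = 0.
Proof. by rewrite /spread big1// => j _; rewrite bit_small ?expn_gt0. Qed.

(** The recurrence by which the table is filled: the entry of [x] comes from that of [x %/ 2]. *)
Lemma spread_rec w x : 0 < w -> x < 2 ^ w ->
  spread w x = spread w (x %/ 2) * 2 ^ d + x %% 2.
Proof.
case: w => // w _; rewrite expnS => lx; rewrite spreadS addnC modn2.
by rewrite -(@spread_widen w w.+1)//; lia.
Qed.

End Spread.

Lemma bit_decomp m x : (x %/ 2 ^ m = 2 * (x %/ 2 ^ m.+1) + bit m x).
Proof.
by rewrite expnSr divnMA /bit; have := odd_double_half (x %/ 2 ^ m); lia.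
Qed.

Section Interleave.

Definition binary d (x : nat -> bool) := \sum_(c < d) x c * 2 ^ (d.-1 - c).

Lemma binaryS d x : binary d.+1 x = binary d x * 2 + x d.
Proof.
rewrite /binary big_ord_recr /= subnn muln1; congr addn.
rewrite big_distrl /=; apply: eq_bigr => c _; rewrite -mulnA -expnSr.
by congr (_ * 2 ^ _); have := ltn_ord c; lia.
Qed.

Lemma binary_lt d x : binary d x < 2 ^ d.
Proof.
elim: d => [|d IH]; first by rewrite /binary big_ord0.
by rewrite binaryS expnS; case: (x d); lia.
Qed.

Lemma binary_inj d x y : binary d x = binary d y -> forall c, c < d -> x c = y c.
Proof.
elim: d => // d IH; rewrite !binaryS => E c; rewrite ltnS leq_eqVlt.
have [E1 E2] : binary d x = binary d y /\ x d = y d.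
  by move: E; case: (x d); case: (y d); split => //; lia.
by move=> /orP[/eqP ->//|]; apply: IH.
Qed.

Variable d : nat.

(** The Morton code summed by coordinates instead of digits, so that each coordinate enters through
    [spread], which the machine can look up. Its recursion by levels is [interleaveS]: the low [d]
    bits take one bit of each coordinate. *)
Definition interleave b (v : nat -> nat) :=
  \sum_(c < d) spread d b (v c) * 2 ^ (d.-1 - c).

Lemma interleaveS b v : interleave b.+1 v =
  interleave b (fun c => v c %/ 2) * 2 ^ d + binary d (fun c => odd (v c)).
Proof.
rewrite /interleave /binary big_distrl /= -big_split /=.
by apply: eq_bigr => c _; rewrite spreadS mulnDl addnC mulnAC.
Qed.

Lemma interleave0 v : interleave 0 v = 0.
Proof. by rewrite /interleave big1// => c _; rewrite /spread big_ord0. Qed.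

Lemma interleave_lt b v : interleave b v < 2 ^ (b * d).
Proof.
elim: b v => [|b IH] v; first by rewrite interleave0 expn_gt0.
rewrite interleaveS mulSn expnD.
apply: (@leq_trans ((interleave b (fun c => v c %/ 2)).+1 * 2 ^ d)).
  by rewrite mulSn addnC ltn_add2r binary_lt.
by rewrite mulnC leq_mul2l IH orbT.
Qed.

Lemma interleave_div1 b v :
  interleave b.+1 v %/ 2 ^ d = interleave b (fun c => v c %/ 2).
Proof.
by rewrite interleaveS divnMDl ?expn_gt0// divn_small ?addn0// binary_lt.
Qed.

(** Dropping [j * d] bits of the code amounts to passing to the dyadic cube of side 2 ^ j. *)
Lemma interleave_div b j v :
  interleave (j + b) v %/ 2 ^ (j * d) = interleave b (fun c => v c %/ 2 ^ j).
Proof.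
elim: j v => [|j IH] v.
  rewrite mul0n expn0 divn1 add0n; congr interleave.
  by apply/funext => c /=; rewrite divn1.
rewrite mulSn expnD divnMA addSn interleave_div1 IH; congr interleave.
by apply/funext => c /=; rewrite expnS divnMA.
Qed.

Lemma interleave_inj b v v' :
  (forall c, c < d -> v c < 2 ^ b) -> (forall c, c < d -> v' c < 2 ^ b) ->
  interleave b v = interleave b v' -> forall c, c < d -> v c = v' c.
Proof.
elim: b v v' => [|b IH] v v' lv lv' E c cd.
  by move: (lv c cd) (lv' c cd); rewrite expn0 !ltnS !leqn0 => /eqP -> /eqP ->.
have E1 : interleave b (fun c => v c %/ 2) = interleave b (fun c => v' c %/ 2).
  by rewrite -!interleave_div1 E.
have E2 : binary d (fun c => odd (v c)) = binary d (fun c => odd (v' c)).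
  by move: E; rewrite !interleaveS E1 => /addnI.
have h c' : c' < d -> v c' %/ 2 < 2 ^ b by move=> /lv; rewrite expnS; lia.
have h' c' : c' < d -> v' c' %/ 2 < 2 ^ b by move=> /lv'; rewrite expnS; lia.
have := IH _ _ h h' E1 c cd; have := binary_inj E2 cd; lia.
Qed.

Lemma interleave_widen b b' v : (forall c, c < d -> v c < 2 ^ b) -> b <= b' ->
  interleave b' v = interleave b v.
Proof.
move=> lv bb; apply: eq_bigr => c _; congr muln.
by apply: spread_widen => //; apply: lv.
Qed.

(** This lets the number of digits of all coordinates be read off the codes; by sortedness the last
    code suffices. *)
Lemma interleave_lt_iff B b v : (forall c, c < d -> v c < 2 ^ B) ->
  interleave B v < 2 ^ (b * d) <-> forall c, c < d -> v c < 2 ^ b.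
Proof.
move=> lv; split=> [lt c cd|lt].
  have [Bb|bB] := leqP B b; first by apply: leq_trans (lv c cd) _; rewrite leq_exp2l.
  have E : interleave (B - b) (fun c => v c %/ 2 ^ b) = interleave (B - b) (fun=> 0).
    rewrite -interleave_div subnKC ?(ltnW bB)// divn_small//.
    by rewrite /interleave big1// => c' _; rewrite spread0.
  have lvb c' : c' < d -> v c' %/ 2 ^ b < 2 ^ (B - b).
    move=> c'd; rewrite ltn_divLR ?expn_gt0// -expnD subnK ?(ltnW bB)//.
    exact: lv.
  have l0 c' : c' < d -> 0 < 2 ^ (B - b) by rewrite expn_gt0.
  have /eqP := interleave_inj lvb l0 E cd.
  by rewrite -leqn0 -ltnS ltn_divLR ?expn_gt0// mul1n.
have [bB|Bb] := leqP b B; first by rewrite (interleave_widen lt bB) interleave_lt.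
apply: leq_trans (interleave_lt _ _) _.
by rewrite leq_exp2l// leq_mul2r (ltnW Bb) orbT.
Qed.

Definition coords (v : 'rV[nat]_d) (c : nat) : nat :=
  if insub c is Some c' then v ord0 c' else 0.

Lemma coordsE v (c : 'I_d) : coords v c = v ord0 c.
Proof. by rewrite /coords valK. Qed.

Lemma mortonE b (v : 'rV[nat]_d) : morton b v = interleave b (coords v).
Proof.
rewrite /morton exchange_big /=; apply: eq_bigr => c _.
rewrite coordsE /spread big_distrl /=; apply: eq_bigr => j _.
by rewrite -mulnA -expnD.
Qed.

Lemma nbits_le n (z : 'I_n -> 'rV[nat]_d) b :
  (nbits z <= b) <-> forall i c, z i ord0 c < 2 ^ b.
Proof.
have lmax i c : z i ord0 c <= \max_(i < n) \max_(c < d) z i ord0 c.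
  apply: leq_trans (@leq_bigmax _ (fun i => \max_(c < d) z i ord0 c) i).
  exact: (@leq_bigmax _ (fun c => z i ord0 c)).
rewrite /nbits; split=> [H i c|H].
  apply: leq_ltn_trans (lmax i c) _.
  by apply: leq_trans (up_logP _ (isT : 1 < 2)) _; rewrite leq_exp2l.
apply: up_log_min => //.
have p0 : 0 < 2 ^ b by rewrite expn_gt0.
rewrite -(prednK p0) ltnS; apply/bigmax_leqP => i _; apply/bigmax_leqP => c _.
by rewrite -ltnS prednK.
Qed.

End Interleave.

(** * Building the tree from the sorted codes *)

Fixpoint zd_cost (f : nat -> nat) (T : Type) (code : T -> nat) (cutoff m : nat)
    (s : seq T) : nat :=
  match m with
  | 0 => 60
  | m'.+1 =>
      if size s < cutoff then 60
      else f (size s) + (zd_cost f code cutoff m' [seq x <- s | ~~ bit m' (code x)]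
                       + zd_cost f code cutoff m' [seq x <- s | bit m' (code x)])
  end.

(* The points of an internal node are split by binary search. *)
Definition node_cost k := 70 * trunc_log 2 k + 300.

Section Build.
Variables (K tA cutoff pb : nat).

Definition bisect :=
  WhE (ltE (Reg 5) (Reg 6))
    (Seq (Asg 7 (Bin Div (Bin Add (Reg 5) (Reg 6)) (Cst 2)))
         (IfE (Bin Mod (Bin Shr (Fetch (adE K tA (Reg 7)))
                         (Bin Add (Reg 11) (Reg 4))) (Cst 2))
            (Asg 6 (Reg 7))
            (Asg 5 (Bin Add (Reg 7) (Cst 1))))).

(* Builds the subtree of number [r 1] for the points at positions [r 2] to
   [r 3 - 1], which agree on all but the last [r 4] bits. *)
Definition build_proc :=
  IfE (Bin Add (Bin Eq (Reg 4) (Cst 0))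
               (ltE (Bin Defs.Sub (Reg 3) (Reg 2)) (Cst cutoff)))
    (Seq (Sto (adE K 0 (Reg 1)) (Cst 0))
    (Seq (Sto (adE K 1 (Reg 1)) (Bin Defs.Sub (Reg 3) (Reg 2)))
         (Sto (adE K 2 (Reg 1)) (Reg 2))))
    (Seq (Asg 4 (Bin Defs.Sub (Reg 4) (Cst 1)))
    (Seq (Asg 5 (Reg 2))
    (Seq (Asg 6 (Reg 3))
    (Seq bisect
    (Seq (Asg 8 (Bin Mul (Cst 2) (Reg 1)))
    (Seq (Asg 9 (Bin Add (Reg 8) (Cst 1)))
    (Seq (Sto (adE K 0 (Reg 1)) (Cst 1))
    (Seq (Sto (adE K 1 (Reg 1)) (adE K 0 (Reg 8)))
    (Seq (Sto (adE K 2 (Reg 1)) (adE K 0 (Reg 9)))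
         (Fork (Seq (Asg 1 (Reg 8)) (Seq (Asg 3 (Reg 5)) (Call pb)))
               (Seq (Asg 1 (Reg 9)) (Seq (Asg 2 (Reg 5)) (Call pb))))))))))))).

Local Open Scope classical_set_scope.
Context {R : realType} {M : nat} {inp : nat -> R} {D : set nat} {pr : program}.
Hypothesis prp : nth Skip pr pb = build_proc.

Variables (n L w B : nat).
Variables (pos : nat -> 'I_n) (code : 'I_n -> nat) (e : nat -> nat).
Hypothesis tAK : (2 < tA < K)%N.
Hypothesis nL : (n <= 2 ^ L)%N.
Hypothesis HM : (n + K * 2 ^ B <= M)%N.
Hypothesis LB : (L + 2 <= B)%N.
Hypothesis LM : (L + B < M)%N.
Hypothesis cutM : (cutoff < M)%N.
Hypothesis eM : forall p, (p < n)%N -> (e p < M)%N.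
Hypothesis ecode : forall p, (p < n)%N -> (e p %/ 2 ^ L)%N = code (pos p).
Hypothesis code_mono : forall p p', (p <= p')%N -> (p' < n)%N ->
  (code (pos p) <= code (pos p'))%N.

Notation cell t i := (ad n K t i).
Notation hoare := (@hoare R M inp D pr).

Let K3 : (3 < K)%N. Proof. by lia. Qed.
Let cellM t i : (t < K)%N -> (i < 2 ^ B)%N -> (cell t i < M)%N.
Proof. by move=> tK iB; apply: leq_trans (ad_lt n tK iB) HM. Qed.
Let BM : (4 * 2 ^ B + n <= M)%N.
Proof. by apply: leq_trans HM; rewrite addnC leq_add2l leq_mul2r K3 orbT. Qed.

(** Nodes are numbered as in a binary heap, with root 1 and children [2 * id] and [2 * id + 1], so
    that parallel processes need no common allocator. The descendants of [id] are the numbers that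
    have [id] as a binary prefix. *)
Definition desc id x := exists k, (x %/ 2 ^ k)%N = id.

Lemma desc_refl id : desc id id.
Proof. by exists 0; rewrite expn0 divn1. Qed.

Lemma desc_child id c x : desc (2 * id + c) x -> (c < 2)%N -> desc id x.
Proof.
move=> [k E] c2; exists k.+1; rewrite expnSr divnMA E; lia.
Qed.

Lemma desc_self id c : (0 < id)%N -> ~ desc (2 * id + c) id.
Proof.
move=> id0 [k E]; have := leq_div id (2 ^ k); rewrite E; lia.
Qed.

Lemma desc_disj id x : (0 < id)%N -> desc (2 * id) x -> ~ desc (2 * id + 1) x.
Proof.
move=> id0 [k E] [k' E'].
have shrink y j : (0 < j)%N -> (y %/ 2 ^ j <= y %/ 2)%N.
  by case: j => // j _; rewrite expnS divnMA leq_div.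
have [kk|kk|kk] := ltngtP k k'.
- have := shrink (2 * id)%N (k' - k)%N; rewrite subn_gt0 kk -E -divnMA -expnD.
  rewrite (subnKC (ltnW kk)) E' => /(_ isT); rewrite E; lia.
- have := shrink (2 * id + 1)%N (k - k')%N; rewrite subn_gt0 kk -E' -divnMA -expnD.
  rewrite (subnKC (ltnW kk)) E => /(_ isT); rewrite E'; lia.
- by move: E'; rewrite -kk E; lia.
Qed.

Definition nodes id : set nat :=
  [set a | exists t x, [/\ (t < 3)%N, desc id x & a = cell t x]].

Lemma nodes_child id c : (c < 2)%N -> nodes (2 * id + c) `<=` nodes id.
Proof. by move=> c2 a [t [x [t3 dx ->]]]; exists t, x; split=> //; apply: desc_child dx c2. Qed.

Lemma nodes_disj id a : (0 < id)%N -> nodes (2 * id) a -> ~ nodes (2 * id + 1) a.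
Proof.
move=> id0 [t [x [t3 dx ->]]] [t' [x' [t3' dx' /ad_inj H]]].
have [_ E] := H ltac:(lia) ltac:(lia).
by move: dx'; rewrite -E; apply: desc_disj.
Qed.

Lemma nodes_self id c t : (0 < id)%N -> (t < 3)%N -> ~ nodes (2 * id + c) (cell t id).
Proof.
move=> id0 t3 [t' [x' [t3' dx' /ad_inj H]]].
have [_ E] := H ltac:(lia) ltac:(lia).
by move: dx'; rewrite -E; apply: desc_self.
Qed.

Lemma nodes_ge id a : nodes id a -> (n <= a)%N.
Proof. by move=> [t [x [_ _ ->]]]; rewrite leq_addr. Qed.

Lemma nodes_arr id p : ~ nodes id (cell tA p).
Proof. by move=> [t [x [t3 _ /ad_inj H]]]; have [] := H _ _; lia. Qed.

(** [represents] with every address fixed by the heap numbering and the leaf arrays confined to the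
    cells below [n]. In this form the cells on which a subtree depends are known, which [stored_ext]
    exploits. *)
Fixpoint stored (h : nat -> nat) id (t : zdtree 'I_n) : Prop :=
  match t with
  | Leaf s => [/\ h (cell 0 id) = 0, h (cell 1 id) = size s
     & exists lo, [/\ h (cell 2 id) = lo, (lo + size s <= n)%N
        & [seq h (lo + j)%N | j <- iota 0 (size s)] = [seq val i | i <- s]]]
  | Node l r => [/\ h (cell 0 id) = 1, h (cell 1 id) = cell 0 (2 * id),
     h (cell 2 id) = cell 0 (2 * id + 1)
     & stored h (2 * id) l /\ stored h (2 * id + 1) r]
  end.

Lemma stored_represents h id t : stored h id t -> represents h (cell 0 id) t.
Proof.
have c1 x : (cell 0 x).+1 = cell 1 x by rewrite /ad addn0 addn1 addnS.
have c2 x : (cell 1 x).+1 = cell 2 x by rewrite /ad addn1 addn2 !addnS.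
elim: t id => [s|l IHl r IHr] id /=.
  move=> [h0 h1 [lo [h2 _ E]]]; split; rewrite ?c1//.
  by rewrite -E; apply: eq_map => j /=; rewrite c2 h2.
by rewrite !c1 c2 => -[-> -> -> [/IHl ? /IHr ?]].
Qed.

Lemma stored_ext h h' id t : (forall a, (a < n)%N -> h' a = h a) ->
  (forall a, nodes id a -> h' a = h a) -> stored h id t -> stored h' id t.
Proof.
move=> low; elim: t id => [s|l IHl r IHr] id hn /=.
  have hid t : (t < 3)%N -> h' (cell t id) = h (cell t id).
    by move=> t3; apply: hn; exists t, id; split=> //; apply: desc_refl.
  rewrite !hid// => -[-> -> [lo [-> los E]]]; split=> //; exists lo; split=> //.
  rewrite -E; apply/eq_in_map => j; rewrite mem_iota => js; apply: low; lia.
have hid t : (t < 3)%N -> h' (cell t id) = h (cell t id).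
  by move=> t3; apply: hn; exists t, id; split=> //; apply: desc_refl.
rewrite !hid// => -[-> -> -> [sl sr]]; split=> //; split.
  by apply: IHl => // a na; apply: hn; apply: (@nodes_child id 0) => //; rewrite addn0.
by apply: IHr => // a na; apply: hn; apply: (@nodes_child id 1).
Qed.

Lemma ok_cellB t x r h A xe : globals n L w r -> (t < K)%N -> @ok R M inp D r h A xe ->
  @eval R inp r h xe = x -> (x < 2 ^ B)%N -> @ok R M inp D r h A (adE K t xe).
Proof.
move=> [E0 _ _ _] tK oe ex xL /=; rewrite E0 ex.
have := cellM tK xL; rewrite /ad => H.
have H3 : (2 ^ 1 <= 2 ^ B)%N by rewrite leq_exp2l//; lia.
have H2 : (K * 2 <= K * 2 ^ B)%N by rewrite leq_mul2l H3 orbT.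
by splits => //; lia.
Qed.

(** Binary search for the first position whose bit [m] is set. The gap is below 2 ^ (trunc_log 2 (hi
    - lo) + 1) at the start and is halved by each round. *)
Lemma bisectP lo hi m r h A U : globals n L w r -> r 4 = m -> r 5 = lo -> r 6 = hi ->
  (lo <= hi <= n)%N -> (m < B)%N ->
  (forall p, (p < n)%N -> h (cell tA p) = e p) ->
  (forall p, (p < n)%N -> A (cell tA p)) ->
  (forall p p', (lo <= p <= p')%N -> (p' < hi)%N ->
     bit m (code (pos p)) -> bit m (code (pos p'))) ->
  hoare bisect r h (70 * trunc_log 2 (hi - lo) + 80)
     (70 * trunc_log 2 (hi - lo) + 80) A U
    (fun r' h' => [/\ h' = h, globals n L w r', r' 4 = m,
       [/\ r' 1 = r 1, r' 2 = r 2 & r' 3 = r 3] &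
       [/\ (lo <= r' 5 <= hi)%N,
          (forall p, (lo <= p < r' 5)%N -> ~~ bit m (code (pos p))) &
          (forall p, (r' 5 <= p < hi)%N -> bit m (code (pos p)))]]).
Proof.
move=> G r4 r5 r6 lohi mB hA AA mono.
have LL : (n <= 2 ^ B)%N by apply: leq_trans nL _; rewrite leq_exp2l//; lia.
apply: hoare_cost.
- apply: (hoare_while (w := 55) (s := 55) (k := (trunc_log 2 (hi - lo)).+1)
   (Inv := fun k r' h' => [/\ h' = h, globals n L w r', r' 4 = m,
       [/\ r' 1 = r 1, r' 2 = r 2 & r' 3 = r 3] &
       [/\ [/\ lo <= r' 5, r' 5 <= r' 6 & r' 6 <= hi]%N, (r' 6 - r' 5 < 2 ^ k)%N,
          (forall p, (lo <= p < r' 5)%N -> ~~ bit m (code (pos p))) &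
          (forall p, (r' 6 <= p < hi)%N -> bit m (code (pos p)))]])); last first.
    split=> //; rewrite r5 r6; split=> //; [by split=> //; lia|exact: trunc_log_ltn|lia|lia].
  move=> k r1 _ [-> {}G {}r4 rr [[l5 l56 l6] lk lob hib]].
  have [E0 E1 E2 [E3 E4 E5]] := G.
  split.
  + by rewrite /=; bounds.
  + move=> /= H; have E : r1 6 = r1 5 by lia.
    by split=> //; split=> //; [lia|rewrite -E].
  move=> /= H.
  case: k lk => [|k] lk; first by move: lk; rewrite expn0; lia.
  exists k => //.
  set mid := ((r1 5 + r1 6) %/ 2)%N.
  have midn : (mid < n)%N by rewrite /mid; lia.
  have midb : (r1 5 <= mid < r1 6)%N by rewrite /mid; lia.
  apply: hoare_cost.
  + apply: hoare_seq; apply: hoare_asg => //=.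
    * by splits => //; lia.
    * by rewrite -/mid; lia.
    rewrite -/mid.
    have evL : @eval R inp (upd r1 7 mid) h (Fetch (adE K tA (Reg 7))) = e mid.
      by rewrite /= E0 -/(cell tA mid) hA.
    have okL : @ok R M inp D (upd r1 7 mid) h A (Fetch (adE K tA (Reg 7))).
      split; last by rewrite /= E0; apply: (AA mid).
      by apply: (ok_cellB (x := mid)) => //=; [lia|bounds|lia].
    have em := eM midn.
    have ev eL : @eval R inp (upd r1 7 mid) h eL = e mid ->
        @eval R inp (upd r1 7 mid) h (Bin Mod (Bin Shr eL
          (Bin Add (Reg 11) (Reg 4))) (Cst 2)) = bit m (code (pos mid)).
      by move=> /= ->; rewrite E1 r4 expnD divnMA ecode// modn2.
    have okE eL : @eval R inp (upd r1 7 mid) h eL = e mid ->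
        @ok R M inp D (upd r1 7 mid) h A eL ->
        @ok R M inp D (upd r1 7 mid) h A (Bin Mod (Bin Shr eL
          (Bin Add (Reg 11) (Reg 4))) (Cst 2)).
      move=> evL' okL'; have /= evS := ev _ evL'.
      have LmM : (r1 11 + r1 4 < M)%N by rewrite E1 r4; lia.
      have sM : (@eval R inp (upd r1 7 mid) h eL %/ 2 ^ (r1 11 + r1 4) < M)%N.
        by rewrite evL'; apply: leq_ltn_trans em; apply: leq_div.
      rewrite /= evS; split; [split=> //| |by case: bit; lia].
        by rewrite E1 r4; bounds.
      by lia.
    apply: (hoare_if (w1 := 10) (s1 := 10) (w2 := 10) (s2 := 10)).
    * exact: okE.
    * rewrite ev// => /eqP b1; apply: hoare_cost; first apply: hoare_asg => //=.
      - by splits => //; lia.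
      - by lia.
      split=> //; split=> //.
      - by split=> //; lia.
      - by move: lk; rewrite expnS /mid; lia.
      - move=> p pl; have [p6|p6] := leqP (r1 6) p; first by apply: hib; lia.
        by apply: (mono mid); [lia|lia|move: b1; case: bit].
      - by [].
      - by [].
    * rewrite ev// => b0; apply: hoare_cost; first apply: hoare_asg => //=.
      - by splits => //; lia.
      - by lia.
      split=> //; split=> //.
      - by split=> //; lia.
      - by move: lk; rewrite expnS /mid; lia.
      - move=> p pl; have [p5|p5] := ltnP p (r1 5); first by apply: lob; lia.
        apply/negP => bp; move: b0; rewrite (mono p mid _ _ bp)//; lia.
      - by [].
      - by [].
  + by rewrite /=; lia.
  + by rewrite /=; lia.
- by rewrite /=; lia.
- by rewrite /=; lia.
Qed.

Let seg lo hi := [seq pos p | p <- iota lo (hi - lo)].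

Lemma seg_cat lo sp hi : (lo <= sp <= hi)%N -> seg lo hi = seg lo sp ++ seg sp hi.
Proof.
move=> H; rewrite /seg -map_cat -{2}(subnKC (proj1 (andP H))) -iotaD.
by congr (map _ (iota _ _)); lia.
Qed.

Lemma seg_filter (P : pred 'I_n) lo sp hi : (lo <= sp <= hi)%N ->
  (forall p, (lo <= p < sp)%N -> ~~ P (pos p)) ->
  (forall p, (sp <= p < hi)%N -> P (pos p)) ->
  [seq x <- seg lo hi | ~~ P x] = seg lo sp /\ [seq x <- seg lo hi | P x] = seg sp hi.
Proof.
move=> H HN HP; rewrite (seg_cat H) !filter_cat.
have all1 : all (predC P) (seg lo sp).
  by apply/allP => _ /mapP[p pi ->]; apply: HN; move: pi; rewrite mem_iota; lia.
have all2 : all P (seg sp hi).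
  by apply/allP => _ /mapP[p pi ->]; apply: HP; move: pi; rewrite mem_iota; lia.
have n1 : [seq x <- seg lo sp | P x] = [::].
  by apply/eqP; rewrite -[_ == _]negbK -has_filter -all_predC.
have n2 : [seq x <- seg sp hi | ~~ P x] = [::].
  apply/eqP; rewrite -[_ == _]negbK -has_filter -all_predC.
  by rewrite (eq_all (a2 := P))// => x /=; rewrite negbK.
by move: (all_filterP all1) (all_filterP all2); rewrite n1 n2 => -> ->; rewrite cats0.
Qed.

Lemma size_seg a b : size (seg a b) = (b - a)%N.
Proof. by rewrite size_map size_iota. Qed.

Let Acc id := nodes id `|` [set a | exists2 p, (p < n)%N & a = cell tA p].

Let node_mem id t : (t < 3)%N -> nodes id (cell t id).
Proof. by move=> t3; exists t, id; split=> //; apply: desc_refl. Qed.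

Let LL : (n <= 2 ^ B)%N.
Proof. by apply: leq_trans nL _; rewrite leq_exp2l//; lia. Qed.

Lemma build_leafP id lo hi r (h : nat -> nat) : globals n L w r ->
  r 1 = id -> r 2 = lo -> r 3 = hi -> (id < 2 ^ B)%N -> (lo <= hi <= n)%N ->
  (forall p, (p < n)%N -> h p = pos p :> nat) ->
  hoare (Seq (Sto (adE K 0 (Reg 1)) (Cst 0))
    (Seq (Sto (adE K 1 (Reg 1)) (Bin Defs.Sub (Reg 3) (Reg 2)))
         (Sto (adE K 2 (Reg 1)) (Reg 2)))) r h 40 40 (Acc id) (nodes id)
    (fun _ h' => stored h' id (Leaf (seg lo hi))).
Proof.
move=> G r1 r2 r3 idB lohi hI.
have n0 := @node_mem id 0 isT; have n1 := @node_mem id 1 isT.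
have n2 := @node_mem id 2 isT.
have okid t A h' : (t < K)%N -> @ok R M inp D r h' A (adE K t (Reg 1)).
  by move=> tK; apply: (ok_cellB (x := id)) => //=; rewrite r1; bounds.
have evid t h' : @eval R inp r h' (adE K t (Reg 1)) = cell t id.
  by rewrite -r1; apply: eval_cell G.
have B0 : (0 < 2 ^ B)%N by rewrite expn_gt0.
apply: hoare_cost.
- apply: hoare_seq; apply: hoare_sto; [exact: okid (ltnW (ltnW (ltnW K3)))|by rewrite /=; lia|..].
  + by rewrite evid; left.
  + by rewrite evid.
  rewrite evid.
  apply: hoare_seq; apply: hoare_sto; [by apply: okid; lia|by rewrite /= r2 r3; bounds|..].
  + by rewrite evid; left.
  + by rewrite evid.
  rewrite evid.
  apply: hoare_sto; [by apply: okid; lia|by rewrite /= r2; bounds|..].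
  + by rewrite evid; left.
  + by rewrite evid.
  rewrite evid /= r2 r3.
  have d01 : (cell 0 id == cell 1 id) = false by rewrite /ad; lia.
  have d02 : (cell 0 id == cell 2 id) = false by rewrite /ad; lia.
  have d12 : (cell 1 id == cell 2 id) = false by rewrite /ad; lia.
  rewrite d01 d02 d12 !eqxx size_seg; split=> //.
  exists lo; split=> //; first by lia.
  rewrite /seg -map_comp -[X in _ = [seq _ | _ <- iota X _]]addn0 iotaDl -map_comp.
  apply/eq_in_map => j; rewrite mem_iota => jl /=.
  have ne t : (lo + j == cell t id)%N = false by rewrite /ad; lia.
  by rewrite !ne; apply: hI; lia.
- by rewrite /=; lia.
- by rewrite /=; lia.
Qed.

Lemma build_stopP m id lo hi r (h : nat -> nat) : globals n L w r ->
    r 1 = id -> r 2 = lo -> r 3 = hi -> r 4 = m -> (id < 2 ^ B)%N ->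
    (lo <= hi <= n)%N -> (m < B)%N ->
    (forall p, (p < n)%N -> h p = pos p :> nat) -> m = 0 \/ (hi - lo < cutoff)%N ->
    hoare (Call pb) r h 60 60 (Acc id) (nodes id)
      (fun _ h' => stored h' id (Leaf (seg lo hi))).
Proof.
move=> G r1 r2 r3 r4 idB lohi mB hI cond.
  have B0 : (0 < 2 ^ B)%N by rewrite expn_gt0.
  apply: hoare_cost.
  + apply: hoare_call; rewrite prp.
    apply: (hoare_if (w1 := 40) (s1 := 40) (w2 := 0) (s2 := 0)).
    * by rewrite /= r2 r3 r4; bounds.
    * by move=> _; apply: build_leafP.
    * by rewrite /= r2 r3 r4 => H; case: cond; lia.
  + by rewrite /=; lia.
  + by rewrite /=; lia.
Qed.

(** A call writes only the cells numbered by its own subtree and reads in addition the sorted array,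
    which nobody writes; hence the two children cannot race. *)
Lemma buildP m id lo hi r (h : nat -> nat) : globals n L w r ->
  r 1 = id -> r 2 = lo -> r 3 = hi -> r 4 = m ->
  (0 < id)%N -> (id.+1 * 2 ^ m <= 2 ^ B)%N -> (lo <= hi <= n)%N -> (m < B)%N ->
  (forall p p', (lo <= p < hi)%N -> (lo <= p' < hi)%N ->
     code (pos p) %/ 2 ^ m = code (pos p') %/ 2 ^ m)%N ->
  (forall p, (p < n)%N -> h (cell tA p) = e p) ->
  (forall p, (p < n)%N -> h p = pos p :> nat) ->
  hoare (Call pb) r h (zd_cost node_cost code cutoff m (seg lo hi))
    (m.+1 * (node_cost n)) (Acc id) (nodes id)
    (fun _ h' => stored h' id (zd_build code cutoff m (seg lo hi))).
Proof.
elim: m id lo hi r h => [|m IH] id lo hi r h G r1 r2 r3 r4 id0 idB lohi mB share hA hI.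
  have idlt : (id < 2 ^ B)%N by apply: leq_trans idB; rewrite leq_pmulr ?expn_gt0.
  apply: hoare_cost; first by apply: (build_stopP (m := 0)) => //; left.
  + by rewrite /=; lia.
  + by rewrite /node_cost; lia.
have idlt : (id < 2 ^ B)%N by apply: leq_trans idB; rewrite leq_pmulr ?expn_gt0.
rewrite /= size_seg; case: ifP => cut.
  apply: hoare_cost; first by apply: (build_stopP (m := m.+1)) => //; right.
  + by rewrite /=; lia.
  + by rewrite /node_cost mulSn; lia.
have [E0 E1 E2 [E3 E4 E5]] := G.
have B0 : (0 < 2 ^ B)%N by rewrite expn_gt0.
have cut2 : (trunc_log 2 (hi - lo) <= trunc_log 2 n)%N.
  by apply: leq_trunc_log; lia.
have id2B : (2 * id + 2 <= 2 ^ B)%N.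
  apply: leq_trans idB; rewrite expnS mulnA; apply: leq_trans (leq_pmulr _ (expn_gt0 2 m)).
  by lia.
(* In the segment all higher bits agree, so the order of the codes forces bit [m] to be
   nondecreasing. *)
have mono p p' : (lo <= p <= p')%N -> (p' < hi)%N ->
     bit m (code (pos p)) -> bit m (code (pos p')).
  move=> lp lp' bp.
  have := leq_div2r (2 ^ m) (code_mono (proj2 (andP lp)) (leq_trans lp' (proj2 (andP lohi)))).
  rewrite !(bit_decomp m) bp (share p p'); [|by lia|by lia].
  by case: bit => //; lia.
have n0 := @node_mem id 0 isT; have n1 := @node_mem id 1 isT.
have n2 := @node_mem id 2 isT.
apply: hoare_cost.
- apply: hoare_call; rewrite prp.
  apply: (hoare_if (w1 := 0) (s1 := 0)).
  + by rewrite /= r2 r3 r4; bounds.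
  + by rewrite /= r2 r3 r4; lia.
  move=> _; apply: hoare_seq; apply: hoare_asg => //=; [by rewrite r4; bounds|by lia|].
  apply: hoare_seq; apply: hoare_asg => //=; [by rewrite r2; bounds|by lia|].
  apply: hoare_seq; apply: hoare_asg => //=; [by rewrite r3; bounds|by lia|].
  set r' := upd _ 6 _.
  have G' : globals n L w r' by do 3 apply: globalsU => //.
  apply: hoare_seq; apply: hoare_weak.
    apply: (bisectP (m := m) (lo := lo) (hi := hi) _ G') => //.
    + by rewrite /r' /= r4; lia.
    + by lia.
    + by move=> p pn; right; exists p.
  move=> r6 _ /= [-> G6 s4 [s1 s2 s3] [lsp spN spP]].
  set sp := r6 5 in lsp spN spP *.
  have {}s1 : r6 1 = id by rewrite s1 -r1.
  have {}s2 : r6 2 = lo by rewrite s2 -r2.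
  have {}s3 : r6 3 = hi by rewrite s3 -r3.
  have [F0 F1 F2 [F3 F4 F5]] := G6.
  apply: hoare_seq; apply: hoare_asg => //=; [by rewrite s1; bounds|by lia|].
  apply: hoare_seq; apply: hoare_asg => //=; [by rewrite s1; bounds|by lia|].
  rewrite s1.
  set r5 := upd _ 9 _.
  have G5 : globals n L w r5 by do 2 apply: globalsU => //.
  have r58 : r5 8 = (2 * id)%N by [].
  have r59 : r5 9 = (2 * id + 1)%N by [].
  have r55 : r5 5 = sp by [].
  have r5_1 : r5 1 = id by rewrite /r5 /= s1.
  have okid t x y A h' : (t < K)%N -> (x < 10)%N -> r5 x = y -> (y < 2 ^ B)%N ->
      @ok R M inp D r5 h' A (adE K t (Reg x)).
    move=> tK x10 xy yB; apply: (ok_cellB (x := y)) => //=; split; last by lia.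
    by apply: leq_trans x10 _.
  have evid t x h' : @eval R inp r5 h' (adE K t (Reg x)) = cell t (r5 x).
    exact: eval_cell G5.
  have cM0 x : (x < 2 ^ B)%N -> (cell 0 x < M)%N by apply: cellM; lia.
  apply: hoare_seq; apply: hoare_sto; [by apply: (okid _ _ id) => //; lia|by rewrite /=; lia
     |by rewrite evid r5_1; left|by rewrite evid r5_1|].
  apply: hoare_seq; apply: hoare_sto; [by apply: (okid _ _ id) => //; lia
     |by apply: (okid _ _ (2 * id)%N) => //; lia|by rewrite evid r5_1; left|by rewrite evid r5_1|].
  apply: hoare_seq; apply: hoare_sto; [by apply: (okid _ _ id) => //; lia
     |by apply: (okid _ _ (2 * id + 1)%N) => //; lia|by rewrite evid r5_1; left|by rewrite evid r5_1|].
  rewrite !evid r5_1.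
  set h1 := upd _ _ _.
  have h1A p : (p < n)%N -> h1 (cell tA p) = e p.
    move=> pn; rewrite /h1 /= !ifN ?hA//; apply/eqP => /ad_inj H; have [] := H _ _; lia.
  have h1I p : (p < n)%N -> h1 p = pos p :> nat.
    by move=> pn; rewrite /h1 /= !ifN ?hI// /ad; apply/eqP; lia.
  have [fN fP] := @seg_filter (fun x => bit m (code x)) lo sp hi lsp spN spP.
  have fork_cost0 : (cost (Reg 8) + 1 + (cost (Reg 5) + 1 + zd_cost node_cost code cutoff m (seg lo sp))
      <= zd_cost node_cost code cutoff m [seq x <- seg lo hi | ~~ bit m (code x)] + 10)%N.
    by rewrite fN /=; lia.
  have fork_cost1 : (cost (Reg 9) + 1 + (cost (Reg 5) + 1 + zd_cost node_cost code cutoff m (seg sp hi))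
      <= zd_cost node_cost code cutoff m [seq x <- seg lo hi | bit m (code x)] + 10)%N.
    by rewrite fP /=; lia.
  have fork_span x y : (cost (Reg x) + 1 + (cost (Reg y) + 1 + m.+1 * node_cost n)
      <= m.+1 * node_cost n + 10)%N by rewrite /=; lia.
  have sharelo p p' : (lo <= p < sp)%N -> (lo <= p' < sp)%N ->
      (code (pos p) %/ 2 ^ m = code (pos p') %/ 2 ^ m)%N.
    move=> pl pl'; rewrite !(bit_decomp m) (share p p'); [|by lia|by lia].
    by rewrite (negbTE (spN _ pl)) (negbTE (spN _ pl')).
  have sharehi p p' : (sp <= p < hi)%N -> (sp <= p' < hi)%N ->
      (code (pos p) %/ 2 ^ m = code (pos p') %/ 2 ^ m)%N.
    move=> pl pl'; rewrite !(bit_decomp m) (share p p'); [|by lia|by lia].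
    by rewrite (spP _ pl) (spP _ pl').
  have nc0 : nodes (2 * id) `<=` nodes id.
    by move=> a na; apply: (@nodes_child id 0) => //; rewrite addn0.
  have nc1 : nodes (2 * id + 1) `<=` nodes id by apply: nodes_child.
  have ns0 t : (t < 3)%N -> ~ nodes (2 * id) (cell t id).
    by move=> t3 na; apply: (@nodes_self id 0 t) => //; rewrite addn0.
  have idm0 : ((2 * id).+1 * 2 ^ m <= 2 ^ B)%N.
    by apply: leq_trans idB; rewrite expnS mulnA leq_mul2r; lia.
  have idm1 : ((2 * id + 1).+1 * 2 ^ m <= 2 ^ B)%N.
    by apply: leq_trans idB; rewrite expnS mulnA leq_mul2r; lia.
  apply: (@hoare_fork _ _ _ _ _ _ _ _ _
     (zd_cost node_cost code cutoff m [seq x <- seg lo hi | ~~ bit m (code x)] + 10)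
     (m.+1 * node_cost n + 10)
     (zd_cost node_cost code cutoff m [seq x <- seg lo hi | bit m (code x)] + 10)
     (m.+1 * node_cost n + 10) (Acc (2 * id)) (nodes (2 * id))
     (Acc (2 * id + 1)) (nodes (2 * id + 1))).
  + apply: hoare_cost; last 2 first.
    * exact: fork_cost0.
    * exact: fork_span.
    apply: hoare_seq; apply: hoare_asg; [by []|by rewrite /= r58; bounds|by rewrite /= r58; lia|rewrite /= r58].
    apply: hoare_seq; apply: hoare_asg; [by []|by rewrite /= r55; bounds|by rewrite /= r55; lia|rewrite /= r55].
    apply: hoare_weak; first apply: (IH (2 * id)%N lo sp) => //.
    * by lia.
    * by lia.
    * by lia.
    move=> ? h2 /= S2 fr2.
    apply: hoare_cost; last 2 first.
    * exact: fork_cost1.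
    * exact: fork_span.
    apply: hoare_seq; apply: hoare_asg; [by []|by rewrite /= r59; bounds|by rewrite /= r59; lia|rewrite /= r59].
    apply: hoare_seq; apply: hoare_asg; [by []|by rewrite /= r55; bounds|by rewrite /= r55; lia|rewrite /= r55].
    apply: hoare_weak; first apply: (IH (2 * id + 1)%N sp hi) => //.
    * by lia.
    * by lia.
    * by lia.
    * by move=> p pn; rewrite fr2 ?h1A//; apply: nodes_arr.
    * by move=> p pn; rewrite fr2 ?h1I// => /nodes_ge; lia.
    move=> ? h3 /= S3 fr3.
    have hid t : (t < 3)%N -> h3 (cell t id) = h1 (cell t id).
      by move=> t3; rewrite fr3 ?fr2//; [apply: ns0|apply: nodes_self].
    have d01 : (cell 0 id == cell 1 id) = false by rewrite /ad; lia.
    have d02 : (cell 0 id == cell 2 id) = false by rewrite /ad; lia.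
    have d12 : (cell 1 id == cell 2 id) = false by rewrite /ad; lia.
    rewrite !hid// /h1 /= d01 d02 d12 !eqxx; split=> //.
    rewrite fN fP; split=> //; apply: stored_ext S2 => a Ha; apply: fr3.
      by move=> /nodes_ge; lia.
    exact: nodes_disj.
  + by move=> a [/nc0|]; [left|right].
  + by move=> a [/nc1|]; [left|right].
  + exact: nc0.
  + exact: nc1.
  + move=> a na [nb|[p pn E]]; first exact: nodes_disj na nb.
    by apply: (@nodes_arr (2 * id) p); rewrite -E.
  + move=> a na [nb|[p pn E]]; first exact: nodes_disj nb na.
    by apply: (@nodes_arr (2 * id + 1) p); rewrite -E.
- by rewrite /= /node_cost; lia.
- rewrite /= mulSn /node_cost; lia.
Qed.

End Build.

(** * Computing the Morton codes *)

Lemma spread_lt d b x : 0 < d -> spread d b x < 2 ^ (b * d).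
Proof.
move=> d0; elim: b x => [|b IH] x; first by rewrite /spread big_ord0 expn_gt0.
rewrite spreadS mulSn expnD.
have d2 : 2 ^ 1 <= 2 ^ d by rewrite leq_exp2l.
apply: (@leq_trans ((spread d b (x %/ 2)).+1 * 2 ^ d)).
  by rewrite mulSn ltn_add2r; case: odd; lia.
by rewrite mulnC leq_mul2l IH orbT.
Qed.

Section Encode.
Variables (K d Qc tA : nat).

(** A coordinate has a constant number [Qc] of digits of [w] bits, so its lookups are unrolled into
    a single expression of constant size. *)
Fixpoint spreadE q x :=
  if q is q'.+1 then
    Bin Add (Fetch (adE K 3 (Bin Mod x (Reg 13))))
      (Bin Shl (spreadE q' (Bin Shr x (Reg 12))) (Bin Mul (Reg 12) (Cst d)))
  else Cst 0.

(** Entry 0 reads itself, which is correct because memory is initially zero and [spread] vanishes at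
    0. *)
Definition table :=
  Scoped (Seq (Asg 2 (Cst 0)) (WhE (ltE (Reg 2) (Reg 13))
    (Seq (Sto (adE K 3 (Reg 2))
           (Bin Add (Bin Shl (Fetch (adE K 3 (Bin Div (Reg 2) (Cst 2)))) (Cst d))
                    (Bin Mod (Reg 2) (Cst 2))))
         (Asg 2 (Bin Add (Reg 2) (Cst 1)))))).

(* Register 16 holds the number of grid cells per unit of length, the unit being
   the difference of the real inputs designated by registers 17 and 18. *)
Definition coordE c :=
  Round (Reg 16) (Bin Add (Bin Mul (Reg 1) (Cst d)) (Cst c))
    (Bin Add (Bin Mul (Reg 10) (Cst d)) (Cst c)) (Reg 17) (Reg 18).

Fixpoint encode_from c k :=
  if k is k'.+1 then
    Seq (Asg 2 (coordE c))
    (Seq (Asg 3 (Bin Add (Reg 3)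
            (Bin Shl (spreadE Qc (Reg 2)) (Cst (d.-1 - c)))))
         (encode_from c.+1 k'))
  else Sto (adE K tA (Reg 1)) (Bin Add (Bin Mul (Reg 3) (Reg 15)) (Reg 1)).

Definition encode_body := Seq (Asg 3 (Cst 0)) (encode_from 0 d).

Fixpoint encode_cost c k :=
  if k is k'.+1 then
    cost (coordE c) + 1 + (cost (Bin Add (Reg 3)
            (Bin Shl (spreadE Qc (Reg 2)) (Cst (d.-1 - c)))) + 1 + encode_cost c.+1 k')
  else cost (adE K tA (Reg 1)) + (cost (Bin Add (Bin Mul (Reg 3) (Reg 15)) (Reg 1)) + 1).

Local Open Scope classical_set_scope.
Context {R : realType} {M : nat} {inp : nat -> R} {D : set nat} {pr : program}.
Notation hoare := (@hoare R M inp D pr).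
Notation eval := (@eval R inp).
Notation ok := (@ok R M inp D).

Variables (n L w B : nat).
Hypothesis d0 : (0 < d)%N.
Hypothesis K4 : (3 < K)%N.
Hypothesis tAK : (3 < tA < K)%N.
Hypothesis nL : (0 < n <= 2 ^ L)%N.
Hypothesis wL : (0 < w <= L)%N.
Hypothesis HM : (n + K * 2 ^ B <= M)%N.
Hypothesis BL : (Qc * w * d + L + w * d < B)%N.
Hypothesis nd : ((n + 1) * d + d < M)%N.
Notation cell t i := (ad n K t i).

Let K4B : (4 * 2 ^ B <= K * 2 ^ B)%N. Proof. by rewrite leq_mul2r K4 orbT. Qed.
Let B_ge x : (x <= B)%N -> (2 ^ x < M)%N.
Proof.
move=> xB; have : (2 ^ x <= 2 ^ B)%N by rewrite leq_exp2l.
have : (0 < 2 ^ B)%N by rewrite expn_gt0.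
by move: HM K4B; lia.
Qed.
Let BltM : (B < M)%N.
Proof. by apply: ltn_trans (ltn_expl B (isT : (1 < 2)%N)) (B_ge (leqnn _)). Qed.
Let LB : (2 ^ L <= 2 ^ B)%N. Proof. by rewrite leq_exp2l//; lia. Qed.
Let wB : (2 ^ w <= 2 ^ L)%N. Proof. by rewrite leq_exp2l//; lia. Qed.
Let cellM t i : (t < K)%N -> (i < 2 ^ B)%N -> (cell t i < M)%N.
Proof. by move=> tK iB; apply: leq_trans (ad_lt n tK iB) HM. Qed.
Let okc t x r h A xe : globals n L w r -> (t < K)%N -> ok r h A xe ->
  eval r h xe = x -> (x < 2 ^ L)%N -> ok r h A (adE K t xe).
Proof.
move=> [E0 _ _ _] tK oe ex xL /=; rewrite E0 ex.
have xB : (x < 2 ^ B)%N by lia.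
have := cellM tK xB; rewrite /ad => H.
have H1 : (0 < 2 ^ B)%N by rewrite expn_gt0.
have H2 : (K <= K * 2 ^ B)%N by rewrite leq_pmulr.
have H4 : (2 * K <= K * 2 ^ B)%N.
  rewrite mulnC leq_mul2l; have : (2 ^ 1 <= 2 ^ B)%N by rewrite leq_exp2l//; lia.
  by rewrite expn1 => ->; rewrite orbT.
by splits => //; lia.
Qed.

Lemma tableP r h Q : globals n L w r -> h (cell 3 0) = 0 ->
  (forall h', (forall x, (x < 2 ^ w)%N -> h' (cell 3 x) = spread d w x) ->
    (forall a, (forall x, a <> cell 3 x) -> h' a = h a) -> Q r h') ->
  hoare table r h (2 ^ w * 100 + 40) (2 ^ w * 100 + 40) setT setT Q.
Proof.
move=> G h0 HQ.
have dM : (w * d < M)%N by lia.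
apply: hoare_cost.
- apply: hoare_scoped; apply: hoare_seq; apply: hoare_asg => //=; try lia.
  apply: (hoare_while (w := 80) (s := 80) (k := 2 ^ w) (Inv := fun k r h' =>
    exists t, [/\ k + t = 2 ^ w, r 2 = t, globals n L w r, h' (cell 3 0) = 0 &
     (forall x, (x < t)%N -> h' (cell 3 x) = spread d w x) /\
     forall a, (forall i, a <> cell 3 i) -> h' a = h a]%N)); last first.
    by exists 0; rewrite addn0; split.
  move=> k r1 h1 [t [kt r2 {}G {}h0 [hS fr]]].
  have [E0 E1 E2 [E3 E4 E5]] := G.
  split.
  + by rewrite /= r2 E3; bounds.
  + rewrite /= r2 E3 => H; have tE : t = 2 ^ w by lia.
    by apply: HQ => // v vV; apply: hS; rewrite tE.
  rewrite /= r2 E3 => H; have tV : (t < 2 ^ w)%N by lia.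
  case: k kt => [|k] kt; first lia.
  exists k => //; apply: hoare_cost.
  + have t2 : (t %/ 2 < 2 ^ w)%N by apply: leq_ltn_trans tV; apply: leq_div.
    have ev2 : h1 (cell 3 (t %/ 2)) = spread d w (t %/ 2).
      case: t {kt tV H r2} hS t2 => [|t] hS t2; first by rewrite div0n h0 spread0.
      by apply: hS; lia.
    have sb := spread_lt w t d0; have wM := @B_ge (w * d) ltac:(lia).
    have sr := spread_rec d (proj1 (andP wL)) tV.
    apply: hoare_seq; apply: hoare_sto => //.
    * by apply: (okc (x := t)) => //=; [bounds|lia].
    * split.
      - split.
        + split=> //; apply: (okc (x := (t %/ 2)%N)) => //=; rewrite ?r2; bounds.
        + by rewrite /=; lia.
        + by rewrite /= E0 r2 -/(cell 3 (t %/ 2)) ev2; lia.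
      - by rewrite /= r2; bounds.
      - rewrite [X in (X < M)%N]/= E0 r2 -/(cell 3 (t %/ 2)) ev2 -sr; lia.
    rewrite (eval_cell K 3 (Reg 2) _ G) /= r2 E0 -/(cell 3 (t %/ 2)) ev2 -sr.
    apply: hoare_asg => //=.
    * by rewrite r2; bounds.
    * by rewrite r2; lia.
    exists t.+1; rewrite r2; split=> //.
    * by rewrite -addSnnS.
    * by rewrite addn1.
    * case: eqP => [/ad_inj [] //|_]; last by [].
      by move=> _ <-; rewrite spread0.
    split.
    * move=> v vt; case: eqP => [/ad_inj [] // _ -> //|NE].
      apply: hS; have : v <> t by move=> E; apply: NE; rewrite E.
      by lia.
    * by move=> x Hx /=; rewrite ifN ?fr//; apply/eqP.
  + by rewrite /=; lia.
  + by rewrite /=; lia.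
- by rewrite /=; lia.
- by rewrite /=; lia.
Qed.

Lemma spreadEP q x r h A v : globals n L w r -> (q <= Qc)%N ->
  (forall y, (y < 2 ^ w)%N -> h (cell 3 y) = spread d w y) ->
  (forall y, (y < 2 ^ w)%N -> A (cell 3 y)) ->
  ok r h A x -> eval r h x = v -> (v < M)%N ->
  ok r h A (spreadE q x) /\ eval r h (spreadE q x) = spread d (q * w) v.
Proof.
move=> G qQ hT AT; have [E0 E1 E2 [E3 E4 E5]] := G.
elim: q qQ x v => [|q IH] qQ x v okx ex vM.
  by rewrite mul0n /spread big_ord0 /=; split=> //; lia.
have wdM : (w * d < M)%N by lia.
have dM : (d < M)%N by have : (d <= w * d)%N by [rewrite leq_pmull//; lia]; lia.
have wM : (2 ^ w < M)%N by apply: B_ge; have : (w <= w * d)%N by [rewrite leq_pmulr]; lia.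
have w2 : (w < M)%N by apply: ltn_trans (ltn_expl _ (isT : (1 < 2)%N)) wM.
have ok2 : ok r h A (Bin Shr x (Reg 12)).
  split=> //=; first by rewrite E2.
  by rewrite ex; apply: leq_ltn_trans vM; apply: leq_div.
have ev2 : eval r h (Bin Shr x (Reg 12)) = (v %/ 2 ^ w)%N by rewrite /= ex E2.
have v2M : (v %/ 2 ^ w < M)%N by apply: leq_ltn_trans vM; apply: leq_div.
have [ok3 ev3] := IH (ltnW qQ) _ _ ok2 ev2 v2M.
have w0 : (0 < 2 ^ w)%N by rewrite expn_gt0.
have okm : ok r h A (Bin Mod x (Reg 13)).
  split=> //=; rewrite E3 //.
  by rewrite ex; apply: leq_ltn_trans vM; apply: leq_mod.
have evm : eval r h (Bin Mod x (Reg 13)) = (v %% 2 ^ w)%N by rewrite /= ex E3.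
have vm : (v %% 2 ^ w < 2 ^ w)%N by rewrite ltn_mod.
have evT : eval r h (Fetch (adE K 3 (Bin Mod x (Reg 13)))) = spread d w (v %% 2 ^ w).
  by rewrite -hT// -evm -(eval_cell K 3 _ h G).
have okT : ok r h A (Fetch (adE K 3 (Bin Mod x (Reg 13)))).
  split; first by apply: (okc (x := (v %% 2 ^ w)%N)) => //; apply: leq_trans vm _.
  by rewrite (eval_cell K 3 _ h G) evm; apply: AT.
have sD := spreadD d w (q * w) v.
have sb : (spread d (w + q * w) v < 2 ^ (Qc * w * d))%N.
  apply: leq_trans (spread_lt _ _ d0) _; rewrite leq_exp2l// leq_mul2r -mulSn.
  by rewrite leq_mul2r qQ !orbT.
have BM := @B_ge (Qc * w * d) ltac:(lia).
have ev : eval r h (spreadE q.+1 x) = spread d (q.+1 * w) v.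
  have -> : eval r h (spreadE q.+1 x) = (eval r h (Fetch (adE K 3 (Bin Mod x (Reg 13))))
      + eval r h (spreadE q (Bin Shr x (Reg 12))) * 2 ^ (r 12 * d))%N by [].
  by rewrite mulSn sD evT ev3 E2.
split=> //.
have evS : weval Shl (eval r h (spreadE q (Bin Shr x (Reg 12))))
    (eval r h (Bin Mul (Reg 12) (Cst d))) = (spread d (q * w) (v %/ 2 ^ w) * 2 ^ (w * d))%N.
  by rewrite ev3 /= E2.
split; [exact: okT| |].
- split; [exact: ok3|by rewrite /= E2; splits|].
  by rewrite evS; lia.
- rewrite -[weval _ _ _]/(eval r h (spreadE q.+1 x)) ev mulSn; lia.
Qed.

Variables (z : nat -> nat -> nat) (scale u1 u2 : nat) (r0 h0 : nat -> nat).
Hypothesis G0 : globals n L w r0.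
Hypothesis R16 : r0 16 = scale.
Hypothesis R17 : r0 17 = u1.
Hypothesis R18 : r0 18 = u2.
Hypothesis Dc : forall i c, (i <= n)%N -> (c < d)%N -> D (i * d + c)%N.
Hypothesis Du1 : D u1.
Hypothesis Du2 : D u2.
Hypothesis uM : [/\ (scale < M), (u1 < M) & (u2 < M)]%N.
Hypothesis zE : forall i c, (i < n)%N -> (c < d)%N ->
  Num.truncn (scale%:R * (inp (i * d + c)%N - inp (n * d + c)%N)
    / (inp u1 - inp u2))%R = z i c.
Hypothesis zM : forall i c, (i < n)%N -> (c < d)%N -> (z i c < M)%N.

(** Code and index share one word, so that the sort moves single words and the index is recovered by
    a remainder. *)
Definition encoded i := (interleave d (Qc * w) (z i) * 2 ^ L + i)%N.

Let Acc i : set nat := [set a | (exists2 x, (x < 2 ^ w)%N & a = cell 3 x) \/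
  a = cell tA i].
Let partial i c := (\sum_(0 <= c' < c) spread d (Qc * w) (z i c') * 2 ^ (d.-1 - c'))%N.

Let partial_lt i c : (c <= d)%N -> (partial i c < 2 ^ (Qc * w * d))%N.
Proof.
move=> cd; apply: leq_ltn_trans (interleave_lt d (Qc * w) (z i)).
rewrite /interleave -(big_mkord xpredT (fun c' => spread d (Qc * w) (z i c') * 2 ^ (d.-1 - c')))%N.
by rewrite (big_cat_nat _ cd)//= leq_addr.
Qed.

Lemma encode_fromP i c k r h : (c + k = d)%N -> (i < n)%N -> same_glob r r0 ->
  r 1 = i -> r 3 = partial i c ->
  (forall y, (y < 2 ^ w)%N -> h (cell 3 y) = spread d w y) ->
  hoare (encode_from c k) r h (encode_cost c k) (encode_cost c k)
    (Acc i) [set cell tA i] (fun _ h' => h' (cell tA i) = encoded i).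
Proof.
move=> + lin; elim: k c r => [|k IH] c r cd rr r1 r3 hT.
all: have G := globals_same rr G0; have [E0 E1 E2 [E3 E4 E5]] := G.
all: have BM := @B_ge (Qc * w * d) ltac:(lia).
all: have BM' := @B_ge (Qc * w * d + L) ltac:(lia).
  have Ec : partial i c = interleave d (Qc * w) (z i).
    by rewrite /partial -cd addn0 big_mkord.
  have el : (interleave d (Qc * w) (z i) * 2 ^ L + i < 2 ^ (Qc * w * d + L))%N.
    rewrite expnD; apply: row_lt; first exact: interleave_lt.
    by case/andP: nL => _; apply: leq_trans.
  have pl := @interleave_lt d (Qc * w) (z i).
  have LM := @B_ge L ltac:(lia).
  apply: hoare_sto.
  - by apply: (okc (x := i)) => //=; [lia|rewrite r1; bounds|lia].
  - by rewrite /= r1 r3 Ec E5; bounds.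
  - by rewrite (eval_cell K tA _ h G) /= r1; right.
  - by rewrite (eval_cell K tA _ h G) /= r1.
  by rewrite (eval_cell K tA _ h G) /= r1 r3 Ec E5 eqxx.
have cd' : (c < d)%N by lia.
have evz : eval r h (coordE c) = z i c.
  by rewrite -zE// /= r1 E0 !rr// R16 R17 R18.
have nd1 : (i * d + c < M)%N.
  apply: leq_trans nd; have : (i * d <= n * d)%N by rewrite leq_mul2r ltnW ?orbT.
  by rewrite mulnDl; lia.
have [sM u1M u2M] := uM.
have zb := zM lin cd'.
apply: hoare_seq; apply: hoare_asg => //.
- have n1 : (n <= (n + 1) * d)%N by rewrite (@leq_trans (n * d))// ?leq_pmulr// leq_mul2r leq_addr orbT.
  move: nd n1; rewrite mulnDl => nd' n1.
  split; last split.
  + by rewrite /= r1 E0 !rr// R16 R17 R18; splits => //; lia.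
  + by rewrite /= r1; apply: Dc => //; apply: ltnW.
  + by rewrite /= E0; apply: Dc.
  + by rewrite /= rr// R17.
  + by rewrite /= rr// R18.
  + by rewrite evz.
- by rewrite evz.
rewrite evz.
have G2 : globals n L w (upd r 2 (z i c)) by apply: globalsU.
have okz : ok (upd r 2 (z i c)) h (Acc i) (Reg 2) by [].
have [oks evs] := @spreadEP Qc (Reg 2) _ h (Acc i) (z i c) G2 (leqnn _) hT
  (fun y yw => or_introl (ex_intro2 _ _ y yw erefl)) okz erefl zb.
have pS : partial i c.+1 = (partial i c + spread d (Qc * w) (z i c) * 2 ^ (d.-1 - c))%N.
  by rewrite /partial big_nat_recr.
have pl := partial_lt i cd'.
apply: hoare_seq; apply: hoare_asg => //.
- have dM : (d < M)%N by have : (d <= w * d)%N by [rewrite leq_pmull//; lia]; lia.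
  have pM : (partial i c < M)%N by lia.
  split; [by rewrite /= r3| split=> //|].
  + by rewrite /=; lia.
  + by rewrite [weval _ _ _]/= evs; lia.
  + by rewrite [weval _ _ _]/= evs r3; lia.
- by rewrite /= evs r3; lia.
rewrite [eval _ _ _]/= evs r3 -pS.
apply: IH => //.
- by rewrite addSnnS.
- by do 2 apply: same_globU => //.
Qed.

Variable p : nat.
Hypothesis prp : nth Skip pr p = pfor_proc p encode_body.

Lemma encodeP h Q :
  (forall y, (y < 2 ^ w)%N -> h (cell 3 y) = spread d w y) ->
  (forall h', (forall i, (i < n)%N -> h' (cell tA i) = encoded i) ->
    (forall a, (forall i, a <> cell tA i) -> h' a = h a) -> Q r0 h') ->
  hoare (PFor p 10) r0 h (n * (encode_cost 0 d + 70))
     (encode_cost 0 d + 30 * L + 70) setT setT Q.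
Proof.
move=> hT HQ; have [E0 _ _ _] := G0.
have d3A : 3 <> tA by lia.
have nM : (n + 2 < M)%N by have := @B_ge 0 isT; lia.
apply: hoare_cost.
- apply: hoare_le; first apply: (@hoare_pfor R M inp D pr p encode_body n r0 h _ _
    Acc (fun i => [set cell tA i]) (fun i h' => h' (cell tA i) = encoded i)
    prp nM _ _ _ _ 10 L r0 h Q) => //.
  + by move=> i h1 h2 E; rewrite E.
  + by move=> i a ->; right.
  + move=> i j a lin jn ij -> [[x _ /ad_inj H]|/ad_inj H].
      by have [] := H _ _; lia.
    by have [] := H _ _; lia.
  + move=> i r h1 lin rr r1 HA.
    apply: hoare_seq; apply: hoare_asg => //=; try lia.
    apply: (encode_fromP (c := 0)) => //.
    * exact: same_globU.
    * by rewrite /partial big_geq.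
    * by move=> y yw; rewrite HA ?hT//; left; exists y.
  + move=> h1 P1 fr; apply: HQ => // a Ha; apply: fr => -[i _ /= E].
    exact: (Ha i).
  + exact: leqnn.
  + exact: leqnn.
  + by move=> ? _.
  + by move=> ? _.
  + by [].
- by rewrite /= leq_mul2l; lia.
- by rewrite /=; lia.
Qed.

End Encode.

(** * The program *)

(** Repeated doubling finds L = up_log 2 n. The digit length [w] is half of it, rounded up, so that
    both the blocks and their number are O(sqrt n). Register 16 receives the resolution 2 ^ (a * L),
    which is at least n ^ a. *)
Definition preamble a :=
  Seq (Asg 10 (Reg 0)) (Seq (Asg 11 (Cst 0)) (Seq (Asg 15 (Cst 1))
  (Seq (WhE (ltE (Reg 15) (Reg 10))
         (Seq (Asg 15 (Bin Add (Reg 15) (Reg 15))) (Asg 11 (Bin Add (Reg 11) (Cst 1)))))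
  (Seq (Asg 12 (Bin Div (Bin Add (Reg 11) (Cst 1)) (Cst 2)))
  (Seq (Asg 13 (Bin Shl (Cst 1) (Reg 12)))
  (Seq (Asg 14 (Bin Shl (Cst 1) (Bin Defs.Sub (Reg 11) (Reg 12))))
       (Asg 16 (Bin Shl (Cst 1) (Bin Mul (Cst a) (Reg 11)))))))))).

Fixpoint pick_cmd (l : seq (nat * nat)) :=
  if l is p :: l' then
    Seq (IfE (DistLe (Reg 17) (Reg 18) (Cst p.1) (Cst p.2))
           (Seq (Asg 17 (Cst p.1)) (Asg 18 (Cst p.2))) Skip)
        (pick_cmd l')
  else Skip.

(** The machine has no absolute value on reals. Maximizing over differences taken in both orders
    yields the largest absolute difference. *)
Definition pick_pair (R : realType) (inp : nat -> R) :=
  foldl (fun p q : nat * nat =>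
    if (inp p.1 - inp p.2 <= inp q.1 - inp q.2)%R then q else p).

Lemma pick_pair_mem (R : realType) (inp : nat -> R) p l :
  pick_pair inp p l \in p :: l.
Proof.
elim: l p => [|q l IH] p /=; first by rewrite inE.
have := IH (if (inp p.1 - inp p.2 <= inp q.1 - inp q.2)%R then q else p).
by case: ifP => _; rewrite !inE => /orP[->|->]; rewrite ?orbT.
Qed.

Lemma pick_pair_max (R : realType) (inp : nat -> R) p l q : q \in p :: l ->
  (inp q.1 - inp q.2 <= inp (pick_pair inp p l).1 - inp (pick_pair inp p l).2)%R.
Proof.
elim: l p q => [|p' l IH] p q /=; first by rewrite inE => /eqP ->.
rewrite !inE orbA => /orP[/orP[/eqP ->|/eqP ->]|ql].
- case: ifPn => [le|_]; last by apply: IH; rewrite inE eqxx.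
  by apply: le_trans le _; apply: IH; rewrite inE eqxx.
- case: ifPn => [_|]; first by apply: IH; rewrite inE eqxx.
  rewrite -ltNge => /ltW le; apply: le_trans le _.
  by apply: IH; rewrite inE eqxx.
- by apply: IH; rewrite inE ql orbT.
Qed.

Section Main.
Variables (a d Qc cutoff : nat).

(** A code has [Qc * w * d] bits, that is [Qc * d] digits of [w] bits. *)
Definition npass := Qc * d.
Definition K := stride npass.

(* Differences of coordinates of the first two points, in both orders. *)
Definition pairs :=
  [seq (c, d + c) | c <- iota 0 d] ++ [seq (d + c, c) | c <- iota 0 d].

Definition final_body :=
  Sto (Reg 1) (Bin Mod (Fetch (adE K (tag_arr npass) (Reg 1))) (Reg 15)).

(** The root box of the tree is the smallest dyadic cube, so the exact number of digits is needed
    rather than the a priori bound [Qc * w]. It is the least l for which the largest code is below 2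
    ^ (l * d). *)
Definition count_bits :=
  Seq (Asg 19 (Cst 0))
  (WhE (Bin Le (Bin Shl (Cst 1) (Bin Mul (Reg 19) (Cst d)))
     (Bin Div (Fetch (adE K (tag_arr npass) (Bin Defs.Sub (Reg 10) (Cst 1)))) (Reg 15)))
     (Asg 19 (Bin Add (Reg 19) (Cst 1)))).

Definition main :=
  Seq (preamble a) (Seq (Asg 17 (Cst 0)) (Seq (Asg 18 (Cst d))
  (Seq (pick_cmd pairs) (Seq (table K d) (Seq (PFor 1 10) (Seq (passes npass 4 0 npass)
  (Seq (PFor 2 10) (Seq count_bits
  (Seq (Asg 1 (Cst 1)) (Seq (Asg 2 (Cst 0)) (Seq (Asg 3 (Reg 10))
  (Seq (Asg 4 (Bin Mul (Reg 19) (Cst d)))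
  (Seq (Scoped (Call 3)) (Asg 0 (adE K 0 (Cst 1)))))))))))))))).

Definition zd_program : program :=
  [:: main; pfor_proc 1 (encode_body K d Qc (tag_arr 0)); pfor_proc 2 final_body;
      build_proc K (tag_arr npass) cutoff 3]
  ++ flatten [seq pass_procs npass 4 q | q <- iota 0 npass].

Lemma zd_program_pass q i : (q < npass)%N -> (i < 3)%N ->
  nth Skip zd_program (4 + 3 * q + i) = nth Skip (pass_procs npass 4 q) i.
Proof.
move=> qn i3; rewrite /zd_program -addnA /=.
suff H k0 k : (q < k)%N -> nth Skip (flatten [seq pass_procs npass 4 q' | q' <- iota k0 k])
    (3 * q + i) = nth Skip (pass_procs npass 4 (k0 + q)) i by rewrite H.
have step k1 k2 : flatten [seq pass_procs npass 4 q' | q' <- iota k1 k2.+1] =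
    pass_procs npass 4 k1 ++ flatten [seq pass_procs npass 4 q' | q' <- iota k1.+1 k2].
  by [].
elim: q k0 k {qn} => [|q IH] k0 [|k] // qk; rewrite step// nth_cat.
  by rewrite muln0 add0n addn0 i3.
have -> : (3 * q.+1 + i = 3 + (3 * q + i))%N by lia.
by rewrite ltnNge leq_addr /= addKn IH// addSnnS.
Qed.

Local Open Scope classical_set_scope.
Context {R : realType} {M : nat} {inp : nat -> R} {D : set nat}.
Let pr := zd_program.
Notation hoare := (@hoare R M inp D pr).
Notation eval := (@eval R inp).
Notation ok := (@ok R M inp D).

Variables (n B : nat).
Hypothesis d0 : (0 < d)%N.
Hypothesis n1 : (1 < n)%N.
Let L := up_log 2 n.
Let w := ((L + 1) %/ 2)%N.
Hypothesis HM : (n + K * 2 ^ B <= M)%N.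
Hypothesis BL : ((a + 2) * L + npass * L + L + L * d + d + 2 < B)%N.
Hypothesis nd : ((n + 1) * d + d < M)%N.
Hypothesis cutM : (cutoff < M)%N.

Let L0 : (0 < L)%N. Proof. by rewrite up_log_gt0. Qed.
Let nL : (n <= 2 ^ L)%N. Proof. exact: up_logP. Qed.
Let Ln : (2 ^ L.-1 < n)%N. Proof. exact: up_log_gtn. Qed.
Let K10 : (10 <= K)%N. Proof. by rewrite /K /stride; lia. Qed.
Let B_ge x : (x <= B)%N -> (2 ^ x + n < M)%N.
Proof.
move=> xB; have : (2 ^ x <= 2 ^ B)%N by rewrite leq_exp2l.
have : (0 < 2 ^ B)%N by rewrite expn_gt0.
have : (10 * 2 ^ B <= K * 2 ^ B)%N by rewrite leq_mul2r K10 orbT.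
by move: HM; lia.
Qed.
Let BltM : (B + n < M)%N.
Proof.
by apply: leq_ltn_trans (B_ge (leqnn _)); rewrite leq_add2r ltnW// ltn_expl.
Qed.

Lemma preambleP r h : r 0 = n ->
  hoare (preamble a) r h (50 * L + 100) (50 * L + 100) setT setT
    (fun r' h' => [/\ h' = h, globals n L w r' & r' 16 = 2 ^ (a * L)]).
Proof.
move=> r_0; have LM := @B_ge L ltac:(lia).
have LltM : (L < 2 ^ L)%N by apply: ltn_expl.
apply: hoare_cost.
- apply: hoare_seq; apply: hoare_asg => //=; [by rewrite r_0; bounds|by rewrite r_0; lia|rewrite r_0].
  apply: hoare_seq; apply: hoare_asg => //=; [by lia|by lia|].
  apply: hoare_seq; apply: hoare_asg => //=; [by lia|by lia|].
  apply: hoare_seq.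
  apply: (hoare_while (w := 30) (s := 30) (k := L) (Inv := fun k r h' => exists l,
    [/\ (k + l = L)%N, h' = h, r 10 = n, r 11 = l & r 15 = 2 ^ l])); last first.
    by exists 0; rewrite addn0.
  move=> k r1 _ [l [kl -> E0 E1 E5]].
  have lL : (2 ^ l <= 2 ^ L)%N by rewrite leq_exp2l//; lia.
  split.
  + by rewrite /= E0 E5; bounds.
  + rewrite /= E0 E5 => H.
    have lL' : l = L.
      apply/eqP; apply: contraT => NE.
      have : (2 ^ l <= 2 ^ L.-1)%N by rewrite leq_exp2l//; lia.
      by lia.
    have wL : (w <= L)%N by rewrite /w; lia.
    have wB : (2 ^ w <= 2 ^ L)%N by rewrite leq_exp2l.
    have wB' : (2 ^ (L - w) <= 2 ^ L)%N by rewrite leq_exp2l// leq_subr.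
    have aB := @B_ge (a * L) ltac:(lia).
    have aM : (a < M)%N by have : (a <= a * L)%N by [rewrite leq_pmulr]; lia.
    have aLM : (a * L < M)%N by lia.
    have w2 : (L - w < M)%N by lia.
    apply: hoare_seq; apply: hoare_asg => //=; rewrite E1 lL'; [by bounds|by lia|].
    rewrite -/w; apply: hoare_seq; apply: hoare_asg => //=; rewrite mul1n; [by bounds|by lia|].
    apply: hoare_seq; apply: hoare_asg => //=; rewrite E1 lL' mul1n; [by bounds|by lia|].
    apply: hoare_asg => //=; rewrite E1 lL' mul1n; [by bounds|by lia|].
    by split=> //; split=> //=; rewrite ?E0 ?E5 ?E1 lL'.
  + rewrite /= E0 E5 => H.
    case: k kl => [|k] kl.
      have : l = L by lia.
      by move=> E; move: H; rewrite E; lia.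
    exists k => //; apply: hoare_cost.
    * apply: hoare_seq; apply: hoare_asg => //=; [by rewrite E5; bounds|by rewrite E5; lia|].
      rewrite E5; apply: hoare_asg => //=; [by rewrite E1; bounds|by rewrite E1; lia|].
      exists l.+1; rewrite E1; split=> //; first by lia.
      * by rewrite addn1.
      * by rewrite expnS mul2n addnn.
    * by rewrite /=; lia.
    * by rewrite /=; lia.
- by rewrite /=; lia.
- by rewrite /=; lia.
Qed.

Lemma pick_hoare l p r h : r 17 = p.1 -> r 18 = p.2 ->
  (forall q, q \in p :: l -> [/\ (q.1 < M)%N, (q.2 < M)%N, D q.1 & D q.2]) ->
  hoare (pick_cmd l) r h (30 * size l + 1) (30 * size l + 1) setT setT
    (fun r' h' => [/\ h' = h, r' 17 = (pick_pair inp p l).1,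
       r' 18 = (pick_pair inp p l).2 &
       forall x, x <> 17 -> x <> 18 -> r' x = r x]).
Proof.
elim: l p r => [|q l IH] p r r17 r18 Hl; first exact: hoare_skip.
have [p1 p2 dp1 dp2] := Hl p (mem_head _ _).
have [q1 q2 dq1 dq2] : [/\ (q.1 < M)%N, (q.2 < M)%N, D q.1 & D q.2].
  by apply: Hl; rewrite !inE eqxx orbT.
apply: hoare_cost.
- apply: hoare_seq; apply: (hoare_weak (Q := fun r' h' => [/\ h' = h,
     r' 17 = (if (inp p.1 - inp p.2 <= inp q.1 - inp q.2)%R then q else p).1,
     r' 18 = (if (inp p.1 - inp p.2 <= inp q.1 - inp q.2)%R then q else p).2 &
     forall x, x <> 17 -> x <> 18 -> r' x = r x])).
    apply: (hoare_if (w1 := 4) (s1 := 4) (w2 := 4) (s2 := 4)).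
    + by rewrite /= r17 r18; split; splits.
    + rewrite /= r17 r18; case: ifP => // _ _.
      apply: hoare_cost; first (apply: hoare_seq; apply: hoare_asg => //=;
        apply: hoare_asg => //=).
      * split=> // x /eqP/negPf n17 /eqP/negPf n18.
        by rewrite n17 n18.
      * by [].
      * by [].
    + rewrite /= r17 r18; case: ifP => // _ _.
      by apply: hoare_cost; first exact: hoare_skip.
  move=> r1 _ [-> s17 s18 sx].
  apply: hoare_weak; first apply: (IH _ _ s17 s18).
    by move=> q' q'l; apply: Hl; move: q'l; case: ifP => _; rewrite !inE => /orP[->|->]; rewrite ?orbT.
  move=> r2 h2 [-> t17 t18 tx]; split=> // x n17 n18.
  by rewrite tx// sx.
- by rewrite /=; lia.
- by rewrite /=; lia.
Qed.

Section Run.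
Variables (z : nat -> nat -> nat) (nb : nat) (pos : nat -> 'I_n).
Variables (sl : seq 'I_n) (code : 'I_n -> nat).
Let u := pick_pair inp (0, d) pairs.
Hypothesis Dc : forall i c, (i <= n)%N -> (c < d)%N -> D (i * d + c)%N.
Hypothesis zE : forall i c, (i < n)%N -> (c < d)%N ->
  Num.truncn ((2 ^ (a * L))%:R * (inp (i * d + c)%N - inp (n * d + c)%N)
    / (inp u.1 - inp u.2))%R = z i c.
Hypothesis zlt : forall i c, (i < n)%N -> (c < d)%N -> (z i c < 2 ^ (Qc * w))%N.
Hypothesis codeE : forall i : 'I_n, code i = interleave d (Qc * w) (z i).
Hypothesis code_inj : injective code.
Hypothesis slE : sl = sort (relpre code leq) (enum 'I_n).
Hypothesis posE : forall p, (p < n)%N -> pos p = nth (pos p) sl p.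
Hypothesis nbP : forall l, (nb <= l)%N <->
  forall i c, (i < n)%N -> (c < d)%N -> (z i c < 2 ^ l)%N.

Let wL : (w <= L)%N. Proof. by rewrite /w; lia. Qed.
Let w0 : (0 < w)%N. Proof. by rewrite /w; lia. Qed.
Let wB : (2 ^ w <= 2 ^ L)%N. Proof. by rewrite leq_exp2l. Qed.
Let nb_le : (nb <= Qc * w)%N. Proof. by apply/nbP. Qed.
Let npw : (Qc * w * d = npass * w)%N. Proof. by rewrite /npass mulnAC. Qed.
Let npL : (npass * w <= npass * L)%N. Proof. by rewrite leq_mul2l wL orbT. Qed.
Let nbd : (nb * d <= npass * L)%N.
Proof. by apply: leq_trans npL; rewrite -npw leq_mul2r nb_le orbT. Qed.
Let npB : (npass * L <= B)%N. Proof. by lia. Qed.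
Let code_lt i : (code i < 2 ^ (npass * w))%N.
Proof. by rewrite codeE -npw; apply: interleave_lt. Qed.
Let enc (x : 'I_n) := encoded d Qc L w z x.
Let encE x : (enc x %/ 2 ^ L = code x)%N.
Proof.
rewrite /enc /encoded codeE divnMDl ?expn_gt0// divn_small ?addn0//.
exact: leq_trans (ltn_ord x) nL.
Qed.
Let encM x : (enc x %% 2 ^ L = x)%N.
Proof.
by rewrite /enc /encoded modnMDl modn_small//; exact: leq_trans (ltn_ord x) nL.
Qed.
Let size_sl : size sl = n.
Proof. by rewrite slE size_sort size_enum_ord. Qed.
Let map_pos : [seq pos p | p <- iota 0 n] = sl.
Proof.
apply: (@eq_from_nth _ (pos 0)) => [|p]; first by rewrite size_map size_iota size_sl.
rewrite size_map size_iota => pn.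
rewrite (nth_map 0) ?size_iota// nth_iota// add0n posE//.
by apply: set_nth_default; rewrite size_sl.
Qed.

Lemma finalP r h e Q : globals n L w r ->
  (forall p, (p < n)%N -> h (ad n K (tag_arr npass) p) = e p) ->
  (forall p, (p < n)%N -> (e p < M)%N) ->
  (forall h', (forall p, (p < n)%N -> h' p = (e p %% 2 ^ L)%N) ->
    (forall x, (n <= x)%N -> h' x = h x) -> Q r h') ->
  hoare (PFor 2 10) r h (n * 80) (30 * L + 80) setT setT Q.
Proof.
move=> G hA eM HQ; have nM : (n + 2 < M)%N by lia.
have [E0 _ _ _] := G.
have tK : (tag_arr npass < K)%N by rewrite /K /stride /tag_arr; lia.
have LB : (2 ^ L <= 2 ^ B)%N by rewrite leq_exp2l//; lia.
have LM := @B_ge L ltac:(lia).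
apply: hoare_cost.
- apply: hoare_le; first apply: (@hoare_pfor R M inp D pr 2 final_body n r h 20 20
    (fun i => [set x | x = i \/ x = ad n K (tag_arr npass) i]) (fun i => [set i])
    (fun i h' => h' i = e i %% 2 ^ L)%N erefl nM _ _ _ _ 10 L r h Q) => //.
  + by move=> i h1 h2 E H; rewrite -E.
  + by move=> i x ->; left.
  + by move=> i j x lin ljn ij ->; case=> [//|E]; move: lin; rewrite E /ad; lia.
  + move=> i r1 h1 lin rr r11 HA.
    have G1 := globals_same rr G; have [F0 F1 F2 [F3 F4 F5]] := G1.
    have okT : ok r1 h1 [set x | x = i \/ x = ad n K (tag_arr npass) i]
        (Fetch (adE K (tag_arr npass) (Reg 1))).
      have K2 : (2 * K <= K * 2 ^ B)%N.
        by rewrite mulnC leq_mul2l (leq_exp2l 1)// orbC; lia.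
      have cM : (ad n K (tag_arr npass) i < M)%N.
        by apply: leq_trans (ad_lt n tK (leq_trans lin (leq_trans nL LB))) _.
      split; last by rewrite (eval_cell K _ _ _ G1) /= r11; right.
      by move: cM; rewrite /ad /= F0 r11 => cM; splits => //; lia.
    have evT : eval r1 h1 (Fetch (adE K (tag_arr npass) (Reg 1))) = e i.
      rewrite -hA// -HA; last by right.
      by rewrite /= F0 r11.
    apply: hoare_cost; first apply: hoare_sto.
    * by rewrite /= r11; bounds.
    * split; [exact: okT|by rewrite /= F5; splits => //; lia|].
      rewrite evT /= F5.
      by apply: leq_ltn_trans (eM _ lin); apply: leq_mod.
    * by rewrite /= r11; left.
    * by rewrite /= r11.
    * by rewrite [eval r1 h1 (Reg 1)]/= r11 /upd eqxx -evT -F5.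
    * by [].
    * by [].
  + by lia.
  + by move=> h1 P1 fr; apply: HQ => // x nx; apply: fr => -[i lin /= E]; lia.
  + exact: leqnn.
  + exact: leqnn.
  + by move=> ? _.
  + by move=> ? _.
  + by [].
- by rewrite leq_mul2l; lia.
- by lia.
Qed.

Lemma count_bitsP r h e Q : globals n L w r ->
  h (ad n K (tag_arr npass) (n - 1)) = e -> (e < M)%N ->
  (forall l, (l <= nb)%N -> (2 ^ (l * d) <= e %/ 2 ^ L)%N = (l < nb)%N) ->
  (forall r', (forall x, x <> 19 -> r' x = r x) -> r' 19 = nb -> Q r' h) ->
  hoare count_bits r h (nb * 60 + 60) (nb * 60 + 60) setT setT Q.
Proof.
move=> G he eM lE HQ; have [E0 E1 E2 [E3 E4 E5]] := G.
have tK : (tag_arr npass < K)%N by rewrite /K /stride /tag_arr; lia.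
have LB : (2 ^ L <= 2 ^ B)%N by rewrite leq_exp2l//; lia.
have LM := @B_ge L ltac:(lia).
have K2 : (2 * K <= K * 2 ^ B)%N.
  by rewrite mulnC leq_mul2l (leq_exp2l 1)// orbC; lia.
have cM : (ad n K (tag_arr npass) (n - 1) < M)%N.
  apply: leq_trans (ad_lt n tK (leq_trans _ LB)) HM; apply: leq_trans nL; lia.
apply: hoare_cost.
- apply: hoare_seq; apply: hoare_asg => //=; [by lia|by lia|].
  apply: (hoare_while (w := 20) (s := 20) (k := nb) (Inv := fun k r' h' => exists l,
    [/\ (k + l = nb)%N, h' = h, r' 19 = l & forall x, x <> 19 -> r' x = r x])); last first.
    by exists 0; rewrite addn0; split=> // x /eqP/negPf /= ->.
  move=> k r1 _ [l [kl -> r19 rx]].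
  have G1 : globals n L w r1 by split; [..|split]; rewrite rx.
  have evT : eval r1 h (Fetch (adE K (tag_arr npass) (Bin Defs.Sub (Reg 10) (Cst 1)))) = e.
    by rewrite -he /= !rx// E0.
  have okT : ok r1 h setT (Fetch (adE K (tag_arr npass) (Bin Defs.Sub (Reg 10) (Cst 1)))).
    split=> //; move: cM; rewrite /ad /= !rx// E0 => cM; splits => //; lia.
  have ldnb : (l * d <= nb * d)%N by rewrite leq_mul2r; lia.
  have lB := @B_ge (l * d) (leq_trans ldnb (leq_trans nbd npB)).
  have ldM : (l * d < 2 ^ (l * d))%N by apply: ltn_expl.
  have lM : (l <= l * d)%N by rewrite leq_pmulr.
  have dM : (d < M)%N by lia.
  have evC : eval r1 h (Bin Le (Bin Shl (Cst 1) (Bin Mul (Reg 19) (Cst d)))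
     (Bin Div (Fetch (adE K (tag_arr npass) (Bin Defs.Sub (Reg 10) (Cst 1)))) (Reg 15)))
     = (l < nb)%N.
    rewrite -[LHS]/(nat_of_bool (1 * 2 ^ (r1 19 * d) <=
      eval r1 h (Fetch (adE K (tag_arr npass) (Bin Defs.Sub (Reg 10) (Cst 1)))) %/ r1 15)%N).
    by rewrite evT r19 rx// E5 mul1n lE//; lia.
  split.
  + have boolM (b : bool) : (b < M)%N by case: b; lia.
    split; last exact: boolM.
      by rewrite /= r19 mul1n; splits => //; lia.
    split; [exact: okT|by rewrite /= rx// E5; splits => //; lia|].
    rewrite evT; apply: leq_ltn_trans eM; exact: leq_div.
  + rewrite evC => H; apply: HQ => //; rewrite r19.
    by apply/eqP; rewrite eqn_leq; apply/andP; split; lia.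
  + rewrite evC => H; case: k kl => [|k] kl; first by lia.
    exists k => //; apply: hoare_cost; first apply: hoare_asg => //=.
    * by rewrite r19; bounds.
    * by rewrite r19; lia.
    * exists l.+1; rewrite r19; split=> //; [by lia|by rewrite addn1|].
      by move=> x nx /=; rewrite ifN ?rx//; apply/eqP.
    * by [].
    * by [].
- by rewrite /=; lia.
- by rewrite /=; lia.
Qed.

Lemma code_mono p p' : (p <= p')%N -> (p' < n)%N ->
  (code (pos p) <= code (pos p'))%N.
Proof.
move=> pp p'n; have pn := leq_ltn_trans pp p'n.
have srt : sorted (relpre code leq) sl by rewrite slE; apply: sort_sorted => x y; exact: leq_total.
have tr : transitive (relpre code leq) by move=> x y x' /=; apply: leq_trans.
rewrite posE// [pos p']posE// (set_nth_default (pos p') (pos p)) ?size_sl//.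
by have := sorted_leq_nth tr (fun x => leqnn _) (pos p') srt;
  apply; rewrite ?inE ?size_sl.
Qed.

(** The last code in sorted order bounds all codes, and by [interleave_lt_iff] a bound 2 ^ (l * d)
    on the codes is a bound 2 ^ l on all coordinates. *)
Lemma nb_code l : (l <= nb)%N -> (2 ^ (l * d) <= code (pos (n - 1)))%N = (l < nb)%N.
Proof.
move=> lnb; have n1n : (n - 1 < n)%N by lia.
have H1 (v : nat -> nat) i : (i < n)%N -> v = z i -> forall c, (c < d)%N -> (v c < 2 ^ (Qc * w))%N.
  by move=> lin -> c; apply: zlt.
apply/idP/idP => [le|lt].
  rewrite ltnNge; apply/negP => /nbP H; move: le; apply/negP; rewrite -ltnNge codeE.
  by apply/interleave_lt_iff => c cd; [apply: zlt|apply: H].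
rewrite leqNgt; apply/negP => H; move: lt; apply/negP; rewrite -leqNgt.
apply/nbP => i c lin cd.
have : (code (Ordinal lin) < 2 ^ (l * d))%N.
  apply: leq_ltn_trans H.
  have : Ordinal lin \in sl by rewrite slE mem_sort mem_enum.
  rewrite -map_pos => /mapP[p]; rewrite mem_iota => /andP[_ pn] ->.
  by apply: code_mono; lia.
rewrite codeE => /interleave_lt_iff; apply=> // c' c'd; exact: zlt.
Qed.

Let ec := encode_cost K d Qc (tag_arr 0) 0 d.
Definition work_const := 3000 + 60 * d + ec + 1000 * npass + 60 * Qc.
Definition span_const := 3000 + 60 * d + ec + 2000 * npass + 60 * Qc.

Hypothesis DP : forall x, x \in (0, d) :: pairs -> [/\ (x.1 < M)%N, (x.2 < M)%N, D x.1 & D x.2].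

Lemma size_pairs : size pairs = (2 * d)%N.
Proof. by rewrite /pairs size_cat !size_map !size_iota; lia. Qed.

Lemma mainP :
  hoare main (upd (fun=> 0) 0 n) (fun=> 0)
    (work_const * 2 ^ L + zd_cost node_cost code cutoff (nb * d) sl)
    (span_const * 2 ^ w + (nb * d).+1 * node_cost n) setT setT
    (fun r' h' => represents h' (r' 0) (zd_build code cutoff (nb * d) sl)).
Proof.
have n0 : (0 < n)%N by lia.
have nL' : (0 < n <= 2 ^ L)%N by rewrite n0.
have wL' : (0 < w <= L)%N by rewrite w0.
have LM := @B_ge L ltac:(lia).
have tK q : (q <= npass)%N -> (tag_arr q < K)%N by rewrite /K /stride /tag_arr; lia.
have [umem1 umem2 umem3 umem4] := DP (pick_pair_mem inp (0, d) pairs).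
have Mpos : (2 < M)%N by lia.
have K4 : (3 < K)%N by lia.
have LBM : (L + B < M)%N.
  have B2 : (B < 2 ^ B)%N by apply: ltn_expl.
  have : (10 * 2 ^ B <= K * 2 ^ B)%N by rewrite leq_mul2r K10 orbT.
  by move: HM; lia.
have tA : (3 < tag_arr 0 < K)%N by rewrite tK.
have wdL : (w * d <= L * d)%N by rewrite leq_mul2r wL orbT.
have BL' : (Qc * w * d + L + w * d < B)%N by rewrite npw; lia.
have aLM := @B_ge (a * L) ltac:(lia).
have uM : [/\ 2 ^ (a * L) < M, u.1 < M & u.2 < M]%N by split=> //; lia.
have zM i c : (i < n)%N -> (c < d)%N -> (z i c < M)%N.
  move=> lin cd; apply: ltn_trans (zlt lin cd) _.
  have QwB : (Qc * w <= npass * w)%N by rewrite -npw leq_pmulr.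
  by have := @B_ge (Qc * w) ltac:(lia); lia.
have Lw : (L - w <= w)%N by rewrite /w; lia.
have KL : (n + stride npass * (2 ^ L).+1 < M)%N.
  apply: leq_trans HM; rewrite -/K ltn_add2l ltn_mul2l; apply/andP; split; first by lia.
  apply: (@leq_trans (2 ^ L.+1)); last by rewrite leq_exp2l//; lia.
  by rewrite expnS; have := ltn_expl L (isT : (1 < 2)%N); lia.
apply: hoare_cost.
- apply: hoare_seq; apply: hoare_weak; first exact: preambleP.
  move=> r1 _ [-> G1 r1_16].
  apply: hoare_seq; apply: hoare_asg => //=; [by lia|by lia|].
  apply: hoare_seq; apply: hoare_asg => //=; [by lia|by lia|].
  apply: hoare_seq; apply: hoare_weak; first by apply: (pick_hoare (p := (0, d))).
  move=> r2 _ [-> r2_17 r2_18 r2x].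
  have G2 : globals n L w r2.
    have [E0 E1 E2 [E3 E4 E5]] := G1.
    by split; [..|split]; rewrite r2x //=.
  have r2_16 : r2 16 = 2 ^ (a * L) by rewrite r2x.
  apply: hoare_seq; apply: (tableP d0 K4 tA nL' wL' HM BL' nd) => // h1 T1 fr1.
  apply: hoare_seq; apply: (encodeP d0 K4 tA nL' wL' HM BL' nd G2 r2_16 r2_17 r2_18
    Dc umem3 umem4 uM zE zM (p := 1)) => // h2 A2 fr2.
  have encB i : (i < n)%N -> (encoded d Qc L w z i < M)%N.
    move=> lin; rewrite /encoded.
    apply: (@leq_trans (2 ^ (Qc * w * d) * 2 ^ L)).
      apply: row_lt; [exact: interleave_lt|exact: leq_trans lin nL].
    by rewrite -expnD; have := @B_ge (Qc * w * d + L) ltac:(lia); lia.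
  apply: hoare_seq; apply: (passesP zd_program_pass nL' wL Lw KL G2
     (a := encoded d Qc L w z)) => //.
  + by move=> i j _ _; rewrite !key0.
  + move=> q i /andP[_ qn]; rewrite fr2 ?fr1//.
      by move=> x /ad_inj H; have [] := H _ _; rewrite /K /stride; lia.
    by move=> x /ad_inj H; have [] := H _ _; rewrite /K /stride /tag_arr; lia.
  rewrite add0n => h3 b pb sb hb.
  have bE p : (p < n)%N -> b p = enc (pos p).
    have E : mkseq b n = map enc sl.
      rewrite slE; apply: (sorted_by_key (L := L)) => //.
      - by move=> i j _ _; apply: code_inj.
      - by rewrite (map_comp (encoded d Qc L w z)) val_enum_ord.
      apply/(sortedP 0) => i; rewrite size_mkseq => iS.
      rewrite /= !nth_mkseq//; last by lia.
      have keyE j : (j < n)%N -> key L w npass (b j) = (b j %/ 2 ^ L)%N.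
        move=> jn; apply: key_full.
        have : b j \in mkseq (encoded d Qc L w z) n.
          by rewrite -(perm_mem pb); apply/mapP; exists j; rewrite ?mem_iota.
        move=> /mapP[k]; rewrite mem_iota => /andP[_ kn] ->.
        by rewrite (encE (Ordinal kn)); apply: code_lt.
      by rewrite -!keyE//; [apply: sb|lia].
    move=> pn; have := congr1 (fun l => nth 0 l p) E.
    by rewrite /= nth_mkseq// (nth_map (pos p)) ?size_sl// -posE.
  have bM p : (p < n)%N -> (b p < M)%N by move=> pn; rewrite bE//; apply: encB.
  apply: hoare_seq; apply: (finalP G2 hb bM) => h4 I4 fr4.
  have hb4 p : (p < n)%N -> h4 (ad n K (tag_arr npass) p) = b p.
    by move=> pn; rewrite fr4 ?hb// leq_addr.
  have n1n : (n - 1 < n)%N by lia.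
  apply: hoare_seq; apply: (count_bitsP G2 (hb4 _ n1n) (bM _ n1n)).
    by move=> l lnb; rewrite bE// encE; apply: nb_code.
  move=> r3 r3x r3_19.
  have G3 : globals n L w r3.
    have [E0 E1 E2 [E3 E4 E5]] := G2.
    by split; [..|split]; rewrite r3x.
  have [E0 E1 E2 [E3 E4 E5]] := G3.
  have nbdM : (nb * d < M)%N by lia.
  have dM : (d < M)%N by lia.
  have nbM : (nb < M)%N by have : (nb <= nb * d)%N by [rewrite leq_pmulr]; lia.
  apply: hoare_seq; apply: hoare_asg => //=; [by lia|by lia|].
  apply: hoare_seq; apply: hoare_asg => //=; [by lia|by lia|].
  apply: hoare_seq; apply: hoare_asg => //=; [by rewrite E0; bounds|by rewrite E0; lia|rewrite E0].
  apply: hoare_seq; apply: hoare_asg => //=; [by rewrite r3_19; bounds|by rewrite r3_19; lia|rewrite r3_19].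
  set r4 := upd _ 4 _.
  have G4 : globals n L w r4 by do 4 apply: globalsU => //.
  have segE : [seq pos p | p <- iota 0 (n - 0)] = sl by rewrite subn0 map_pos.
  apply: hoare_seq; apply: hoare_scoped.
  apply: hoare_le; first apply: (@buildP K (tag_arr npass) cutoff 3 R M inp D pr erefl n L w B
    pos code b _ _ HM _ _ _ _ _ _ (nb * d) 1 0 n r4 h4 G4) => //.
  + by rewrite tK ?andbT// /tag_arr; lia.
  + by lia.
  + by move=> p pn; rewrite bE// encE.
  + exact: code_mono.
  + by rewrite -expnS leq_exp2l//; lia.
  + by lia.
  + by lia.
  (* All codes lie below 2 ^ (nb * d), so at the root the common prefix is empty. *)
  + move=> p p' pn p'n; rewrite !divn_small//.
      rewrite codeE; apply/interleave_lt_iff => c cd; first exact: zlt.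
      exact: (proj1 (nbP nb) (leqnn _)).
    rewrite codeE; apply/interleave_lt_iff => c cd; first exact: zlt.
    exact: (proj1 (nbP nb) (leqnn _)).
  + by move=> p pn; rewrite I4// bE// encM.
  + exact: leqnn.
  + exact: leqnn.
  + by move=> ? _.
  + by move=> ? _.
  move=> ? h5 /= S5.
  have cM1 : (ad n K 0 1 < M)%N.
    by apply: leq_trans (ad_lt (m := 2 ^ B) n _ _) HM; [lia|rewrite (ltn_exp2l 0)//; lia].
  apply: hoare_asg => //.
  + by have [F0 _ _ _] := G4; move: cM1; rewrite /ad /= F0 => cM1; splits => //; lia.
  + by rewrite (eval_cell K 0 _ _ G4).
  rewrite (eval_cell K 0 _ _ G4) /=.
  by rewrite -segE; apply: stored_represents.
- have e1 : (n * (encode_cost K d Qc (tag_arr 0) 0 d + 70) <= 2 ^ L * ec + 70 * 2 ^ L)%N.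
    by rewrite -/ec (mulnC 70) -mulnDr leq_mul2r nL orbT.
  have X0 : (0 < 2 ^ L)%N by rewrite expn_gt0.
  have e2 : (d <= d * 2 ^ L)%N by rewrite leq_pmulr.
  have e3 : (nb <= Qc * 2 ^ L)%N.
    by apply: leq_trans nb_le _; rewrite leq_mul2l (leq_trans wL) ?orbT// ltnW// ltn_expl.
  have e4 : (L < 2 ^ L)%N by apply: ltn_expl.
  rewrite subn0 map_pos size_pairs /work_const; cbn [cost adE].
  move: (zd_cost _ _ _ _ _) => x; clear - nL wB e1 e2 e3 e4 X0; lia.
- have X0 : (0 < 2 ^ w)%N by rewrite expn_gt0.
  have e2 : (d <= d * 2 ^ w)%N by rewrite leq_pmulr.
  have e3 : (nb <= Qc * 2 ^ w)%N.
    by apply: leq_trans nb_le _; rewrite leq_mul2l ltnW ?orbT// ltn_expl.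
  have e4 : (L <= 2 * 2 ^ w)%N by have := ltn_expl w (isT : (1 < 2)%N); rewrite /w; lia.
  have e5 : (ec <= ec * 2 ^ w)%N by rewrite leq_pmulr.
  rewrite size_pairs /span_const -/ec; cbn [cost adE].
  move: ((nb * d).+1 * node_cost n)%N => x; clear - e2 e3 e4 e5 X0; lia.
Qed.

End Run.
End Main.

(** * Expansion and the total cost of the nodes *)

Section Boxes.
Local Open Scope ring_scope.
Context {R : realType} {d n : nat}.
Variables (P : 'I_n -> 'rV[R]_d) (X : set 'rV[R]_d) (gamma : R).
Hypothesis gamma1 : 1 <= gamma.
Hypothesis n1 : (1 < n)%N.
Hypothesis Puniq : unique_coordinates P.
Hypothesis Xconn : connected X.
Hypothesis PX : forall i, X (P i).
Hypothesis Pexp : has_expansion P X gamma.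
Implicit Types (x y : 'rV[R]_d) (r l : R).

Lemma in_boxE x r y : 0 <= r -> in_box x r y = (`|y - x| <= r).
Proof.
move=> r0; rewrite [`|y - x|]mx_normrE; apply/forallP/bigmax_leP => [H|[_ H] c].
  split=> // -[i c] _ /=; rewrite ord1; have := H c; by rewrite !mxE.
by have := H (0, c) isT; rewrite /= !mxE.
Qed.

Lemma box_count_le x y r l :
  (forall i, in_box x r (P i) -> in_box y l (P i)) ->
  (box_count P x r <= box_count P y l)%N.
Proof. by move=> H; apply: subset_leq_card; apply/fintype.subsetP => i; apply: H. Qed.

Lemma box_count_mono x r l : r <= l -> (box_count P x r <= box_count P x l)%N.
Proof.
move=> rl; apply: box_count_le => i /forallP H; apply/forallP => c.
exact: le_trans (H c) rl.
Qed.

Lemma box_count_sub x y r l : 0 <= r -> `|x - y| + r <= l ->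
  (box_count P x r <= box_count P y l)%N.
Proof.
move=> r0 rl; have l0 : 0 <= l by apply: le_trans rl; rewrite addr_ge0.
apply: box_count_le => i; rewrite !in_boxE// => H; apply: le_trans rl.
have -> : P i - y = (x - y) + (P i - x) by rewrite [RHS]addrC subrKA.
by apply: le_trans (ler_normD _ _) _; rewrite lerD2l.
Qed.

(* As coordinates are unique, every face of the box contains at most one point. *)
Lemma card_sphere x r : 0 < r ->
  (#|[pred i | (`|P i - x| == r)%R]| <= 2 * d)%N.
Proof.
move=> r0.
pose A := [set i | `|P i - x| == r].
pose on i (bc : bool * 'I_d) := P i 0 bc.2 == x 0 bc.2 + (-1) ^+ bc.1 * r.
have onA i : i \in A -> exists bc, on i bc.
  rewrite inE => /eqP Ei.
  have nz : mx_norm (P i - x) != 0 by rewrite -[mx_norm _]/(`|P i - x|) Ei gt_eqF.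
  have [[k c] /=] := mx_norm_neq0 nz.
  rewrite -[mx_norm _]/(`|P i - x|) Ei ord1 => Ec.
  have {}Ec : `|P i 0 c - x 0 c| = r by rewrite Ec !mxE.
  have [s|s] := ltP (P i 0 c - x 0 c) 0.
    by exists (true, c); rewrite /on /= expr1 mulN1r -Ec (ltr0_norm s); apply/eqP; lra.
  by exists (false, c); rewrite /on /= expr0 mul1r -Ec (ger0_norm s); apply/eqP; lra.
have -> : #|[pred i | `|P i - x| == r]| = #|A| by apply: eq_card => i; rewrite !inE.
have [->|[i1 /onA[bc0 _]]] := set_0Vmem A; first by rewrite cards0.
pose f i := odflt bc0 [pick bc | on i bc].
have fP i : i \in A -> on i (f i).
  by move=> /onA[bc onb]; rewrite /f; case: pickP => //= /(_ bc); rewrite onb.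
have finj : {in A &, injective f}.
  move=> i j /fP/eqP Ei /fP/eqP Ej Ef.
  by apply: (Puniq (c := (f i).2)); rewrite Ei Ef Ej.
rewrite -(card_in_imset finj); apply: leq_trans (max_card _) _.
by rewrite card_prod card_bool card_ord.
Qed.

Lemma expand x r : X x -> 0 < r -> (1 < box_count P x r)%N ->
  (box_count P x (4 * r))%:R <= gamma ^+ 2 * (box_count P x r)%:R.
Proof.
move=> Xx r0 k1; have -> : 4 * r = 2 * (2 * r) by lra.
have r2 : 0 < 2 * r by lra.
have k2 : (1 < box_count P x (2 * r))%N.
  by apply: leq_trans k1 _; apply: box_count_mono; lra.
apply: le_trans (Pexp Xx r2 k2) _.
rewrite expr2 -mulrA ler_wpM2l//; first exact: le_trans ler01 gamma1.
exact: Pexp.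
Qed.

(** Two doublings, each costing a factor [gamma], lead from a box with at most 2 d + 1 points to the
    box of four times its radius. *)
Definition sparse : R := gamma ^+ 2 * (2 * d + 1)%:R.

(* The smallest box around [x] with two points has at most [2 d + 1] points. *)
Lemma box_count_sparse x r : X x -> 0 < r -> (box_count P x r <= 1)%N ->
  (box_count P x (4 * r))%:R <= sparse.
Proof.
move=> Xx r0 k1; pose dist i := `|P i - x|.
have dE i j : in_box x (dist i) (P j) = (dist j <= dist i) by rewrite in_boxE /dist ?normr_ge0.
pose S := [pred i | (1 < box_count P x (dist i))%N].
(* The box reaching the farthest point contains all points, so the minimum over [S] below is over a
   nonempty set. *)
pose i0 : 'I_n := [arg max_(i > Ordinal (ltnW n1)) dist i]%O.
have Si0 : S i0.
  rewrite /S inE /= /box_count; have -> : #|[pred i | in_box x (dist i0) (P i)]| = n.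
    rewrite -[RHS]card_ord; apply: eq_card => i; rewrite !inE dE /i0.
    by case: arg_maxP => // j _ /(_ i isT).
  by [].
pose i1 := [arg min_(i < i0 | S i) dist i]%O.
have [S1 min1] : S i1 /\ forall j, S j -> dist i1 <= dist j.
  by rewrite /i1; case: arg_minP.
have r1 : r < dist i1.
  rewrite ltNge; apply/negP => le1; move: S1; rewrite inE /= ltnNge => /negP; apply.
  exact: leq_trans (box_count_mono x le1) k1.
(* Were there two points strictly inside, the farther of them would define a smaller box with two
   points. *)
have low1 : (#|[set j | (dist j < dist i1)%R]| <= 1)%N.
  rewrite leqNgt; apply/negP => /card_gt1P[j [k [jl kl jk]]].
  rewrite !inE in jl kl.
  wlog jk' : j k jl kl jk / dist j <= dist k.
    move=> H; case: (lerP (dist j) (dist k)) => [|/ltW] le; first exact: (H j k).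
    by apply: (H k j) => //; rewrite eq_sym.
  have : S k.
    rewrite inE /=; apply/card_gt1P; exists j, k; split=> //; rewrite !inE dE//.
  by move=> /min1; rewrite leNgt kl.
have cnt1 : (box_count P x (dist i1) <= 2 * d + 1)%N.
  have sph := card_sphere x (lt_trans r0 r1).
  have -> : box_count P x (dist i1) = #|[set j | (dist j < dist i1)%R] :|: [set j | (dist j == dist i1)%R]|.
    by apply: eq_card => j; rewrite !inE dE le_eqVlt orbC.
  apply: leq_trans (leq_card_setU _ _) _; rewrite addnC leq_add//.
  by apply: leq_trans sph; rewrite leq_eqVlt; apply/orP; left; apply/eqP;
    apply: eq_card => j; rewrite !inE.
apply: (@le_trans _ _ (box_count P x (4 * dist i1))%:R).
  by rewrite ler_nat; apply: box_count_mono; lra.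
apply: le_trans (expand Xx _ S1) _; first by lra.
by rewrite /sparse ler_wpM2l ?sqr_ge0// ler_nat.
Qed.

(** The intermediate value theorem for the distance to [P i] on the connected set [X]. *)
Lemma sphere_point i l y : 0 <= l -> X y -> l < `|y - P i| ->
  exists2 x, X x & `|x - P i| = l.
Proof.
move=> l0 Xy ly; pose f x := `|x - P i|.
have cf : continuous f.
  move=> x; apply: continuous_comp; last exact: norm_continuous.
  by apply: continuousB => //; exact: cst_continuous.
have /connected_intervalP If := connected_continuous_connected Xconn (continuous_subspaceT cf).
have : (f @` X)%classic l.
  apply: (If 0 (f y)); [by exists (P i) => //; rewrite /f subrr normr0|by exists y|].
  by rewrite l0 ltW.
by move=> [x Xx fx]; exists x.
Qed.

(* By connectedness there is a point of [X] at distance [3 l]; the expansion at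
   that point makes the box of radius [l] around it, which is disjoint from the
   one around [P i], carry a proportional number of points. *)
Lemma box_growth i j l : 0 < l -> 3 * l < `|P j - P i| ->
  sparse < (box_count P (P i) l)%:R ->
  (1 + (gamma ^+ 2)^-1) * (box_count P (P i) l)%:R <= (box_count P (P i) (4 * l))%:R.
Proof.
move=> l0 far dense.
(* At distance 3 l the boxes of radius l are disjoint, and each of them lies in the box of radius 4
   l around the other center. *)
have [x Xx xi] := sphere_point (i := i) (ltac:(lra) : 0 <= 3 * l) (PX j) far.
have g0 : 0 < gamma ^+ 2 by rewrite exprn_gt0// (lt_le_trans ltr01).
have le1 : (box_count P (P i) l)%:R <= (box_count P x (4 * l))%:R :> R.
  by rewrite ler_nat; apply: box_count_sub; [lra|rewrite distrC xi; lra].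
(* Otherwise the box of radius 4 l around [x] would have at most [sparse] points, yet it contains
   the dense box around [P i]. *)
have k1 : (1 < box_count P x l)%N.
  rewrite ltnNge; apply/negP => k1.
  by have := box_count_sparse Xx l0 k1; lra.
have le2 := le_trans le1 (expand Xx l0 k1).
have le3 : (box_count P (P i) l + box_count P x l <= box_count P (P i) (4 * l))%N.
  rewrite /box_count -cardUI [X in (_ + X)%N](_ : _ = 0) ?addn0.
    apply: subset_leq_card; apply/fintype.subsetP => k; rewrite !inE.
    rewrite !in_boxE; [|lra|lra|lra] => /orP[le|le]; first by lra.
    have -> : P k - P i = (P k - x) + (x - P i) by rewrite subrKA.
    by apply: le_trans (ler_normD _ _) _; rewrite xi; lra.
  apply: eq_card0 => k; rewrite !inE !in_boxE; [|lra|lra].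
  apply/negP => /andP[a b]; have : `|x - P i| <= l + l.
    have -> : x - P i = (P k - P i) - (P k - x) by rewrite opprB [RHS]addrC subrKA.
    exact: le_trans (ler_normB _ _) (lerD a b).
  by rewrite xi; lra.
rewrite -(ler_nat R) natrD in le3; apply: le_trans le3.
rewrite mulrDl mul1r lerD2l mulrC ler_pdivrMr// mulrC.
exact: le2.
Qed.

End Boxes.

(** * The weights of a point summed over all scales *)

Section Scales.
Local Open Scope ring_scope.
Context {R : realType} {d n : nat}.
Variables (P : 'I_n -> 'rV[R]_d) (X : set 'rV[R]_d) (gamma : R).
Hypothesis gamma1 : 1 <= gamma.
Hypothesis n1 : (1 < n)%N.
Hypothesis Puniq : unique_coordinates P.
Hypothesis Xconn : connected X.
Hypothesis PX : forall i, X (P i).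
Hypothesis Pexp : has_expansion P X gamma.
Variable cutoff : nat.
Hypothesis cut_sparse : @sparse R d gamma < cutoff%:R.
Hypothesis cut1 : (1 < cutoff)%N.

Definition shrink : R := (Num.sqrt (1 + (gamma ^+ 2)^-1))^-1.

Let g0 : 0 < gamma ^+ 2.
Proof. by rewrite exprn_gt0// (lt_le_trans ltr01). Qed.

Lemma shrink_lt1 : 0 < shrink < 1.
Proof.
have b1 : 1 < 1 + (gamma ^+ 2)^-1 by rewrite ltrDl invr_gt0.
have s1 : 1 < Num.sqrt (1 + (gamma ^+ 2)^-1) by rewrite -[X in X < _]sqrtr1 ltr_sqrt// (lt_trans ltr01).
by rewrite /shrink invr_gt0 (lt_trans ltr01)//= invf_lt1// (lt_trans ltr01).
Qed.

(* The cost O(log k) = O(sqrt k) of a node with [k] points is shared evenly among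
   its points. *)
Definition weight (k : nat) : R := if (cutoff <= k)%N then (Num.sqrt k%:R)^-1 else 0.

Lemma weight_ge0 k : 0 <= weight k.
Proof. by rewrite /weight; case: ifP => // _; rewrite invr_ge0 sqrtr_ge0. Qed.

Lemma sqrt_nat_ge1 k : (0 < k)%N -> 1 <= Num.sqrt k%:R :> R.
Proof. by move=> k0; rewrite -[X in X <= _]sqrtr1 ler_wsqrtr// ler1n. Qed.

Lemma weight_le1 k : weight k <= 1.
Proof.
rewrite /weight; case: ifP => // ck; have k0 : (0 < k)%N by lia.
by rewrite invf_le1 ?sqrt_nat_ge1// (lt_le_trans ltr01)// sqrt_nat_ge1.
Qed.

(* The square roots of the counts grow by the factor [shrink^-1] every second
   scale, so the weights telescope; only at the [k] coarsest scales no point need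
   be far away. *)
Lemma weight_sum q s J k : 0 < s ->
  (forall t, (t < J)%N -> exists j, 3 * (2 ^+ t * s) < `|P j - P q|) ->
  \sum_(t < J + k) weight (box_count P (P q) (2 ^+ t * s)) <= 2 / (1 - shrink) + k%:R.
Proof.
move=> s0 far; pose N t := box_count P (P q) (2 ^+ t * s).
have /andP[sh0 sh1] := shrink_lt1.
have NS t t' : (t <= t')%N -> (N t <= N t')%N.
  move=> tt; apply: box_count_mono; apply: ler_wpM2r; first exact: ltW.
  by rewrite ler_eXn2l ?ltr1n.
(* A potential that equals the weight above the cutoff. Its value 1 below the cutoff is the largest
   possible one, so the potential never increases there and the weight 0 is paid trivially. *)
pose phi t := if (cutoff <= N t)%N then (Num.sqrt (N t)%:R)^-1 else 1 : R.
have phi01 t : 0 <= phi t <= 1.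
  rewrite /phi; case: ifP => ct; last by rewrite ler01 lexx.
  by have := weight_le1 (N t); rewrite /weight ct => ->; rewrite invr_ge0 sqrtr_ge0.
have step t : (t < J)%N -> (1 - shrink) * weight (N t) <= phi t - phi t.+2.
  move=> tJ; rewrite /weight; have p2 := phi01 t.+2; case: ifPn => ct.
    have ct2 : (cutoff <= N t.+2)%N by apply: leq_trans ct (NS _ _ _); lia.
    have -> : phi t = (Num.sqrt (N t)%:R)^-1 by rewrite /phi ct.
    have -> : phi t.+2 = (Num.sqrt (N t.+2)%:R)^-1 by rewrite /phi ct2.
    have [j fj] := far t tJ.
    have l0 : 0 < 2 ^+ t * s by rewrite mulr_gt0// exprn_gt0//; lra.
    have dense : @sparse R d gamma < (N t)%:R by apply: lt_le_trans cut_sparse _; rewrite ler_nat.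
    have := box_growth gamma1 n1 Puniq Xconn PX Pexp l0 fj dense.
    have -> : 4 * (2 ^+ t * s) = 2 ^+ t.+2 * s by rewrite !exprS; ring.
    rewrite -/(N t) -/(N t.+2) => grow.
    have Nt0 : 0 < (N t)%:R :> R by rewrite ltr0n; lia.
    have Nt2 : 0 < (N t.+2)%:R :> R by rewrite ltr0n; lia.
    have b0 : 0 < 1 + (gamma ^+ 2)^-1 by rewrite addr_gt0// invr_gt0.
    have gs : Num.sqrt (1 + (gamma ^+ 2)^-1) * Num.sqrt (N t)%:R <= Num.sqrt (N t.+2)%:R.
      rewrite -(sqrtrM _ (ltW b0)); exact: ler_wsqrtr.
    have : (Num.sqrt (N t.+2)%:R)^-1 <= shrink * (Num.sqrt (N t)%:R)^-1.
      by rewrite /shrink -invfM lef_pV2 // ?posrE ?mulr_gt0 ?sqrtr_gt0.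
    by lra.
  have -> : phi t = 1 by rewrite /phi (negbTE ct).
  by rewrite mulr0; lra.
rewrite big_split_ord /= lerD//; last first.
  apply: (@le_trans _ _ (\sum_(t < k) 1)); last by rewrite sumr_const card_ord.
  by apply: ler_sum => t _; apply: weight_le1.
rewrite ler_pdivlMr ?subr_gt0// mulrC mulr_sumr.
(* The differences skip one index, so two initial terms remain, each at most 1; this is the 2 in the
   bound. *)
have tele : forall j, (j <= J)%N ->
    \sum_(t < j) (1 - shrink) * weight (N t) <= 2 - phi j - phi j.+1.
  elim=> [_|j IH jJ].
    by rewrite big_ord0; have := phi01 0%N; have := phi01 1%N; lra.
  by rewrite big_ord_recr /=; have := IH (ltnW jJ); have := step _ jJ; lra.
by have := tele J (leqnn _); have := phi01 J; have := phi01 J.+1; lra.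
Qed.

End Scales.

(** * Boxes of nodes against boxes centered at points *)

Section Cells.
Local Open Scope ring_scope.
Context {R : realType} {d n : nat}.
Variables (P : 'I_n -> 'rV[R]_d) (X : set 'rV[R]_d) (gamma : R).
Hypothesis gamma1 : 1 <= gamma.
Hypothesis d0 : (0 < d)%N.
Hypothesis n1 : (1 < n)%N.
Hypothesis Puniq : unique_coordinates P.
Hypothesis Xconn : connected X.
Hypothesis PX : forall i, X (P i).
Hypothesis Pexp : has_expansion P X gamma.
Variable cutoff : nat.
Hypothesis cut_sparse : @sparse R d gamma < cutoff%:R.
Hypothesis cut1 : (1 < cutoff)%N.
Variables (o : 'rV[R]_d) (g : R) (b : nat).
Hypothesis g0 : 0 < g.
Hypothesis oP : forall i c, 0 <= P i 0 c - o 0 c.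
Let zc i (c : 'I_d) : nat := grid P o g i ord0 c.
Hypothesis zlt : forall i c, (zc i c < 2 ^ b)%N.

Definition zcode i := interleave d b (coords (grid P o g i)).
(** The number of points sharing the node of [i] when [m] bits of the code are left. For [m] between
    [t * d] and [t.+1 * d], the box of the node lies between dyadic cubes of sides 2 ^ t * g and 2 ^
    t.+1 * g. *)
Definition cell_size m i := #|[pred j | zcode j %/ 2 ^ m == zcode i %/ 2 ^ m]%N|.

Lemma zc_bounds i c : (zc i c)%:R * g <= P i 0 c - o 0 c < (zc i c).+1%:R * g.
Proof.
rewrite /zc mxE -ler_pdivlMr// -ltr_pdivrMr//.
by apply: truncn_itv; rewrite divr_ge0// ltW.
Qed.

Lemma zc_div_bounds i c t : (zc i c %/ 2 ^ t)%:R * (2 ^+ t * g) <= P i 0 c - o 0 c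
  < ((zc i c %/ 2 ^ t)%:R + 1) * (2 ^+ t * g).
Proof.
have /andP[lo hi] := zc_bounds i c.
have t0 : (0 < 2 ^ t)%N by rewrite expn_gt0.
apply/andP; split.
  apply: le_trans lo; rewrite mulrA; apply: ler_wpM2r; first exact: ltW.
  by rewrite -natrX -natrM ler_nat; apply: leq_divM.
apply: lt_le_trans hi _; rewrite mulrA; apply: ler_wpM2r; first exact: ltW.
by rewrite -natrX natr1 -natrM ler_nat; apply: ltn_ceil.
Qed.

Lemma coords_lt i c : (c < d)%N -> (coords (grid P o g i) c < 2 ^ b)%N.
Proof. by move=> cd; have := coordsE (grid P o g i) (Ordinal cd) => /= ->; apply: zlt. Qed.

Lemma zcode_div i t :
  (zcode i %/ 2 ^ (t * d) = interleave d b (fun c => coords (grid P o g i) c %/ 2 ^ t))%N.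
Proof.
rewrite /zcode -(interleave_widen (b' := t + b)); last 2 first.
- exact: coords_lt.
- exact: leq_addl.
exact: interleave_div.
Qed.

Lemma same_cell_zc i j t : (zcode i %/ 2 ^ (t * d) = zcode j %/ 2 ^ (t * d))%N ->
  forall c, (zc i c %/ 2 ^ t = zc j c %/ 2 ^ t)%N.
Proof.
rewrite !zcode_div => E c; rewrite /zc -!coordsE.
have lt k c' : (c' < d)%N -> (coords (grid P o g k) c' %/ 2 ^ t < 2 ^ b)%N.
  by move=> cd; apply: leq_ltn_trans (leq_div _ _) (coords_lt _ cd).
exact: (interleave_inj (lt i) (lt j) E).
Qed.

Lemma cell_in_box i j m t : (m <= t * d)%N ->
  (zcode i %/ 2 ^ m = zcode j %/ 2 ^ m)%N -> in_box (P i) (2 ^+ t * g) (P j).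
Proof.
move=> mt E; have {}E : (zcode i %/ 2 ^ (t * d) = zcode j %/ 2 ^ (t * d))%N.
  by rewrite -(subnKC mt) expnD !divnMA E.
apply/forallP => c; have Ec := same_cell_zc E c.
have := zc_div_bounds i c t; have := zc_div_bounds j c t; rewrite Ec.
move: (zc j c %/ 2 ^ t)%:R (2 ^+ t * g) => u l; rewrite mulrDl mul1r.
by move: (u * l) => v; rewrite ler_norml => /andP[? ?] /andP[? ?]; apply/andP; split; lra.
Qed.

(** The radius is twice the side of the cubes, so the positions of the cubes of [q] and [i] differ
    by at most 2 in each coordinate. By symmetry five values per coordinate remain, which [key]
    shifts by 2 into ['I_5]; hence the constant 5 ^ d. *)
Lemma box_zc q i c t : in_box (P q) (2 ^+ t.+1 * g) (P i) ->
  (zc i c %/ 2 ^ t <= zc q c %/ 2 ^ t + 2)%N.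
Proof.
move=> /forallP /(_ c); have := zc_div_bounds i c t; have := zc_div_bounds q c t.
rewrite exprS -mulrA; set l := 2 ^+ t * g.
have l0 : 0 < l by rewrite mulr_gt0// exprn_gt0//; lra.
move=> /andP[q1 q2] /andP[i1 i2]; rewrite ler_norml => /andP[_ iq].
have : (zc i c %/ 2 ^ t)%:R * l < ((zc q c %/ 2 ^ t)%:R + 3) * l.
  rewrite mulrDl mul1r in q2; rewrite mulrDl; lra.
by rewrite ltr_pM2r// -natrD ltr_nat addn3 addn2 ltnS.
Qed.

Lemma in_box_sym (x y : 'rV[R]_d) (r : R) : in_box x r y = in_box y r x.
Proof. by apply: eq_forallb => c; rewrite distrC. Qed.

Let key q t i := [ffun c : 'I_d => inord (zc i c %/ 2 ^ t + 2 - zc q c %/ 2 ^ t) : 'I_5].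

Lemma key_same q t i j m : (t * d <= m)%N ->
  in_box (P q) (2 ^+ t.+1 * g) (P i) -> in_box (P q) (2 ^+ t.+1 * g) (P j) ->
  key q t i = key q t j -> (zcode i %/ 2 ^ m = zcode j %/ 2 ^ m)%N.
Proof.
move=> tm bi bj K.
have E (c : 'I_d) : (zc i c %/ 2 ^ t = zc j c %/ 2 ^ t)%N.
  have li := box_zc c bi; have lj := box_zc c bj.
  have li' : (zc q c %/ 2 ^ t <= zc i c %/ 2 ^ t + 2)%N by apply: box_zc; rewrite in_box_sym.
  have lj' : (zc q c %/ 2 ^ t <= zc j c %/ 2 ^ t + 2)%N by apply: box_zc; rewrite in_box_sym.
  have := congr1 (fun f : {ffun 'I_d -> 'I_5} => val (f c)) K.
  rewrite !ffunE /= !inordK; lia.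
rewrite -(subnKC tm) !expnD !divnMA !zcode_div; congr (_ %/ _)%N.
apply: eq_bigr => c _; congr (spread d b _ * _)%N.
by have := E c; rewrite /zc -!coordsE.
Qed.

Lemma cell_size_gt0 m i : (0 < cell_size m i)%N.
Proof. by apply/card_gt0P; exists i; rewrite inE. Qed.

(** The points near [q] are grouped by their cube of side 2 ^ t * g. A group lies in a single node,
    so it has at most as many points as the node, and each of them contributes the inverse of that
    number: a group sums to at most 1. *)
Lemma inv_cell_sum q t m : (t * d <= m)%N ->
  \sum_(i | in_box (P q) (2 ^+ t.+1 * g) (P i)) (cell_size m i)%:R^-1 <= (5 ^ d)%:R :> R.
Proof.
move=> tm; rewrite (partition_big (key q t) predT)//=.
apply: (@le_trans _ _ (\sum_(k : {ffun 'I_d -> 'I_5}) 1)); last first.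
  by rewrite sumr_const card_ffun !card_ord.
apply: ler_sum => k _.
case: (pickP (fun i => in_box (P q) (2 ^+ t.+1 * g) (P i) && (key q t i == k)));
  last by move=> E; rewrite big_pred0.
move=> i0 /andP[bi0 /eqP ki0].
have same i : in_box (P q) (2 ^+ t.+1 * g) (P i) && (key q t i == k) ->
    (zcode i %/ 2 ^ m = zcode i0 %/ 2 ^ m)%N.
  by move=> /andP[bi /eqP ki]; apply: (key_same tm bi bi0); rewrite ki.
rewrite (eq_bigr (fun=> (cell_size m i0)%:R^-1)); last first.
  move=> i /same E; congr (_%:R^-1); apply: eq_card => j; by rewrite !inE E.
rewrite sumr_const -[X in X <= _]mulr_natl ler_pdivrMr ?ltr0n ?cell_size_gt0// mul1r ler_nat.
apply: subset_leq_card; apply/fintype.subsetP => i /same E.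
by rewrite inE E.
Qed.

(* A dense cell charges the boxes of comparable size centered at the points around
   it; conversely, near a given point there are at most 5 ^ d cells. *)
Lemma weight_charge i m t : (m <= t.+1 * d)%N ->
  @weight R cutoff (cell_size m i) <=
  \sum_(q | in_box (P q) (2 ^+ t.+1 * g) (P i))
    gamma * @weight R cutoff (box_count P (P q) (2 ^+ t * (4 * g))) / (cell_size m i)%:R.
Proof.
move=> mt; set l := 2 ^+ t.+1 * g.
have l0 : 0 < l by rewrite mulr_gt0// exprn_gt0//; lra.
have c0 := cell_size_gt0 m i.
have gm0 : 0 < gamma by apply: lt_le_trans ltr01 gamma1.
rewrite {1}/weight; case: ifPn => cut; last first.
  by apply: sumr_ge0 => q _; rewrite divr_ge0// mulr_ge0 ?weight_ge0// ltW.
set N := box_count P (P i) l.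
have cN : (cell_size m i <= N)%N.
  apply: subset_leq_card; apply/fintype.subsetP => j; rewrite !inE => /eqP E.
  by apply: (cell_in_box mt).
have N0 : 0 < N%:R :> R by rewrite ltr0n (leq_trans c0).
have cR0 : 0 < (cell_size m i)%:R :> R by rewrite ltr0n.
rewrite -mulr_suml ler_pdivlMr//.
have -> : (Num.sqrt (cell_size m i)%:R)^-1 * (cell_size m i)%:R = Num.sqrt (cell_size m i)%:R :> R.
  by rewrite -{2}(sqr_sqrtr (ltW cR0)) expr2 mulKf// gt_eqF ?sqrtr_gt0.
apply: (@le_trans _ _ (Num.sqrt N%:R)); first by rewrite ler_wsqrtr// ler_nat.
(* Since [q] is in the box of [i] exactly when [i] is in the box of [q], there are N terms of 1 /
   sqrt N, one for each point that is charged. *)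
have -> : Num.sqrt N%:R = \sum_(q | in_box (P q) l (P i)) (Num.sqrt N%:R)^-1 :> R.
  rewrite sumr_const [X in _ = _ *+ X](_ : _ = N); last first.
    by apply: eq_card => q; rewrite !inE in_box_sym.
  by rewrite -[RHS]mulr_natl -{2}(sqr_sqrtr (ltW N0)) expr2 mulfK// gt_eqF ?sqrtr_gt0.
apply: ler_sum => q qi.
(* The box at [q] has radius 2 l in order to contain the box of radius l around [i], and so to reach
   the cutoff as well. *)
have E2 : 2 ^+ t * (4 * g) = 2 * l by rewrite /l exprS; lra.
rewrite E2; set N' := box_count P (P q) (2 * l).
have Nl : (N <= N')%N.
  apply: box_count_le => j; rewrite !in_boxE; [|lra|lra]; move: qi.
  rewrite in_boxE; last lra.
  move=> a1 a2; have -> : P j - P q = (P j - P i) + (P i - P q) by rewrite subrKA.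
  by apply: le_trans (ler_normD _ _) _; lra.
(* Conversely the box of radius 2 l around [q] lies within 3 l, hence within 4 l, of [i]. The factor
   gamma ^ 2 of the expansion becomes gamma under the square root. *)
have N'l : (N'%:R <= gamma ^+ 2 * N%:R :> R).
  apply: le_trans (expand gamma1 Pexp (PX i) l0 _); last first.
    by apply: leq_trans cut1 (leq_trans cut cN).
  rewrite ler_nat; apply: box_count_le => j; rewrite !in_boxE; [|lra|lra]; move: qi.
  rewrite in_boxE; last lra.
  rewrite distrC => a1 a2; have -> : P j - P i = (P j - P q) + (P q - P i) by rewrite subrKA.
  by apply: le_trans (ler_normD _ _) _; lra.
rewrite /weight (leq_trans (leq_trans cut cN) Nl).
have N'0 : 0 < N'%:R :> R by rewrite (lt_le_trans N0)// ler_nat.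
have sN : 0 < Num.sqrt N%:R :> R by rewrite sqrtr_gt0.
have sN' : 0 < Num.sqrt N'%:R :> R by rewrite sqrtr_gt0.
rewrite -[X in X <= _]mul1r ler_pdivrMr// mulrAC ler_pdivlMr// mul1r.
rewrite -[X in X * _](ger0_norm (ltW gm0)) -sqrtr_sqr -sqrtrM ?sqr_ge0//.
exact: ler_wsqrtr.
Qed.

Lemma cell_charge m t : (t * d <= m <= t.+1 * d)%N ->
  \sum_i @weight R cutoff (cell_size m i) <=
  (5 ^ d)%:R * gamma * \sum_q @weight R cutoff (box_count P (P q) (2 ^+ t * (4 * g))).
Proof.
move=> /andP[tm mt]; have gm0 : 0 < gamma by apply: lt_le_trans ltr01 gamma1.
apply: (@le_trans _ _ (\sum_i \sum_(q | in_box (P q) (2 ^+ t.+1 * g) (P i))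
    gamma * @weight R cutoff (box_count P (P q) (2 ^+ t * (4 * g))) / (cell_size m i)%:R)).
  by apply: ler_sum => i _; apply: weight_charge.
rewrite (exchange_big_dep predT)//= mulr_sumr; apply: ler_sum => q _.
rewrite -mulr_sumr mulrC -mulrA; apply: ler_wpM2r; last exact: inv_cell_sum.
by rewrite mulr_ge0 ?weight_ge0// ltW.
Qed.

End Cells.

Lemma sqr_le_exp2 t : t.+1 ^ 2 <= 4 * 2 ^ t.
Proof.
elim: t => [|[|[|t]] IH] //; rewrite (expnS 2).
by apply: (@leq_trans (2 * t.+3 ^ 2)); [rewrite -!mulnn; nia | lia].
Qed.

(** * The cost of the tree in terms of the weights of the points *)

Section TreeCost.
Local Open Scope ring_scope.
Context {R : realType} {n : nat}.
Variables (code : 'I_n -> nat) (cutoff : nat).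
Hypothesis cut0 : (0 < cutoff)%N.

(** With t = trunc_log 2 k, the left side is at most 420 (t + 1), and (t + 1) ^ 2 <= 4 * 2 ^ t <= 4
    k. The additional 60 pays for a leaf: a binary tree has one leaf more than internal nodes, and
    the remaining leaf is the constant 60 in [zd_cost_le]. *)
Lemma node_cost_sqrt k : (0 < k)%N ->
  (node_cost k)%:R + 60 <= 840 * Num.sqrt k%:R :> R.
Proof.
move=> k0; have kR : 0 <= k%:R :> R by rewrite ler0n.
have tk : (2 ^ trunc_log 2 k <= k)%N by apply: trunc_logP.
have t1 : (trunc_log 2 k).+1%:R <= 2 * Num.sqrt k%:R :> R.
  rewrite -(ler_pXn2r (n := 2)) ?nnegrE ?ler0n ?mulr_ge0 ?sqrtr_ge0//.
  rewrite exprMn sqr_sqrtr// -natrX -(natrX _ 2 2) -natrM ler_nat.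
  by apply: leq_trans (sqr_le_exp2 _) _; rewrite leq_mul2l tk orbT.
have : (node_cost k)%:R + 60 <= 420 * (trunc_log 2 k).+1%:R :> R.
  by rewrite -natrD -natrM ler_nat /node_cost; lia.
lra.
Qed.

Let class_size m i := #|[pred j | code j %/ 2 ^ m == code i %/ 2 ^ m]%N|.

(** By the last two hypotheses [s] is a whole class of points with a common prefix, that is, a node.
    Each of its k points carries 1 / sqrt k for it, which adds up to the sqrt k that bounds the cost
    of the node. *)
Lemma zd_cost_le m (s : seq 'I_n) : uniq s ->
  {in s &, forall x y, code x %/ 2 ^ m = code y %/ 2 ^ m}%N ->
  {in s, forall x, forall y, (code y %/ 2 ^ m = code x %/ 2 ^ m)%N -> y \in s} ->
  (zd_cost node_cost code cutoff m s)%:R <=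
  60 + 840 * \sum_(x <- s) \sum_(1 <= k < m.+1) @weight R cutoff (class_size k x).
Proof.
elim: m s => [|m IH] s us same full /=.
  by rewrite big1 ?mulr0 ?addr0// => x _; rewrite big_geq.
case: ifPn => cut.
  rewrite lerDl; apply: mulr_ge0; first exact: ler0n.
  by apply: sumr_ge0 => x _; apply: sumr_ge0 => k _; apply: weight_ge0.
have sz x : x \in s -> class_size m.+1 x = size s.
  move=> xs; rewrite -(card_uniqP us); apply: eq_card => y; rewrite inE.
  by apply/eqP/idP => [/(full _ xs)//|ys]; apply: same.
have s0 : (0 < size s)%N by lia.
have sub (b : bool) : let s' := [seq x <- s | bit m (code x) == b] in
    [/\ uniq s', {in s' &, forall x y, code x %/ 2 ^ m = code y %/ 2 ^ m}%N
      & {in s', forall x, forall y, (code y %/ 2 ^ m = code x %/ 2 ^ m)%N -> y \in s'}].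
  split; first exact: filter_uniq.
  - move=> x y; rewrite !mem_filter => /andP[/eqP bx xs] /andP[/eqP by' ys].
    by rewrite !(bit_decomp m) bx by' (same x y).
  - move=> x + y E; rewrite !mem_filter => /andP[/eqP bx xs].
    have E' : (code y %/ 2 ^ m.+1 = code x %/ 2 ^ m.+1)%N by rewrite expnSr !divnMA E.
    rewrite (full _ xs _ E') andbT -bx; apply/eqP.
    by move: E; rewrite !(bit_decomp m) E' => /addnI; case: bit; case: bit.
have [u0 same0 full0] := sub false; have [u1 same1 full1] := sub true.
have I0 := IH _ u0 same0 full0; have I1 := IH _ u1 same1 full1.
have f0 : [seq x <- s | ~~ bit m (code x)] = [seq x <- s | bit m (code x) == false].
  by apply: eq_filter => x; case: bit.
have f1 : [seq x <- s | bit m (code x)] = [seq x <- s | bit m (code x) == true].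
  by apply: eq_filter => x; case: bit.
rewrite -f0 in I0; rewrite -f1 in I1.
have -> : \sum_(x <- s) \sum_(1 <= k < m.+2) @weight R cutoff (class_size k x) =
   \sum_(x <- s) \sum_(1 <= k < m.+1) @weight R cutoff (class_size k x) + Num.sqrt (size s)%:R.
  rewrite (eq_bigr (fun x => \sum_(1 <= k < m.+1) @weight R cutoff (class_size k x) +
     @weight R cutoff (class_size m.+1 x))); last by move=> x _; rewrite big_nat_recr.
  rewrite big_split /=; congr (_ + _).
  rewrite big_seq (eq_bigr (fun=> (Num.sqrt (size s)%:R)^-1)); last first.
    by move=> x xs; rewrite sz// /weight ifT//; lia.
  rewrite -big_seq big_const_seq count_predT iter_addr_0 -[LHS]mulr_natl.
  have S0 : 0 < (size s)%:R :> R by rewrite ltr0n.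
  by rewrite -{1}(sqr_sqrtr (ltW S0)) expr2 mulfK// gt_eqF ?sqrtr_gt0.
have -> : \sum_(x <- s) \sum_(1 <= k < m.+1) @weight R cutoff (class_size k x) =
   \sum_(x <- [seq x <- s | bit m (code x)]) \sum_(1 <= k < m.+1) @weight R cutoff (class_size k x) +
   \sum_(x <- [seq x <- s | ~~ bit m (code x)]) \sum_(1 <= k < m.+1) @weight R cutoff (class_size k x).
  by rewrite !big_filter (bigID (fun x => bit m (code x))).
by have := node_cost_sqrt s0; rewrite !natrD; lra.
Qed.

End TreeCost.

(** * Linear total weight over all depths *)

Section Total.
Local Open Scope ring_scope.
Context {R : realType} {d n : nat}.
Implicit Types (x y : 'rV[R]_d).

Lemma edist_le x y : Defs.edist x y <= d%:R * `|x - y|.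
Proof.
rewrite /Defs.edist -[leRHS]ger0_norm ?mulr_ge0// -sqrtr_sqr ler_wsqrtr// exprMn.
apply: (@le_trans _ _ (\sum_(c < d) `|x - y| ^+ 2)).
  apply: ler_sum => c _; rewrite -[leLHS]real_normK ?num_real// lerXn2r ?nnegrE//.
  by have := in_boxE y x (normr_ge0 (x - y)); rewrite lexx => /forallP /(_ c).
rewrite sumr_const card_ord -[leLHS]mulr_natl ler_wpM2r ?sqr_ge0//.
by rewrite -natrX ler_nat; case: (d) => // d'; rewrite leq_pmulr.
Qed.

Lemma coord_le_edist x y c : `|x 0 c - y 0 c| <= Defs.edist x y.
Proof.
rewrite /Defs.edist -sqrtr_sqr ler_wsqrtr// (bigD1 c)//= lerDl.
by apply: sumr_ge0 => c' _; apply: sqr_ge0.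
Qed.

Variables (P : 'I_n -> 'rV[R]_d).

Lemma edist_ge0 x y : 0 <= Defs.edist x y. Proof. exact: sqrtr_ge0. Qed.

Lemma edist_le_dmax i j : Defs.edist (P i) (P j) <= dmax P.
Proof.
apply: (@le_trans _ _ (\big[Num.max/0]_j Defs.edist (P i) (P j))).
  exact: (le_bigmax _ (fun j => Defs.edist (P i) (P j))).
exact: (le_bigmax _ (fun i => \big[Num.max/0]_j Defs.edist (P i) (P j))).
Qed.

Lemma dmaxP : (0 < n)%N -> exists i j, dmax P <= Defs.edist (P i) (P j).
Proof.
move=> n0; pose i0 := Ordinal n0.
pose ij := [arg max_(p > (i0, i0)) Defs.edist (P p.1) (P p.2)]%O.
exists ij.1, ij.2; rewrite /ij; case: arg_maxP => // p _ H.
apply/bigmax_leP; split=> [|i _]; first exact: edist_ge0.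
apply/bigmax_leP; split=> [|j _]; first exact: edist_ge0.
exact: (H (i, j)).
Qed.

Variables (X : set 'rV[R]_d) (gamma : R).
Hypothesis gamma1 : 1 <= gamma.
Hypothesis d0 : (0 < d)%N.
Hypothesis n1 : (1 < n)%N.
Hypothesis Puniq : unique_coordinates P.
Hypothesis Xconn : connected X.
Hypothesis PX : forall i, X (P i).
Hypothesis Pexp : has_expansion P X gamma.
Variable cutoff : nat.
Hypothesis cut_sparse : @sparse R d gamma < cutoff%:R.
Hypothesis cut1 : (1 < cutoff)%N.
Variables (o : 'rV[R]_d) (g : R) (b : nat).
Hypothesis g0 : 0 < g.
Hypothesis oP : forall i c, 0 <= P i 0 c - o 0 c.
Hypothesis zlt : forall i (c : 'I_d), (grid P o g i ord0 c < 2 ^ b)%N.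
Hypothesis btop : (0 < b)%N -> 2 ^+ b.-1 * g <= 2 * dmax P.

(** One end of a pair at distance [dmax P] is at least half as far from [q] as the two ends are from
    each other. The required 12 * 2 ^ t * g thus becomes 24, and 48 because of the factor 2 in
    [btop]; comparing Euclidean distance and norm costs a factor d. Finally 48 d < 64 * 2 ^ d = 2 ^
    (d + 6), and the seventh digit is the difference between [b] and [b.-1]. *)
Lemma far_point q t : (t + d + 7 <= b)%N ->
  exists j, 3 * (2 ^+ t * (4 * g)) < `|P j - P q|.
Proof.
move=> tb; have [i [j ij]] := dmaxP (ltnW n1).
have top := btop ltac:(lia).
have dR : 0 < d%:R :> R by rewrite ltr0n.
have {}ij := le_trans ij (edist_le (P i) (P j)).
have tri : `|P i - P j| <= `|P i - P q| + `|P j - P q|.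
  by rewrite (distrC (P j)) -[P i - P j](subrKA (P q)); apply: ler_normD.
have pw : 48 * d%:R * 2 ^+ t < 2 ^+ b.-1 :> R.
  have -> : 2 ^+ b.-1 = 2 ^+ t * (64 * (2 ^+ d * 2 ^+ (b - (t + d + 7)))) :> R.
    have -> : b.-1 = (t + (6 + (d + (b - (t + d + 7)))))%N by lia.
    by rewrite !exprD; congr (_ * (_ * _)); ring.
  have t0 : 0 < 2 ^+ t :> R by rewrite exprn_gt0//; lra.
  rewrite mulrC ltr_pM2l//.
  have dd : d%:R <= 2 ^+ d :> R by rewrite -natrX ler_nat ltnW// ltn_expl.
  have e1 : 1 <= 2 ^+ (b - (t + d + 7)) :> R by rewrite exprn_ege1//; lra.
  have : d%:R <= 2 ^+ d * 2 ^+ (b - (t + d + 7)) :> R.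
    by rewrite -[leLHS]mulr1; apply: ler_pM => //; exact: ltW.
  lra.
have : 48 * d%:R * 2 ^+ t * g < 2 ^+ b.-1 * g by rewrite ltr_pM2r.
move=> lt1; have lt2 : d%:R * (24 * (2 ^+ t * g)) < d%:R * (`|P i - P q| + `|P j - P q|).
  apply: lt_le_trans (ler_wpM2l (ltW dR) tri); apply: lt_le_trans ij.
  have : 48 * d%:R * 2 ^+ t * g = 2 * (d%:R * (24 * (2 ^+ t * g))) by ring.
  by move: lt1 top; lra.
rewrite ltr_pM2l// in lt2.
have [le|lt] := lerP (`|P i - P q|) (3 * (2 ^+ t * (4 * g))); last by exists i.
by exists j; lra.
Qed.

(** The factors are the [d] depths of a scale, the cost of passing from nodes to centered boxes, and
    per point the series over the fine scales together with at most 1 for each of the [d + 7]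
    coarsest ones, where [far_point] gives nothing. *)
Definition total_const : R :=
  d%:R * ((5 ^ d)%:R * gamma * (2 / (1 - shrink gamma) + (d + 7)%:R)).

Lemma sum_block (f : nat -> R) (F : nat -> R) B :
  (forall m t, (t * d <= m <= t.+1 * d)%N -> F m <= f t) ->
  \sum_(0 <= m < B * d) F m <= d%:R * \sum_(t < B) f t.
Proof.
move=> Ff; elim: B => [|B IH]; first by rewrite mul0n big_geq// big_ord0 mulr0.
rewrite (big_cat_nat (n := (B * d)%N))//=; last by rewrite leq_mul2r leqnSn orbT.
rewrite big_ord_recr /= mulrDr lerD//.
apply: (@le_trans _ _ (\sum_(B * d <= m < B.+1 * d) f B)).
  by rewrite big_nat_cond [leRHS]big_nat_cond; apply: ler_sum => m;
    rewrite andbT => /andP[l1 l2]; apply: Ff; rewrite l1 ltnW.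
by rewrite sumr_const_nat mulSn addnK mulr_natl.
Qed.

Lemma cell_sum :
  \sum_i \sum_(1 <= k < (b * d).+1) @weight R cutoff (cell_size P o g b k i)
    <= total_const * n%:R.
Proof.
have gm0 : 0 < gamma by apply: lt_le_trans ltr01 gamma1.
have k0 : 0 <= (5 ^ d)%:R * gamma by rewrite mulr_ge0// ltW.
apply: (@le_trans _ _ (\sum_(0 <= m < b.+1 * d)
    \sum_i @weight R cutoff (cell_size P o g b m i))).
  rewrite exchange_big /= [leRHS](big_cat_nat (n := 1))//=; last by rewrite muln_gt0.
  rewrite -[leLHS]add0r lerD//.
    by rewrite sumr_ge0// => m _; rewrite sumr_ge0// => i _; apply: weight_ge0.
  rewrite [leRHS](big_cat_nat (n := (b * d).+1))//=; last by rewrite mulSn; lia.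
  by rewrite lerDl sumr_ge0// => m _; rewrite sumr_ge0// => i _; apply: weight_ge0.
apply: le_trans (sum_block (f := fun t => (5 ^ d)%:R * gamma *
    \sum_q @weight R cutoff (box_count P (P q) (2 ^+ t * (4 * g)))) _ _) _.
  move=> m t tm.
  exact: (cell_charge gamma1 d0 n1 PX Pexp cut_sparse cut1 g0 oP zlt tm).
rewrite /total_const -mulrA; apply: ler_wpM2l; first by rewrite ler0n.
rewrite -mulr_sumr -[leRHS]mulrA; apply: ler_wpM2l => //.
rewrite exchange_big /=.
apply: (@le_trans _ _ (\sum_(q : 'I_n) (2 / (1 - shrink gamma) + (d + 7)%:R))).
  apply: ler_sum => q _.
  (* If b + 1 < d + 7 the first summand is 0 by truncation and all scales count as coarse; in any
     case the second one is at most d + 7. *)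
  have -> : b.+1 = ((b.+1 - (d + 7)) + (b.+1 - (b.+1 - (d + 7))))%N by lia.
  apply: le_trans (weight_sum gamma1 n1 Puniq Xconn PX Pexp cut_sparse cut1 _ _ _) _.
  - by rewrite mulr_gt0//; lra.
  - by move=> t tJ; apply: far_point; lia.
  - by rewrite lerD2l ler_nat; lia.
by rewrite sumr_const card_ord mulr_natr.
Qed.

End Total.

(** * The grid and the bounds *)

Section Instance.
Local Open Scope ring_scope.
Context {R : realType} {d n : nat}.
Variables (P : 'I_n -> 'rV[R]_d) (o : 'rV[R]_d).

(** One concrete input, on which work and span can be determined before the quantification over
    inputs in [builds]. By [layout_unique] any other input agrees with it on the cells that
    matter. *)
Definition layout (x : nat) : R :=
  if insub (x %% d)%N is Some c then
    if insub (x %/ d)%N is Some i then P i 0 c else o 0 c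
  else 0.

Lemma layoutP : input_layout P o layout.
Proof.
split=> [i c|c]; have d0 : (0 < d)%N by apply: leq_ltn_trans (ltn_ord c).
- by rewrite /layout modnMDl modn_small// divnMDl// divn_small// addn0 !valK.
- by rewrite /layout modnMDl modn_small// valK divnMDl// divn_small// addn0 insubF ?ltnn.
Qed.

Lemma layout_unique inp : (0 < d)%N -> input_layout P o inp ->
  forall x, (x < n.+1 * d)%N -> inp x = layout x.
Proof.
move=> d0 [inpP inpo] x xlt; have md : (x %% d < d)%N by rewrite ltn_mod.
have [lP lo] := layoutP.
rewrite (divn_eq x d); have : (x %/ d <= n)%N by rewrite -ltnS ltn_divLR.
rewrite leq_eqVlt => /orP[/eqP ->|lt]; first by rewrite (inpo (Ordinal md)) (lo (Ordinal md)).
by rewrite (inpP (Ordinal lt) (Ordinal md)) (lP (Ordinal lt) (Ordinal md)).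
Qed.

Hypothesis n1 : (1 < n)%N.
Hypothesis Pinj : injective P.

Lemma dim_gt0 : (0 < d)%N.
Proof.
case: (posnP d) => // d0; have : Ordinal (ltnW n1) = Ordinal n1.
  by apply: Pinj; apply/rowP => -[c cd]; exfalso; rewrite d0 in cd.
by move=> /(congr1 val).
Qed.

Lemma dmin_le i j : i != j -> dmin P <= Defs.edist (P i) (P j).
Proof.
move=> ij; exact: (@bigmin_le_cond _ _ _ (dmax P) (i, j) (fun ij => ij.1 != ij.2)
  (fun ij => Defs.edist (P ij.1) (P ij.2)) ij).
Qed.

Lemma edist_gt0 i j : i != j -> 0 < Defs.edist (P i) (P j).
Proof.
move=> ij; rewrite lt0r edist_ge0 andbT; apply: contra_neqN ij => /eqP E.
apply: Pinj; apply/rowP => c; apply/eqP; rewrite -subr_eq0 -normr_le0.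
by rewrite -E coord_le_edist.
Qed.

Lemma dmin_gt0 : 0 < dmin P.
Proof.
have i01 : Ordinal (ltnW n1) != Ordinal n1 by [].
have dm : 0 < dmax P by apply: lt_le_trans (edist_gt0 i01) (edist_le_dmax _ _ _).
by apply/bigmin_gtP; split=> // -[i j] /= ij; apply: edist_gt0.
Qed.

Let u := pick_pair layout (0, d)%N (pairs d).
Let i0 := Ordinal (ltnW n1).
Let i1 := Ordinal n1.
(** The maximum norm of the difference of the first two points, since [pairs] contains each
    coordinate in both orders. *)
Definition spreadR : R := layout u.1 - layout u.2.

Lemma layout0 (c : 'I_d) : layout c = P i0 0 c.
Proof. by have [<- _] := layoutP; rewrite mul0n. Qed.

Lemma layout1 (c : 'I_d) : layout (d + c)%N = P i1 0 c.
Proof. by have [<- _] := layoutP; rewrite mul1n. Qed.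

Lemma pairs_mem (x : nat * nat) : x \in (0, d)%N :: pairs d ->
  exists c : 'I_d, x = (val c, (d + c)%N) \/ x = ((d + c)%N, val c).
Proof.
have d0 := dim_gt0.
rewrite inE mem_cat => /or3P[/eqP ->|/mapP[c cI ->]|/mapP[c cI ->]].
- by exists (Ordinal d0); left; rewrite /= addn0.
- by rewrite mem_iota in cI; exists (Ordinal cI); left.
- by rewrite mem_iota in cI; exists (Ordinal cI); right.
Qed.

Lemma spreadR_le : spreadR <= dmax P.
Proof.
apply: le_trans (edist_le_dmax _ i0 i1).
have [c] := pairs_mem (pick_pair_mem layout (0, d)%N (pairs d)).
rewrite /spreadR -/u => -[] -> /=; rewrite layout0 layout1.
  exact: le_trans (ler_norm _) (coord_le_edist _ _ _).
by apply: le_trans (coord_le_edist _ _ c); rewrite distrC ler_norm.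
Qed.

Lemma spreadR_ge : dmin P <= d%:R * spreadR.
Proof.
apply: le_trans (dmin_le (isT : i0 != i1)) _; apply: le_trans (edist_le _ _) _.
have H (c : 'I_d) : `|P i0 0 c - P i1 0 c| <= spreadR.
  have cI : val c \in iota 0 d by rewrite mem_iota ltn_ord.
  rewrite ler_norml; apply/andP; split.
  - rewrite lerNl opprB -layout0 -layout1; apply: (pick_pair_max layout (q := ((d + c)%N, val c))).
    by rewrite inE mem_cat; apply/or3P/Or33; apply/mapP; exists (val c).
  - rewrite -layout0 -layout1; apply: (pick_pair_max layout (q := (val c, (d + c)%N))).
    by rewrite inE mem_cat; apply/or3P/Or32; apply/mapP; exists (val c).
apply: ler_wpM2l => //; rewrite -in_boxE; first exact/forallP.
exact: le_trans (normr_ge0 _) (H (Ordinal dim_gt0)).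
Qed.

Variable k : nat.
Hypothesis kP : d%:R * (dmax P / dmin P) <= k%:R.

Let d0 : 0 < d%:R :> R. Proof. by rewrite ltr0n dim_gt0. Qed.

Lemma ratio_ge1 : 1 <= dmax P / dmin P.
Proof.
rewrite ler_pdivlMr ?dmin_gt0// mul1r.
exact: le_trans (dmin_le (isT : i0 != i1)) (edist_le_dmax _ _ _).
Qed.

Lemma spreadR_gt0 : 0 < spreadR.
Proof. by rewrite -(pmulr_rgt0 _ d0); apply: lt_le_trans dmin_gt0 spreadR_ge. Qed.

Lemma resolution_gt0 : 0 < k%:R :> R.
Proof.
apply: lt_le_trans kP; rewrite mulr_gt0//.
by apply: lt_le_trans ratio_ge1.
Qed.

(* The machine does not know [dmin P]; the first two points provide a length
   between [dmin P / d] and [dmax P]. *)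
Definition mesh : R := spreadR / k%:R.

Lemma mesh_gt0 : 0 < mesh.
Proof. by rewrite divr_gt0 ?spreadR_gt0 ?resolution_gt0. Qed.

Lemma mesh_le : d%:R * mesh <= dmin P.
Proof.
rewrite /mesh mulrA ler_pdivrMr ?resolution_gt0//.
apply: (@le_trans _ _ (d%:R * dmax P)); first by rewrite ler_pM2l// spreadR_le.
rewrite -ler_pdivrMl ?dmin_gt0//; apply: le_trans kP.
by rewrite mulrCA (mulrC (dmax P)).
Qed.

Hypothesis oP : valid_offset P o.

Lemma grid_mesh_bounds i c : ((grid P o mesh i) ord0 c)%:R * mesh <= P i 0 c - o 0 c
  < (((grid P o mesh i) ord0 c).+1)%:R * mesh.
Proof.
rewrite mxE -ler_pdivlMr ?mesh_gt0// -ltr_pdivrMr ?mesh_gt0//.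
by apply: truncn_itv; rewrite divr_ge0 ?(ltW mesh_gt0)//; have /andP[] := oP i c.
Qed.

(** Points with the same image differ by less than the mesh in every coordinate, hence by less than
    d times the mesh, at most [dmin P], in distance. *)
Lemma grid_inj : injective (grid P o mesh).
Proof.
move=> i j E; apply/eqP; apply: contraT => ij.
suff : Defs.edist (P i) (P j) < dmin P by rewrite ltNge dmin_le.
apply: le_lt_trans (edist_le _ _) _; apply: lt_le_trans mesh_le.
rewrite ltr_pM2l//.
have H (c : 'I_d) : `|P i 0 c - P j 0 c| < mesh.
  have := grid_mesh_bounds i c; have := grid_mesh_bounds j c; rewrite -E.
  move: (grid P o mesh i ord0 c) => z; rewrite -natr1 mulrDl mul1r.
  by move=> /andP[? ?] /andP[? ?]; rewrite ltr_norml; apply/andP; split; lra.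
have nz : mx_norm (P i - P j) != 0.
  by rewrite -[mx_norm _]/(`|P i - P j|) normr_eq0 subr_eq0 (inj_eq Pinj).
have [[r c] /= Ec] := mx_norm_neq0 nz.
by rewrite -[`|P i - P j|]/(mx_norm (P i - P j)) Ec ord1 !mxE.
Qed.

(** A shifted coordinate is at most 2 dmax, and dmax / mesh = k * dmax / spreadR. The second factor
    [k] comes from dmax / spreadR <= d * dmax / dmin <= k. *)
Lemma grid_mesh_le i c : ((grid P o mesh i) ord0 c <= 2 * k ^ 2)%N.
Proof.
have /andP[H _] := grid_mesh_bounds i c.
have {}H : (grid P o mesh i ord0 c)%:R * mesh <= 2 * dmax P.
  by apply: le_trans H _; have /andP[] := oP i c.
rewrite -(ler_nat R) -(ler_pM2r mesh_gt0); apply: le_trans H _.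
have -> : (2 * k ^ 2)%:R * mesh = 2 * (k%:R * spreadR).
  by rewrite /mesh natrM natrX; field; rewrite gt_eqF ?resolution_gt0.
rewrite ler_pM2l//; apply: (@le_trans _ _ (d%:R * (dmax P / dmin P) * spreadR)); last first.
  by rewrite ler_pM2r ?spreadR_gt0.
have -> : d%:R * (dmax P / dmin P) * spreadR = dmax P * ((d%:R * spreadR) / dmin P).
  by field; rewrite gt_eqF ?dmin_gt0.
rewrite -[leLHS]mulr1; apply: ler_wpM2l.
  exact: le_trans (ltW spreadR_gt0) spreadR_le.
by rewrite ler_pdivlMr ?dmin_gt0// mul1r spreadR_ge.
Qed.

(** By minimality of [nbits]: were the inequality false, one digit less would suffice for all
    coordinates. *)
Lemma nbits_top : (0 < nbits (grid P o mesh))%N ->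
  2 ^+ (nbits (grid P o mesh)).-1 * mesh <= 2 * dmax P.
Proof.
move=> b0; rewrite leNgt; apply/negP => lt.
suff : (nbits (grid P o mesh) <= (nbits (grid P o mesh)).-1)%N by lia.
apply/nbits_le => i c; rewrite -(ltr_nat R) natrX -(ltr_pM2r mesh_gt0).
apply: le_lt_trans lt; have /andP[H _] := grid_mesh_bounds i c.
by apply: le_trans H _; have /andP[] := oP i c.
Qed.

Lemma grid_round (i : 'I_n) (c : 'I_d) :
  Num.truncn (k%:R * (layout (i * d + c)%N - layout (n * d + c)%N) /
    (layout u.1 - layout u.2)) = grid P o mesh i ord0 c.
Proof.
have [-> ->] := layoutP; rewrite mxE -/spreadR /mesh; congr Num.truncn.
by field; rewrite !gt_eqF ?resolution_gt0 ?spreadR_gt0.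
Qed.

End Instance.

Lemma height_zd_build T (code : T -> nat) cutoff m s :
  height (zd_build code cutoff m s) <= m.
Proof.
by elim: m s => [|m IH] s //=; case: ifP => // _; rewrite /= ltnS geq_max !IH.
Qed.

Section Logarithms.
Local Open Scope ring_scope.
Context {R : realType}.
Variable n : nat.
Hypothesis n1 : (1 < n)%N.
Let L := up_log 2 n.
Let w := ((L + 1) %/ 2)%N.
Let L0 : (0 < L)%N. Proof. by rewrite up_log_gt0. Qed.
Let Llt : (2 ^ L.-1 < n)%N. Proof. exact: up_log_gtn. Qed.

Lemma pow_log_le : (2 ^ L <= 2 * n)%N.
Proof. by rewrite -(prednK L0) expnS leq_mul2l/= ltnW. Qed.

(** Both L - 1 and 1 are at most the binary logarithm of n, since n is at least 2. *)
Lemma log_le_ln : L%:R <= 2 / ln 2 * ln n%:R :> R.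
Proof.
have ln2 : 0 < ln 2 :> R by rewrite ln_gt0// ltr1n.
have nR : 0 < n%:R :> R by rewrite ltr0n ltnW.
have le2 : ln 2 <= ln n%:R :> R by rewrite ler_ln ?posrE// (ler_nat _ 2).
have : L.-1%:R * ln 2 <= ln n%:R :> R.
  by rewrite mulr_natl -lnXn// -natrX ler_ln ?posrE ?ltr0n ?expn_gt0// ?ler_nat ltnW.
rewrite mulrAC ler_pdivlMr// => H.
have -> : L%:R = L.-1%:R + 1 :> R by rewrite natr1 prednK.
lra.
Qed.

(** Squaring, 2 w <= L + 1 and 2 ^ (L - 1) < n. *)
Lemma half_pow_le : (2 ^ w)%:R <= 2 * Num.sqrt n%:R :> R.
Proof.
rewrite -(ler_pXn2r (n := 2)) ?nnegrE ?ler0n ?mulr_ge0 ?sqrtr_ge0//.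
rewrite exprMn sqr_sqrtr// -natrX -(natrX _ 2 2) -natrM ler_nat -expnM.
apply: (@leq_trans (2 ^ (L.-1 + 2))); last by rewrite expnD mulnC leq_mul2l ltnW.
by rewrite leq_exp2l// /w; move: L0; lia.
Qed.

End Logarithms.

Section Build.
Local Open Scope ring_scope.
Context {R : realType} {d n : nat}.
Variables (a : nat) (P : 'I_n -> 'rV[R]_d) (o : 'rV[R]_d).
Hypothesis n1 : (1 < n)%N.
Hypothesis Pinj : injective P.
Let L := up_log 2 n.
Hypothesis kP : d%:R * (dmax P / dmin P) <= (2 ^ (a * L))%:R.
Hypothesis oP : valid_offset P o.

(** The number of digits of [w] bits per coordinate. Coordinates are at most 2 * (2 ^ (a L)) ^ 2 = 2
    ^ (2 a L + 1), and L <= 2 w gives 2 a L + 1 < (4 a + 4) w. *)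
Definition digits : nat := (4 * a + 4)%N.

Let w := ((L + 1) %/ 2)%N.
Let g := mesh P o (2 ^ (a * L)).
Let z := grid P o g.
Let d0 : (0 < d)%N := dim_gt0 n1 Pinj.
Let L0 : (0 < L)%N. Proof. by rewrite up_log_gt0. Qed.
Let Ln : (n <= 2 ^ L)%N. Proof. exact: up_logP. Qed.

Lemma grid_lt i c : (z i ord0 c < 2 ^ (digits * w))%N.
Proof.
have := grid_mesh_le n1 Pinj kP oP i c => /leq_ltn_trans; apply.
rewrite -expnM -expnS ltn_exp2l//.
have : (L <= 2 * w)%N by rewrite /w; lia.
by move: L0; rewrite /digits -/L; nia.
Qed.

Lemma nbits_grid : (nbits z <= digits * w)%N.
Proof. by apply/nbits_le => i c; apply: grid_lt. Qed.

(** The constant is 2960 = 4 * 740, from a node cost of at most 740 w, a number of levels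
    proportional to [w], and w ^ 2 <= 4 * 2 ^ w. *)
Definition span_total : nat := (1 + span_const d digits + 2960 * (digits * d + 1))%N.

Lemma span_le : ((span_const d digits * 2 ^ w + (nbits z * d).+1 * node_cost n).+1
  <= span_total * 2 ^ w)%N.
Proof.
have w0 : (0 < w)%N by rewrite /w; move: L0; lia.
have Lw : (L <= 2 * w)%N by rewrite /w; lia.
have ww : (w * w <= 4 * 2 ^ w)%N.
  by have := sqr_le_exp2 w; rewrite -mulnn; nia.
have nc : (node_cost n <= 740 * w)%N.
  have : (trunc_log 2 n <= L)%N by rewrite -(leq_exp2l (m := 2))//; apply: leq_trans (trunc_logP _ _) Ln => //; lia.
  by rewrite /node_cost; lia.
have nb : ((nbits z * d).+1 <= (digits * d + 1) * w)%N.
  by have := nbits_grid; move: w0; set q := digits; set r := nbits z; nia.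
have e0 : (0 < 2 ^ w)%N by rewrite expn_gt0.
have lev : ((nbits z * d).+1 * node_cost n <= 2960 * (digits * d + 1) * 2 ^ w)%N.
  apply: leq_trans (leq_mul nb nc) _; rewrite mulnACA.
  apply: leq_trans (leq_mul (leqnn _) ww) _.
  by rewrite mulnA leq_mul2r; apply/orP; right; move: (digits * d + 1)%N => q; lia.
by rewrite /span_total 2!mulnDl mul1n -addSn; apply: leq_add lev; rewrite -add1n leq_add2r.
Qed.

Let zn (i c : nat) : nat := if insub i is Some i' then coords (z i') c else 0%N.
Let code i := morton (nbits z) (z i).
Let sl := sort (relpre code leq) (enum 'I_n).

Let code_interleave i : code i = interleave d (digits * w) (zn i).
Proof.
rewrite /code mortonE /zn valK; apply/esym/interleave_widen; last exact: nbits_grid.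
move=> c cd; rewrite /coords insubT /=; exact: (iffLR (nbits_le _ _) (leqnn _)).
Qed.

Let zn_lt i c : (i < n)%N -> (c < d)%N -> (zn i c < 2 ^ (digits * w))%N.
Proof. by move=> ni cd; rewrite /zn insubT /= /coords insubT; apply: grid_lt. Qed.

Let code_inj : injective code.
Proof.
move=> i j; rewrite !code_interleave => /interleave_inj E.
apply: (grid_inj n1 Pinj kP oP); apply/rowP => c.
have := E _ _ _ (ltn_ord c); rewrite /zn !valK /coords valK; apply.
- by move=> c' cd; have := zn_lt (ltn_ord i) cd; rewrite /zn valK.
- by move=> c' cd; have := zn_lt (ltn_ord j) cd; rewrite /zn valK.
Qed.

Variable cutoff : nat.

(** Constants that multiply or must fit in a word are bounded crudely by x < 2 ^ x, and so become
    summands of the word length. *)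
Definition word_factor : nat :=
  (K d digits + 1 + (a + npass d digits + 2 * d + 10) + cutoff)%N.

Let room : (n + K d digits * 2 ^ ((a + npass d digits + 2 * d + 10) * L) <=
  2 ^ (word_factor * L))%N.
Proof.
set B := ((_ + 10) * L)%N; have LB : (2 ^ L <= 2 ^ B)%N by rewrite leq_exp2l// /B; nia.
apply: (@leq_trans ((K d digits).+1 * 2 ^ B)); first by rewrite mulSn; lia.
apply: (@leq_trans (2 ^ (K d digits).+1 * 2 ^ B)).
  by rewrite leq_mul2r (ltnW (ltn_expl _ _))// orbT.
by rewrite -expnD leq_exp2l// /word_factor /B; move: L0; nia.
Qed.

Let room_input : ((n + 1) * d + d < 2 ^ (word_factor * L))%N.
Proof.
apply: (@leq_trans (2 ^ (L + 1) * 2 ^ d)).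
  have dd : (d < 2 ^ d)%N by apply: ltn_expl.
  by rewrite expnD; apply: (@leq_trans ((n + 2) * 2 ^ d)); [|rewrite leq_mul2r; lia]; nia.
by rewrite -expnD leq_exp2l// /word_factor; move: L0; nia.
Qed.

Let room_cutoff : (cutoff < 2 ^ (word_factor * L))%N.
Proof.
apply: leq_trans (ltn_expl cutoff (isT : (1 < 2)%N)) _.
by rewrite leq_exp2l// /word_factor; move: L0; nia.
Qed.

Lemma machine_builds : exists W S,
  [/\ builds word_factor (zd_program a d digits cutoff) P o (zdtree_of cutoff z) W S,
      (W <= (work_const d digits * 2 ^ L +
        zd_cost node_cost code cutoff (nbits z * d) sl).+1)%N
    & (S <= (span_const d digits * 2 ^ w + (nbits z * d).+1 * node_cost n).+1)%N].
Proof.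
pose D := [set x : nat | (x < n.+1 * d)%N]%classic.
have Dlt i c : (i <= n)%N -> (c < d)%N -> D (i * d + c)%N by rewrite /D /=; nia.
have BL : ((a + 2) * L + npass d digits * L + L + L * d + d + 2 <
    (a + npass d digits + 2 * d + 10) * L)%N by move: L0 d0; nia.
have zE (i c : nat) : (i < n)%N -> (c < d)%N ->
    Num.truncn ((2 ^ (a * L))%:R * (layout P o (i * d + c)%N - layout P o (n * d + c)%N) /
      (layout P o (pick_pair (layout P o) (0, d)%N (pairs d)).1 -
       layout P o (pick_pair (layout P o) (0, d)%N (pairs d)).2)) = zn i c.
  move=> ni cd; rewrite (grid_round o n1 Pinj kP (Ordinal ni) (Ordinal cd)).
  by rewrite /zn insubT /= /coords insubT.
have posE p : (p < n)%N -> nth (Ordinal (ltnW n1)) sl p = nth (nth (Ordinal (ltnW n1)) sl p) sl p.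
  by move=> pn; apply: set_nth_default; rewrite size_sort size_enum_ord.
have nbP l : (nbits z <= l)%N <-> (forall i c : nat, (i < n)%N -> (c < d)%N -> (zn i c < 2 ^ l)%N).
  split=> [/nbits_le H i c ni cd|H]; first by rewrite /zn insubT /= /coords insubT.
  apply/nbits_le => i c; have := H _ _ (ltn_ord i) (ltn_ord c).
  by rewrite /zn valK /coords valK.
have DP (x : nat * nat) : x \in (0, d)%N :: pairs d ->
    [/\ (x.1 < 2 ^ (word_factor * L))%N, (x.2 < 2 ^ (word_factor * L))%N, D x.1 & D x.2].
  move=> /(pairs_mem n1 Pinj)[c cx]; have := ltn_ord c; have := room_input.
  by rewrite /D /=; case: cx => -> /=; split; nia.
have [rho [r' [h' [[W [S [A' [U' [ex [Wle Sle _ _]]]]]] ag rep]]]] :=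
  hoare_call (p := 0) (mainP d0 n1 room BL room_input room_cutoff Dlt zE zn_lt
    code_interleave code_inj erefl posE nbP DP) (fun x _ => erefl).
(* The run on [layout] provides the numbers; every other input agrees with [layout] on [D] and
   therefore has an execution with the same work and span. *)
exists W, S; split=> // inp' inpP; exists rho, h', A', U'; split.
  by apply: ex => x /(layout_unique d0 inpP).
by rewrite ag.
Qed.

Variables (X : set 'rV[R]_d) (gamma : R).
Hypothesis gamma1 : 1 <= gamma.
Hypothesis Puniq : unique_coordinates P.
Hypothesis Xconn : connected X.
Hypothesis PX : forall i, X (P i).
Hypothesis Pexp : has_expansion P X gamma.
Hypothesis cut_sparse : @sparse R d gamma < cutoff%:R.
Hypothesis cut1 : (1 < cutoff)%N.

Lemma zd_cost_linear : (zd_cost node_cost code cutoff (nbits z * d) sl)%:R <=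
  60 + 840 * (@total_const R d gamma * n%:R).
Proof.
have codeE i : code i = zcode P o g (nbits z) i by exact: mortonE.
have code0 i : (code i %/ 2 ^ (nbits z * d))%N = 0%N.
  by rewrite codeE divn_small// interleave_lt.
apply: le_trans (zd_cost_le (ltnW cut1) _ _ _) _.
- by rewrite sort_uniq enum_uniq.
- by move=> i j _ _; rewrite !code0.
- by move=> i _ j _; rewrite mem_sort mem_enum.
rewrite lerD2l; apply: ler_wpM2l; first by lra.
apply: le_trans (cell_sum gamma1 d0 n1 Puniq Xconn PX Pexp cut_sparse cut1
  (mesh_gt0 o n1 Pinj kP) _ (iffLR (nbits_le _ _) (leqnn _)) (nbits_top n1 Pinj kP oP)).
  rewrite (perm_big (enum 'I_n)) ?perm_sort//= big_enum /=.
  apply: ler_sum => i _; apply: ler_sum => k _.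
  rewrite le_eqVlt; apply/orP; left; apply/eqP; congr weight.
  by apply: eq_card => j; rewrite !inE !codeE.
by move=> i c; have /andP[] := oP i c.
Qed.

End Build.

Local Open Scope ring_scope.

Theorem theorem2p1 (R : realType) (d : nat) (gamma : R) (hgamma : 2 <= gamma) :
  exists cutoff0 : nat,
  forall (cutoff : nat) (hcutoff : (cutoff0 <= cutoff)%N) (A : R) (a : nat),
  exists (pr : program) (kappa : nat) (eps C : R),
    [/\ 0 < eps, eps < 1
      & forall (n : nat) (P : 'I_n -> 'rV[R]_d) (X : set 'rV[R]_d)
               (o : 'rV[R]_d),
          (1 < n)%N ->
          injective P ->
          unique_coordinates P ->
          dmax P / dmin P <= A * n%:R ^+ a ->
          bounded_set X -> connected X -> (forall i, X (P i)) ->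
          has_expansion P X gamma ->
          valid_offset P o ->
          exists (t : zdtree 'I_n) (W S : nat),
            [/\ is_zdtree P o cutoff t,
                builds kappa pr P o t W S,
                W%:R <= C * n%:R,
                S%:R <= C * n%:R `^ eps
              & (height t)%:R <= C * ln n%:R]].
Proof.
(* This exceeds [sparse] and is at least 2. *)
pose cutoff0 := (Num.truncn (@sparse R d gamma)).+2.
exists cutoff0 => cutoff cut A a.
(* The constant of the ratio is moved into the exponent: d * |A| <= 2 ^ A1 <= 2 ^ (A1 * L), so that
   the resolution 2 ^ (a1 * L) dominates d * A * n ^ a. *)
pose A1 := (Num.truncn (d%:R * `|A|)).+1; pose a1 := (a + A1)%N.
have A1P : d%:R * `|A| <= (2 ^ A1)%:R.
  apply: (@le_trans _ _ A1%:R); first exact/ltW/truncnS_gt.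
  by rewrite ler_nat ltnW// ltn_expl.
have gamma1 : 1 <= gamma by lra.
(* The 61 consists of the 60 in [zd_cost_linear] and the initial call, the 2 comes from 2 ^ L <= 2
   n, and the absolute value spares the sign of [total_const]. *)
pose Cw : R := 61 + 2 * (work_const d (digits a1))%:R + 840 * `|@total_const R d gamma|.
pose Cs : R := 2 * (@span_total d a1)%:R.
pose Ch : R := (digits a1 * d)%:R * (2 / ln 2).
have ln2 : 0 < ln 2 :> R by rewrite ln_gt0// ltr1n.
have Cw0 : 0 <= Cw.
  have t0 : 0 <= `|@total_const R d gamma| by exact: normr_ge0.
  have wc0 : 0 <= (work_const d (digits a1))%:R :> R by exact: ler0n.
  by rewrite /Cw; lra.
have Cs0 : 0 <= Cs.
  have sc0 : 0 <= (@span_total d a1)%:R :> R by exact: ler0n.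
  by rewrite /Cs; lra.
have Ch0 : 0 <= Ch.
  by apply: mulr_ge0; [exact: ler0n | apply: divr_ge0; [lra | exact: ltW]].
exists (zd_program a1 d (digits a1) cutoff), (@word_factor d a1 cutoff), 2^-1, (Cw + Cs + Ch).
split; [lra|lra|move=> n P X o n1 Pinj Puniq ratio _ Xconn PX Pexp oP].
set L := up_log 2 n; have L0 : (0 < L)%N by rewrite up_log_gt0.
have Ln : (n <= 2 ^ L)%N by exact: up_logP.
have nR : 1 <= n%:R :> R by rewrite ler1n ltnW.
have kP : d%:R * (dmax P / dmin P) <= (2 ^ (a1 * L))%:R.
  apply: (@le_trans _ _ (d%:R * `|A| * n%:R ^+ a)).
    rewrite -mulrA; apply: ler_wpM2l => //; apply: le_trans ratio _.
    by rewrite ler_wpM2r ?exprn_ge0// ler_norm.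
  apply: (@le_trans _ _ ((2 ^ A1)%:R * (2 ^ L)%:R ^+ a)).
    by apply: ler_pM; rewrite ?mulr_ge0 ?exprn_ge0// lerXn2r ?nnegrE// ler_nat.
  rewrite -natrX -natrM ler_nat -expnM -expnD leq_exp2l// /a1.
  by clear -L0; nia.
have cut_sparse : @sparse R d gamma < cutoff%:R.
  by apply: lt_le_trans (truncnS_gt _) _; rewrite ler_nat ltnW.
have cut1 : (1 < cutoff)%N by apply: leq_trans cut.
have [W [S [bld Wle Sle]]] := machine_builds n1 Pinj kP oP cutoff.
have cost := zd_cost_linear n1 Pinj kP oP gamma1 Puniq Xconn PX Pexp cut_sparse cut1.
exists (zdtree_of cutoff (grid P o (mesh P o (2 ^ (a1 * L))))), W, S; split.
- exists (mesh P o (2 ^ (a1 * L))); split=> //; first exact: mesh_gt0.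
  exact: grid_inj.
- exact: bld.
- apply: (@le_trans _ _ (Cw * n%:R)); last by rewrite ler_pM2r; lra.
  move: Wle; rewrite -(ler_nat R) -natr1 natrD natrM => /le_trans; apply.
  have pw : (2 ^ L)%:R <= 2 * n%:R :> R by rewrite -natrM ler_nat pow_log_le.
  have : (work_const d (digits a1))%:R * (2 ^ L)%:R <=
      (work_const d (digits a1))%:R * (2 * n%:R) :> R by apply: ler_wpM2l.
  have : @total_const R d gamma * n%:R <= `|@total_const R d gamma| * n%:R.
    by apply: ler_wpM2r; [lra|exact: ler_norm].
  by rewrite /Cw; move: cost; rewrite -/L; lra.
- rewrite powR12_sqrt; last by lra.
  apply: (@le_trans _ _ (Cs * Num.sqrt n%:R)); last first.
    by apply: ler_wpM2r; [exact: sqrtr_ge0|lra].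
  apply: (@le_trans _ _ (@span_total d a1 * 2 ^ ((L + 1) %/ 2))%:R).
    by rewrite ler_nat; exact: leq_trans Sle (span_le n1 Pinj kP oP).
  rewrite natrM /Cs -mulrA mulrCA; apply: ler_wpM2l => //; exact: half_pow_le.
- have lnn : 0 <= ln n%:R :> R by apply: ln_ge0.
  apply: (@le_trans _ _ (Ch * ln n%:R)); last by apply: ler_wpM2r => //; lra.
  apply: (@le_trans _ _ (digits a1 * d * L)%:R); last first.
    by rewrite natrM /Ch -mulrA; apply: ler_wpM2l => //; exact: log_le_ln.
  rewrite ler_nat; apply: leq_trans (height_zd_build _ _ _ _) _.
  rewrite -mulnAC leq_mul2r; apply/orP; right.
  apply: leq_trans (nbits_grid n1 Pinj kP oP) _; rewrite leq_mul2l; apply/orP; right.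
  by rewrite -/L; clear -L0; lia.
Qed.
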